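(* Let $n \geq 2$ and $p, \sigma \in \mathbb{R}$. The equation \[ -\Delta u = |x|^\sigma u^p \quad \text{in } \mathbb{R}^n \] admits at least one non-trivial, non-negative classical solution if and only if \[ n \geq 3, \quad p \geq \frac{n+2+2\sigma}{n-2}, \quad \text{and} \quad \sigma > -2. \]
   Context: A classical solution is a function $u$ belonging to $C^2(\mathbb{R}^n)$ if $\sigma \geq 0$, and to $C(\mathbb{R}^n) \cap C^2(\mathbb{R}^n \setminus \{0\})$ if $\sigma < 0$, such that the equation holds pointwise everywhere in $\mathbb{R}^n$ when $\sigma \ge 0$ and everywhere except at $x=0$ when $\sigma<0$. For $p=0$ the term $u^p$ is understood as $1$, and for $p<0$ the term $u^p$ is required to make sense, i.e. $u>0$, at each point where the equation is imposed. *)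

(* Defs.v *)
From HB Require Import structures.
From mathcomp Require Import all_boot all_order all_algebra.
From mathcomp Require Import all_classical all_reals all_analysis.
Set Implicit Arguments. Unset Strict Implicit. Unset Printing Implicit Defensive.
Import Order.TTheory GRing.Theory Num.Theory.
Import numFieldNormedType.Exports.
Local Open Scope ring_scope.
Local Open Scope classical_set_scope.

Definition basis_vec (R : realType) (n : nat) (i : 'I_n) : 'rV[R]_n :=
  \row_(j < n) (i == j)%:R.

(* Euclidean norm |x| (the canonical norm on 'rV is the sup norm, so we
   define the Euclidean one explicitly). *)
Definition eucl_norm (R : realType) (n : nat) (x : 'rV[R]_n) : R :=
  Num.sqrt (\sum_(i < n) (x ord0 i) ^+ 2).

Definition partial (R : realType) (n : nat) (i : 'I_n)
  (f : 'rV[R]_n -> R) : 'rV[R]_n -> R :=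
  fun x => 'D_(basis_vec R i) f x.

Definition laplacian (R : realType) (n : nat) (f : 'rV[R]_n -> R)
  : 'rV[R]_n -> R :=
  fun x => \sum_(i < n) partial i (partial i f) x.

Definition C2_on (R : realType) (n : nat) (U : set 'rV[R]_n)
  (f : 'rV[R]_n -> R) : Prop :=
  forall x, U x ->
    {for x, continuous f} /\
    (forall i : 'I_n,
       derivable f x (basis_vec R i) /\
       {for x, continuous (partial i f)} /\
       (forall j : 'I_n,
          derivable (partial i f) x (basis_vec R j) /\
          {for x, continuous (partial j (partial i f))})).

(* Classical solution of  -Δu = |x|^σ u^p  in R^n, following the paper's
   conventions: C^2(R^n) if σ >= 0; C(R^n) ∩ C^2(R^n \ {0}) if σ < 0, the
   equation holding everywhere (σ >= 0) or on R^n \ {0} (σ < 0); at each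
   point where the equation is imposed and p < 0 we require u > 0.
   Powers are powR (a `^ b), with 0 `^ 0 = 1, 0 `^ b = 0 for b > 0. *)
Definition classical_solution (R : realType) (n : nat) (sigma p : R)
  (u : 'rV[R]_n -> R) : Prop :=
  let E : set 'rV[R]_n := if 0 <= sigma then setT else [set x | x != 0] in
  (if 0 <= sigma then C2_on setT u
   else (forall x, {for x, continuous u}) /\ C2_on [set x | x != 0] u) /\
  (forall x, E x ->
     (p < 0 -> 0 < u x) /\
     - laplacian u x = (eucl_norm x) `^ sigma * (u x) `^ p).

(* Main.v *)
Require Import Defs.
From HB Require Import structures.
From mathcomp Require Import all_boot all_order all_algebra.
From mathcomp Require Import all_classical all_reals all_analysis.
From mathcomp Require Import ring lra.
Import Order.TTheory GRing.Theory Num.Theory.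
Import numFieldNormedType.Exports.
Local Open Scope ring_scope.
Local Open Scope classical_set_scope.
Set Implicit Arguments. Unset Strict Implicit. Unset Printing Implicit Defensive.

(* Necessity. A nonnegative nontrivial solution is superharmonic off the origin,
   hence positive by Hopf-type barriers. If sigma <= -2 the right-hand side is
   at least c |x|^(-2) near 0 and forces u to blow up at 0; if n = 2 a positive
   superharmonic function attains its minimum. If n >= 3, the minimum mu(r) of u
   over |x| = r satisfies mu(r) <= 2^(n-2) mu(2r), while the equation gives
   mu(r) >= c r^(2+sigma) mu(2r)^p; for p <= 1 this is absurd as r -> oo. For p > 1
   subcritical, u is compared with its Kelvin transforms with respect to spheres
   centred at 0: in the region outside such a sphere the transform is a strict
   subsolution, so moving the sphere from radius 0 to infinity shows that u
   dominates all of them, whence u >= c |x|^(-(n-2)/2) for |x| >= 1. This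
   contradicts the decay mu(r) <= C r^(-(2+sigma)/(p-1)).

   Sufficiency. With t = |x|^(2+sigma) / (2+sigma)^2 and
   m = 1 + (n-2)/(2+sigma), radial solutions u = V(t) solve
   t V'' + m V' + V^p = 0, V(0) = 1, and the assumption on p reads
   p >= (m+1)/(m-1). The problem with V^p truncated to 0 <= V <= 1 is solved
   globally by Picard iteration, and a first zero of V is excluded by the
   monotonicity of the Pohozaev functional. *)

(** * Second derivatives in one variable *)

(** The main obstacle is the origin: for sigma < 0 only continuity is known there. Comparisons on
    regions that reach the origin therefore add a small multiple of [polar], which is infinite at 0,
    and afterwards let it tend to 0. Minima over spheres take the place of spherical averages. They
    are compared pointwise with radial barriers, and they serve negative p as well as positive p.
    The moving spheres are centred at 0 because the weight |x|^sigma is homogeneous about 0. With b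
    = (n-2)/2 and k = L / |x|^2 < 1 outside the sphere |x|^2 = L, the transform satisfies the
    equation up to the factor k^(b + 2 + sigma - b p), which is below 1 exactly when p is
    subcritical. The final lower bound uses the sphere whose inversion carries x to the unit sphere.
    The resulting decay |x|^(-b) is slower than |x|^(-(2+sigma)/(p-1)) exactly for subcritical p.
    Radial functions are written in the variable s = |x|^2, so exponents are half of the customary
    ones. *)

Section OneVariable.
Context {R : realType}.
Implicit Types (f g h : R -> R) (t x a b c : R).

Lemma derD f g x a b : is_derive x 1 f a -> is_derive x 1 g b ->
  is_derive x 1 (fun t => f t + g t) (a + b).
Proof. by move=> fa gb; exact: (is_deriveD fa gb). Qed.

Lemma derM f g x a b : is_derive x 1 f a -> is_derive x 1 g b ->
  is_derive x 1 (fun t => f t * g t) (a * g x + f x * b).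
Proof.
move=> fa gb; apply: (is_derive_eq (is_deriveM fa gb)).
by rewrite /GRing.scale /= addrC [g x * a]mulrC.
Qed.

Lemma der_comp f g x a b : is_derive (g x) 1 f a -> is_derive x 1 g b ->
  is_derive x 1 (fun t => f (g t)) (a * b).
Proof. by move=> fa gb; exact: is_derive1_comp. Qed.

Lemma derZ c f x a : is_derive x 1 f a ->
  is_derive x 1 (fun t => c * f t) (c * a).
Proof.
move=> fa; apply: (is_derive_eq (derM (is_derive_cst c x 1) fa)).
by rewrite mul0r add0r.
Qed.

Lemma der_cst c x : is_derive x 1 (fun=> c) 0.
Proof. exact: is_derive_cst. Qed.

Lemma der_id x : is_derive x 1 (fun t => t) 1.
Proof. exact: is_derive_id. Qed.

Lemma der_cont f x a : is_derive x 1 f a -> {for x, continuous f}.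
Proof.
by move=> fa; apply: differentiable_continuous; apply/derivable1_diffP.
Qed.

Lemma der_near f g x a : (\forall t \near x, f t = g t) ->
  is_derive x 1 f a -> is_derive x 1 g a.
Proof. exact: near_eq_is_derive. Qed.

Lemma der_at_min h x a : is_derive x 1 h a ->
  (\forall s \near x, is_derive (s : R) (1 : R) h (h^`() s)) ->
  (\forall s \near x, h x <= h s) -> a = 0.
Proof.
move=> ha hd hm.
have /nbhs_ballP[e /= e0 he] : \forall s \near x,
  is_derive (s : R) (1 : R) h (h^`() s) /\ h x <= h s by apply: filterI.
have xe t : t \in `]x - e, x + e[%R -> ball x e t.
  by rewrite in_itv /= -ball_normE /= ltr_distlC => /andP[-> ->].
have H : is_derive x 1 h 0.
  apply: (@derive1_at_min _ h (x - e) (x + e)).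
  - lra.
  - by move=> t /xe /he[].
  - by rewrite in_itv /=; lra.
  - by move=> t /xe /he[].
have <- : 'D_1 h x = 0 by case: H.
by case: ha.
Qed.

(** Relational, so that the values a and b come with the existence of the first derivative near t.
    In this form second derivatives compose by the product and chain rules. *)
Definition is_derive2 h t a b := exists h1 : R -> R,
  [/\ (\forall s \near t, is_derive (s : R) (1 : R) h (h1 s)), h1 t = a & is_derive t 1 h1 b].

Lemma der2_der h t a b : is_derive2 h t a b -> is_derive t 1 h a.
Proof. by case=> h1 [/nbhs_singleton + <-]. Qed.

Lemma der2_eq h t a b a' b' : is_derive2 h t a b -> a = a' -> b = b' ->
  is_derive2 h t a' b'.
Proof. by move=> ? <- <-. Qed.

Lemma der2_cst c t : is_derive2 (fun=> c) t 0 0.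
Proof.
exists (fun=> 0); split => //; first by near=> s; exact: der_cst.
exact: der_cst.
Unshelve. all: by end_near. Qed.

Lemma der2D f g t a b a' b' : is_derive2 f t a b -> is_derive2 g t a' b' ->
  is_derive2 (fun s => f s + g s) t (a + a') (b + b').
Proof.
move=> [f1 [f1d <- f2]] [g1 [g1d <- g2]]; exists (fun s => f1 s + g1 s); split => //.
- near=> s; apply: derD.
  + by near: s.
  + by near: s.
- exact: derD.
Unshelve. all: by end_near. Qed.

Lemma der2M f g t a b a' b' : is_derive2 f t a b -> is_derive2 g t a' b' ->
  is_derive2 (fun s => f s * g s) t (a * g t + f t * a')
    (b * g t + 2 * (a * a') + f t * b').
Proof.
move=> F G; have ff := der2_der F; have gg := der2_der G.
move: F G => [f1 [f1d f1t f2]] [g1 [g1d g1t g2]].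
exists (fun s => f1 s * g s + f s * g1 s); split => //.
- near=> s; apply: derM.
  + by near: s.
  + by near: s.
- by rewrite f1t g1t.
- apply: (is_derive_eq (derD (derM f2 gg) (derM ff g2))).
  by rewrite f1t g1t; ring.
Unshelve. all: by end_near. Qed.

Lemma der2Z c f t a b : is_derive2 f t a b ->
  is_derive2 (fun s => c * f s) t (c * a) (c * b).
Proof.
move=> F; apply: (der2_eq (der2M (der2_cst c t) F)); ring.
Qed.

Lemma der2_comp f g t a b a' b' : is_derive2 f (g t) a b -> is_derive2 g t a' b' ->
  is_derive2 (fun s => f (g s)) t (a * a') (b * a' ^+ 2 + a * b').
Proof.
move=> [f1 [f1d f1t f2]] G; have gg := der2_der G.
move: G => [g1 [g1d g1t g2]].
exists (fun s => f1 (g s) * g1 s); split => //.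
- have gc := der_cont gg.
  have /gc Hc : nbhs (g t) (fun s => is_derive (s : R) (1 : R) f (f1 s)) by [].
  near=> s; apply: der_comp.
  + by near: s.
  + by near: s.
- by rewrite f1t g1t.
- apply: (is_derive_eq (derM (der_comp f2 gg) g2)).
  by rewrite f1t g1t; ring.
Unshelve. all: by end_near. Qed.

Lemma der2_near f g t a b : (\forall s \near t, f s = g s) ->
  is_derive2 f t a b -> is_derive2 g t a b.
Proof.
move=> fg [f1 [f1d f1t f2]]; exists f1; split => //.
have fgn : \forall s \near t, \forall r \near s, f r = g r by exact: near_join.
near=> s; apply: (@der_near f).
  by near: s.
by near: s.
Unshelve. all: by end_near. Qed.

(** The first derivative vanishes at a minimum. If b were negative, h' would be negative just to the
    right of t, and the mean value theorem would give a smaller value of h there. *)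
Lemma der2_min h t a b : is_derive2 h t a b ->
  (\forall s \near t, h t <= h s) -> 0 <= b.
Proof.
move=> H hm; have ha := der2_der H.
move: H => [h1 [h1d h1t h2]].
have a0 : a = 0.
  apply: der_at_min ha _ hm; near=> s.
  have : is_derive (s : R) (1 : R) h (h1 s) by near: s.
  by move=> [A B]; rewrite derive1E B.
rewrite leNgt; apply/negP => b0.
(* Carathéodory slope of h' at t: it is continuous with value b < 0, hence negative near t. *)
have [g [gE gc gt]] := (is_derive1_caratheodory h1 t b).1 h2.
have gneg : \forall s \near t, g s < 0.
  by move/cvgr_lt: gc => /(_ 0); rewrite gt; exact.
have /nbhs_ballP[e /= e0 he] : \forall s \near t,
  [/\ is_derive (s : R) (1 : R) h (h1 s), h t <= h s & g s < 0].
  near=> s; split; near: s => //.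
have be s : t <= s <= t + e / 2 -> ball t e s.
  by move=> /andP[? ?]; rewrite -ball_normE /= ltr_distlC; lra.
have te : t < t + e / 2 by lra.
have dh x : x \in `]t, (t + e / 2)[%R -> is_derive x 1 h (h1 x).
  by rewrite in_itv /= => xi; have [] : _ := he x (be x ltac:(lra)).
have ch : {within `[t, (t + e / 2)], continuous h}.
  apply: continuous_in_subspaceT => x; rewrite inE /= in_itv /= => xi.
  by have [xd _ _] : _ := he x (be x xi); exact: der_cont xd.
have [c] := MVT te dh ch.
rewrite in_itv /= => /andP[tc cte] hE.
have tci : t <= c <= t + e / 2 by rewrite !ltW.
have tei : t <= t + e / 2 <= t + e / 2 by rewrite lexx ltW.
have [_ _ gcn] := he c (be c tci).
have [_ hle _] := he (t + e / 2) (be _ tei).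
have : h1 c < 0.
  have := gE c; rewrite h1t a0 subr0 => ->.
  by rewrite nmulr_rlt0 // subr_gt0.
have te0 : 0 < t + e / 2 - t by rewrite subr_gt0.
move=> hc; have : h1 c * (t + e / 2 - t) < 0 by rewrite nmulr_rlt0.
by rewrite -hE subr_lt0 ltNge hle.
Unshelve. all: by end_near. Qed.

End OneVariable.

(** * The Laplacian along coordinate lines *)

Section Euclidean.
Context {R : realType} {n : nat}.
Implicit Types (x y z v : 'rV[R]_n) (f g u : 'rV[R]_n -> R) (i j : 'I_n) (a b c t r : R).
Notation ei i := (basis_vec R i).

(** The squared norm is polynomial, hence smooth at the origin too; it is the radial variable
    throughout. *)
Definition sqn x : R := \sum_i x ord0 i ^+ 2.

Lemma sqn_ge0 x : 0 <= sqn x.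
Proof. by apply: sumr_ge0 => i _; exact: sqr_ge0. Qed.

Lemma coord_sqn x i : x ord0 i ^+ 2 <= sqn x.
Proof.
by rewrite /sqn (bigD1 i) //= lerDl; apply: sumr_ge0 => j _; exact: sqr_ge0.
Qed.

Lemma sqn_eq0 x : (sqn x == 0) = (x == 0).
Proof.
apply/eqP/eqP => [x0|->]; last first.
  by rewrite /sqn big1 // => i _; rewrite mxE expr0n.
apply/rowP => i; rewrite mxE; apply/eqP; rewrite -sqrf_eq0 eq_le sqr_ge0 andbT.
by rewrite -x0 coord_sqn.
Qed.

Lemma sqn_gt0 x : (0 < sqn x) = (x != 0).
Proof. by rewrite lt_def sqn_ge0 andbT sqn_eq0. Qed.

Lemma sqn0 : sqn 0 = 0.
Proof. by apply/eqP; rewrite sqn_eq0. Qed.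

Lemma sqnZ a x : sqn (a *: x) = a ^+ 2 * sqn x.
Proof. by rewrite /sqn mulr_sumr; apply: eq_bigr => i _; rewrite mxE exprMn. Qed.

Lemma eucl_normE x : eucl_norm x = Num.sqrt (sqn x).
Proof. by []. Qed.

Lemma eucl_norm_powR x r : eucl_norm x `^ r = sqn x `^ (r / 2).
Proof. by rewrite eucl_normE -powR12_sqrt ?sqn_ge0 // -powRrM mulrC. Qed.

Lemma norm_sqn x : `|x| <= Num.sqrt (sqn x).
Proof.
rewrite [leLHS]/Num.Def.normr/= mx_normrE; apply: bigmax_le => [|[k i] _].
  exact: sqrtr_ge0.
by rewrite /= ord1 -sqrtr_sqr ler_sqrt ?sqn_ge0 // coord_sqn.
Qed.

Lemma coord_norm x i : `|x ord0 i| <= `|x|.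
Proof.
rewrite [leRHS]/Num.Def.normr/= mx_normrE.
exact: (le_bigmax _ (fun ij : 'I_1 * 'I_n => `|x ij.1 ij.2|) (ord0, i)).
Qed.

Lemma sum_delta i (F : 'I_n -> R) : \sum_j (i == j)%:R * F j = F i.
Proof.
rewrite (bigD1 i) //= eqxx mul1r big1 ?addr0 // => j ji.
by rewrite eq_sym (negbTE ji) mul0r.
Qed.

Lemma sqn_line x i t : sqn (x + t *: ei i) = sqn x + 2 * t * x ord0 i + t ^+ 2.
Proof.
rewrite /sqn (eq_bigr (fun j => x ord0 j ^+ 2 +
  (i == j)%:R * (2 * t * x ord0 j + t ^+ 2))).
  by rewrite big_split /= sum_delta addrA.
move=> j _; rewrite !mxE; case: (i == j) => /=; ring.
Qed.

Lemma coord_cont i : continuous (fun x => x ord0 i).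
Proof. by move=> x; exact: coord_continuous. Qed.

Lemma sqn_cont : continuous sqn.
Proof.
move=> x; rewrite /sqn.
rewrite (_ : (fun x => _) = \sum_i (fun x => x ord0 i ^+ 2)); last first.
  by apply/funext => y; rewrite fct_sumE.
apply: (big_ind (fun h : 'rV[R]_n -> R => {for x, continuous h})).
- exact: cst_continuous.
- by move=> f g fc gc; exact: continuousD.
- move=> i _; under [fun x => _]funext do rewrite expr2.
  by apply: continuousM; exact: coord_cont.
Qed.

Lemma sqn_sub_cont z : continuous (fun x => sqn (x - z)).
Proof.
move=> x; apply: (@continuous_comp _ _ _ (fun x => x - z) sqn); last exact: sqn_cont.
by apply: continuousB; [exact: cvg_id | exact: cst_continuous].
Qed.

Lemma bounded_sqn (b : R) (A : set 'rV[R]_n) : (forall x, A x -> sqn x <= b) ->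
  bounded_set A.
Proof.
move=> Ab; exists (Num.sqrt b); split; first exact: num_real.
move=> M bM x Ax /=; apply: le_trans (ltW bM).
by apply: (le_trans (norm_sqn _)); rewrite ler_wsqrtr // Ab.
Qed.

Lemma compact_sqn a b : compact [set x | a <= sqn x <= b].
Proof.
apply: bounded_closed_compact.
  by apply: (@bounded_sqn b) => x /= /andP[].
rewrite (_ : [set x | _] = (sqn @^-1` [set t | a <= t]) `&` (sqn @^-1` [set t | t <= b])).
  apply: closedI; apply: closed_comp; first by move=> ? _; exact: sqn_cont.
  - exact: closed_ge.
  - by move=> ? _; exact: sqn_cont.
  - exact: closed_le.
by apply/seteqP; split => x /= => [/andP[]|[-> ->]].
Qed.

Lemma sphere_nonempty a : (0 < n)%N -> 0 <= a -> exists x, sqn x = a.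
Proof.
move=> n0 a0; exists (Num.sqrt a *: ei (Ordinal n0)).
by rewrite -[X in sqn X]add0r sqn_line sqn0 mxE mulr0 add0r add0r sqr_sqrtr.
Qed.

Lemma line0 f x i : f (x + 0 *: ei i) = f x.
Proof. by rewrite scale0r addr0. Qed.

Lemma line_cont x i : continuous (fun t => x + t *: ei i).
Proof.
move=> t; apply: cvgD; [exact: cvg_cst | exact: scalel_continuous].
Qed.

Lemma line_near (P : set 'rV[R]_n) x i : nbhs x P ->
  \forall t \near (0 : R), P (x + t *: ei i).
Proof.
by have := @line_cont x i 0; rewrite /continuous_at scale0r addr0 => H /H.
Qed.

(* Unlike [laplacian], which is total with junk values, this relation carries
   the existence of the second derivatives, so it can be used at minima. *)
Definition has_lap f x l := exists a b : 'I_n -> R,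
  (forall i, is_derive2 (fun t => f (x + t *: ei i)) 0 (a i) (b i)) /\
  l = \sum_i b i.

Lemma has_lapD f g x l k : has_lap f x l -> has_lap g x k ->
  has_lap (fun y => f y + g y) x (l + k).
Proof.
move=> [a [b [fl ->]]] [a' [b' [gl ->]]].
exists (fun i => a i + a' i), (fun i => b i + b' i); split; last by rewrite big_split.
by move=> i; exact: der2D.
Qed.

Lemma has_lapZ c f x l : has_lap f x l -> has_lap (fun y => c * f y) x (c * l).
Proof.
move=> [a [b [fl ->]]]; exists (fun i => c * a i), (fun i => c * b i).
by split; [move=> i; exact: der2Z | rewrite mulr_sumr].
Qed.

Lemma has_lapN f x l : has_lap f x l -> has_lap (fun y => - f y) x (- l).
Proof.
move=> /(has_lapZ (-1)); rewrite mulN1r.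
by under eq_fun do rewrite mulN1r.
Qed.

Lemma has_lapB f g x l k : has_lap f x l -> has_lap g x k ->
  has_lap (fun y => f y - g y) x (l - k).
Proof. by move=> fl /has_lapN gl; exact: has_lapD. Qed.

Lemma has_lap_cst c x : has_lap (fun=> c) x 0.
Proof.
exists (fun=> 0), (fun=> 0); split; last by rewrite big1.
by move=> i; exact: der2_cst.
Qed.

Lemma has_lap_min f x l : has_lap f x l -> (\forall y \near x, f x <= f y) -> 0 <= l.
Proof.
move=> [a [b [fl ->]]] fm; apply: sumr_ge0 => i _.
apply: (der2_min (fl i)); rewrite line0.
by have := @line_near _ x i fm.
Qed.

Lemma sqn_line_der2 x z i :
  is_derive2 (fun t => sqn (x + t *: ei i - z)) 0 (2 * (x - z) ord0 i) 2.
Proof.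
exists (fun t => 2 * (x - z) ord0 i + 2 * t); split; last 2 first.
- by rewrite mulr0 addr0.
- apply: (is_derive_eq (derD (der_cst _ _) (derZ 2 (der_id _)))).
  by rewrite add0r mulr1.
near=> t.
rewrite (_ : (fun t => _) = (fun t => (sqn (x - z) + 2 * (x - z) ord0 i * t) + t * t)).
  apply: (is_derive_eq (derD (derD (der_cst _ _)
    (derZ _ (der_id _))) (derM (der_id _) (der_id _)))); ring.
by apply/funext => s; rewrite addrAC sqn_line; ring.
Unshelve. all: by end_near. Qed.

(** For F(s) = s^a the value is 2a(2a + n - 2) s^(a-1). This is the origin of the constants D below,
    and it vanishes for a = -(n-2)/2, the fundamental solution. *)
Lemma has_lap_radial (F : R -> R) x z a b : is_derive2 F (sqn (x - z)) a b ->
  has_lap (fun y => F (sqn (y - z))) x (4 * sqn (x - z) * b + 2 * n%:R * a).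
Proof.
move=> Fd.
exists (fun i => a * (2 * (x - z) ord0 i)),
  (fun i => b * (2 * (x - z) ord0 i) ^+ 2 + a * 2); split.
  move=> i; apply: der2_comp; last exact: sqn_line_der2.
  by rewrite scale0r addr0.
rewrite big_split /= sumr_const card_ord /sqn.
rewrite mulr_sumr mulr_suml -[in RHS]mulr_natr; congr (_ + _); last by ring.
by apply: eq_bigr => i _; ring.
Qed.

Lemma has_lap_radial0 (F : R -> R) x a b : is_derive2 F (sqn x) a b ->
  has_lap (fun y => F (sqn y)) x (4 * sqn x * b + 2 * n%:R * a).
Proof.
have := @has_lap_radial F x 0 a b; rewrite subr0.
by under eq_fun do rewrite subr0.
Qed.

Lemma line_derive f x v t a :
  is_derive (x + t *: v) v f a -> is_derive t 1 (fun s => f (x + s *: v)) a.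
Proof.
move=> [fd <-].
suff E : (fun h => h^-1 *: (((fun s => f (x + s *: v)) \o shift t) (h *: (1:R)) -
    f (x + t *: v))) =
  (fun h => h^-1 *: ((f \o shift (x + t *: v)) (h *: v) - f (x + t *: v))).
  by split; rewrite /derivable /derive /= in fd E *; rewrite E.
apply/funext => h /=; congr (_ *: (f _ - _)).
by rewrite [_%:A]mulr1 scalerDl addrCA addrA.
Qed.

(** Openness of U supplies the first derivative on a whole piece of each coordinate line through x,
    as [is_derive2] demands. *)
Lemma C2_has_lap (U : set 'rV[R]_n) u x : open U -> C2_on U u -> U x ->
  has_lap u x (laplacian u x).
Proof.
move=> Uo uC Ux; exists (fun i => partial i u x), (fun i => partial i (partial i u) x).
split => // i.
exists (fun t => partial i u (x + t *: ei i)); split.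
- have Un : \forall t \near (0:R), U (x + t *: ei i).
    by apply: line_near; exact: open_nbhs_nbhs.
  near=> t; apply: line_derive.
  have /uC[_ /(_ i)[uD _]] : U (x + t *: ei i) by near: t.
  exact: derivableP.
- by rewrite scale0r addr0.
- apply: line_derive; rewrite scale0r addr0.
  have [_ /(_ i)[_ [_ /(_ i)[uD _]]]] := uC _ Ux.
  exact: derivableP.
Unshelve. all: by end_near. Qed.

End Euclidean.

(** * Comparison principles *)

Section Elementary.
Context {R : realType}.
Implicit Types (s a b c d e : R).

Lemma near_pos s : 0 < s -> \forall t \near s, 0 < t.
Proof. exact: lt_nbhsr. Qed.

Lemma der2_ln s : 0 < s -> is_derive2 (@ln R) s s^-1 (- s ^- 2).
Proof.
move=> s0; exists (fun t => t^-1); split => //.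
  by near=> t; apply: is_derive1_ln; near: t; exact: near_pos.
have := is_deriveV (f := id) (lt0r_neq0 s0) (der_id s).
by rewrite /GRing.scale /= mulr1.
Unshelve. all: by end_near. Qed.

Lemma der2_powR a s : 0 < s ->
  is_derive2 (fun t => t `^ a) s (a * s `^ (a - 1)) (a * (a - 1) * s `^ (a - 2)).
Proof.
move=> s0; exists (fun t => a * t `^ (a - 1)); split => //.
  by near=> t; apply: is_derive1_powR; near: t; exact: near_pos.
apply: (is_derive_eq (derZ a (is_derive1_powR (a - 1) s0))).
by rewrite mulrA (_ : a - 1 - 1 = a - 2) //; ring.
Unshelve. all: by end_near. Qed.

Lemma der2_id s : is_derive2 (fun t => t) s 1 0.
Proof.
exists (fun=> 1); split => //; last exact: der_cst.
by near=> t; exact: der_id.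
Unshelve. all: by end_near. Qed.

(** The device by which small multiples e of an auxiliary barrier are removed: its value c at the
    point considered does not depend on e. *)
Lemma le_limit a b c : (forall e, 0 < e -> a <= b + e * c) -> a <= b.
Proof.
move=> H; rewrite leNgt; apply/negP => ba.
have c1 : 0 < `|c| + 1 by rewrite ltr_wpDl.
have ab : 0 < a - b by rewrite subr_gt0.
have e0 : 0 < (a - b) / (2 * (`|c| + 1)) by rewrite divr_gt0 // mulr_gt0.
have := H _ e0; set e := _ / _.
have : e * c <= (a - b) / 2.
  apply: (@le_trans _ _ (e * (`|c| + 1))).
    apply: ler_wpM2l; first exact: ltW.
    by apply: le_trans (ler_norm c) _; rewrite lerDl.
  by rewrite /e invfM mulrA mulfVK ?lt0r_neq0.
lra.
Qed.

Lemma powR_mulV s a : 0 < s -> s * s `^ (a - 2) = s `^ (a - 1).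
Proof.
move=> s0; rewrite -[X in X * _](powRr1 (ltW s0)) -powRD ?(lt0r_neq0 s0) ?implybT //.
by congr (_ `^ _); ring.
Qed.

Lemma powR_mulVV s a : 0 < s -> s * s `^ (a - 1) = s `^ a.
Proof.
move=> s0; rewrite -[X in X * _](powRr1 (ltW s0)) -powRD ?(lt0r_neq0 s0) ?implybT //.
by congr (_ `^ _); ring.
Qed.

(* -ln s - s is, as a function of s = |x|^2, strictly superharmonic off the
   origin in every dimension at least 2, and blows up at the origin. *)
Definition polar s : R := - ln s - s.

Lemma der2_polar s : 0 < s -> is_derive2 polar s (- s^-1 - 1) (s ^- 2).
Proof.
move=> s0; rewrite /polar.
have := der2D (der2Z (-1) (der2_ln s0)) (der2Z (-1) (der2_id s)).
under eq_fun do rewrite !mulN1r; move=> H.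
apply: (der2_eq H); first by rewrite mulN1r mulr1.
by rewrite mulr0 addr0 mulN1r opprK.
Qed.

Lemma polar_decr s a : 0 < s -> s <= a -> polar a <= polar s.
Proof.
move=> s0 sa; rewrite /polar lerB // lerN2 ler_ln // posrE //.
exact: lt_le_trans sa.
Qed.

Lemma polar_large e b : 0 < e -> exists a, [/\ 0 < a, a <= e & b <= polar a].
Proof.
move=> e0; exists (Order.min (Order.min e 1) (expR (- (b + 1)))); split.
- by rewrite !lt_min e0 ltr01 expR_gt0.
- by rewrite !ge_min lexx.
- rewrite /polar; set a := Order.min _ _.
  have a0 : 0 < a by rewrite !lt_min e0 ltr01 expR_gt0.
  have a1 : a <= 1 by rewrite !ge_min lexx orbT.
  have : ln a <= - (b + 1).
    by rewrite -[leRHS]expRK ler_ln ?posrE ?expR_gt0 // ge_min lexx orbT.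
  lra.
Qed.

Lemma powR_small b e : 0 < b -> 0 < e -> exists2 t0, 0 < t0 &
  forall t, t0 <= t -> t `^ (- b) <= e.
Proof.
move=> b0 e0; exists (e `^ (- b^-1)); first exact: powR_gt0.
move=> t et; have t0 : 0 < t by apply: lt_le_trans et; exact: powR_gt0.
rewrite powRN -[leRHS]invrK lef_pV2 ?posrE ?invr_gt0 ?powR_gt0 //.
have -> : e^-1 = (e `^ (- b^-1)) `^ b.
  by rewrite -powRrM mulNr mulVf ?lt0r_neq0 // powR_inv1 // ltW.
by apply: ge0_ler_powR et; rewrite ?nnegrE ?powR_ge0 ?ltW.
Qed.

End Elementary.

Section Continuity.
Context {R : realType} {T : topologicalType}.
Implicit Types (f g : T -> R) (x : T).

Lemma cont_cst (k : R) x : {for x, continuous (fun _ : T => k)}.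
Proof. exact: cst_continuous. Qed.

Lemma contD f g x : {for x, continuous f} -> {for x, continuous g} ->
  {for x, continuous (fun y => f y + g y)}.
Proof. by move=> fc gc; exact: (continuousD fc gc). Qed.

Lemma contB f g x : {for x, continuous f} -> {for x, continuous g} ->
  {for x, continuous (fun y => f y - g y)}.
Proof. by move=> fc gc; exact: (continuousB fc gc). Qed.

Lemma contM f g x : {for x, continuous f} -> {for x, continuous g} ->
  {for x, continuous (fun y => f y * g y)}.
Proof. by move=> fc gc; exact: (continuousM fc gc). Qed.

Lemma cont_sum m (h : 'I_m -> T -> R) x :
  (forall i, {for x, continuous (h i)}) ->
  {for x, continuous (fun y => \sum_i h i y)}.
Proof.
move=> H; rewrite (_ : (fun y => _) = \sum_i h i); last first.
  by apply/funext => y; rewrite fct_sumE.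
apply: (big_ind (fun h : T -> R => {for x, continuous h})).
- exact: cst_continuous.
- by move=> f g fc gc; exact: continuousD.
- by move=> i _; exact: H.
Qed.

End Continuity.

(** * Maximum principles on annuli and punctured balls *)

Section Comparison.
Context {R : realType} {n : nat}.
Implicit Types (x y z : 'rV[R]_n) (f g u v : 'rV[R]_n -> R) (a b c s t : R).

Lemma compact_ge0 (K : set 'rV[R]_n) f : compact K ->
  (forall x, K x -> {for x, continuous f}) ->
  (forall y, K y -> f y < 0 -> (forall z, K z -> f y <= f z) -> False) ->
  forall x, K x -> 0 <= f x.
Proof.
move=> cK cf H x Kx; rewrite leNgt; apply/negP => fx.
have K0 : K !=set0 by exists x.
have cf' : {within K, continuous f}.
  by apply: continuous_in_subspaceT => y; rewrite inE; exact: cf.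
have [c cK' cm] := EVT_min_rV K0 cK cf'.
rewrite inE in cK'; apply: (H c cK').
  by apply: le_lt_trans fx; apply: cm; rewrite inE.
by move=> z Kz; apply: cm; rewrite inE.
Qed.

Lemma sqn_gt_near a x : a < sqn x -> \forall y \near x, a < sqn y.
Proof. by move=> ax; exact: (cvgr_gt _ (@sqn_cont _ _ x)). Qed.

Lemma sqn_lt_near a x : sqn x < a -> \forall y \near x, sqn y < a.
Proof. by move=> ax; exact: (cvgr_lt _ (@sqn_cont _ _ x)). Qed.

Lemma radial_cont (F : R -> R) x z a : is_derive (sqn (x - z)) 1 F a ->
  {for x, continuous (fun y => F (sqn (y - z)))}.
Proof.
move=> Fd; apply: (@continuous_comp _ _ _ (fun y => sqn (y - z)) F).
  exact: sqn_sub_cont.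
exact: der_cont Fd.
Qed.

Lemma radial_cont0 (F : R -> R) x a : is_derive (sqn x) 1 F a ->
  {for x, continuous (fun y => F (sqn y))}.
Proof.
move=> Fd; apply: (@continuous_comp _ _ _ (fun y => sqn y) F).
  exact: sqn_cont.
exact: der_cont Fd.
Qed.

(** At an interior minimum the Laplacian is nonnegative. Its negativity is asked only at negative
    minima of f over the annulus, so the hypothesis may exploit both properties of such a point. *)
Lemma annulus_ge0 a b f :
  (forall x, a <= sqn x <= b -> {for x, continuous f}) ->
  (forall x, sqn x = a \/ sqn x = b -> 0 <= f x) ->
  (forall y, a < sqn y < b -> f y < 0 ->
    (forall z, a <= sqn z <= b -> f y <= f z) ->
    exists2 l, has_lap f y l & l < 0) ->
  forall x, a <= sqn x <= b -> 0 <= f x.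
Proof.
move=> cf bf H; apply: compact_ge0; [exact: compact_sqn | exact: cf |].
move=> y /= /andP[ay yb] fy ym.
have [ya|yna] := eqVneq (sqn y) a; first by move: fy; rewrite ltNge bf //; left.
have [yb'|ynb] := eqVneq (sqn y) b; first by move: fy; rewrite ltNge bf //; right.
have ay' : a < sqn y by rewrite lt_def yna.
have yb' : sqn y < b by rewrite lt_def eq_sym ynb.
have yab : a < sqn y < b by rewrite ay'.
have [l lf l0] := H y yab fy ym.
move: l0; rewrite ltNge => /negP; apply; apply: has_lap_min lf _.
near=> z; apply: ym; apply/andP; split; apply: ltW; near: z.
- exact: sqn_gt_near.
- exact: sqn_lt_near.
Unshelve. all: by end_near. Qed.

Lemma ball_bounded u b : continuous u -> exists M, forall x, sqn x <= b -> `|u x| <= M.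
Proof.
move=> uc; have [M [_ HM]] := @compact_bounded _ _ _
  (continuous_compact (continuous_subspaceT uc) (@compact_sqn R n 0 b)).
exists (M + 1) => x xb; apply: HM; first by rewrite ltrDl.
by exists x => //=; rewrite sqn_ge0.
Qed.

Lemma has_lap_polar x : x != 0 ->
  exists2 l, has_lap (fun y => polar (sqn y)) x l & (2 <= n)%N -> l < 0.
Proof.
rewrite -sqn_gt0 => x0; eexists; first by apply: has_lap_radial0; exact: der2_polar.
rewrite -(ler_nat R) => n2.
have -> : 4 * sqn x * sqn x ^- 2 + 2 * n%:R * (- (sqn x)^-1 - 1) =
  (4 - 2 * n%:R) / sqn x - 2 * n%:R by field; rewrite lt0r_neq0.
have : (4 - 2 * n%:R) / sqn x <= 0.
  by apply: mulr_le0_ge0; [lra | rewrite invr_ge0 ltW].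
lra.
Qed.

Definition sphere_min u y := forall z, sqn z = sqn y -> u y <= u z.

(* Only the minimizers of u over the spheres centred at 0 matter, because the
   comparison function is radial. *)
Lemma punctured_ball_bound u A mu b T : (2 <= n)%N ->
  continuous u -> 0 < b -> 0 <= A -> 0 < T ->
  (forall y, y != 0 -> sqn y < T -> sphere_min u y ->
     exists2 l, has_lap u y l & A * sqn y `^ (b - 1) <= - l) ->
  (forall y, sqn y = T -> mu <= u y) ->
  forall x, x != 0 -> sqn x <= T ->
    mu + A / (2 * b * (2 * b + n%:R - 2)) * (T `^ b - sqn x `^ b) <= u x.
Proof.
move=> n2 uc b0 A0 T0 ul uT x x0 xT.
have n2' : 2 <= n%:R :> R by rewrite ler_nat.
(* With this D, the function A / D |x|^(2b) has Laplacian A |x|^(2(b-1)). *)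
set D := 2 * b * (2 * b + n%:R - 2).
have D0 : 0 < D by rewrite /D !mulr_gt0 //; lra.
have k0 : 0 <= A / D by rewrite divr_ge0 // ltW.
(* The coefficient d of [polar] tends to 0 last, with x fixed. *)
apply: (@le_limit _ _ _ (polar (sqn x) - polar T)) => d d0.
have [M uM] := ball_bounded T uc.
have sx0 : 0 < sqn x by rewrite sqn_gt0.
(* On the inner sphere |y|^2 = a, the [polar] term exceeds everything else in f, by the bound M on
   u. *)
pose C := (M + `|mu| + A / D * T `^ b) / d + polar T.
have [a [a0 ax aC]] := polar_large C sx0.
pose W := fun s => A / D * s `^ b.
pose f y := u y - mu - A / D * T `^ b + W (sqn y) + d * (polar (sqn y) - polar T).
suff : 0 <= f x by rewrite /f /W; lra.
have fE : f = fun z => u z + (- mu - A / D * T `^ b +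
     W (sqn z) + d * (polar (sqn z) - polar T)) by apply/funext => z; rewrite /f; ring.
have der_f y : y != 0 -> exists2 l', has_lap (fun z => - mu - A / D * T `^ b +
     W (sqn z) + d * (polar (sqn z) - polar T)) y l' & l' < A * sqn y `^ (b - 1).
  move=> y0; have sy0 : 0 < sqn y by rewrite sqn_gt0.
  have [lp Hp /(_ n2) lp0] := has_lap_polar y0.
  have HW := has_lap_radial0 (der2Z (A / D) (der2_powR b sy0)).
  eexists; first exact: (has_lapD (has_lapD (has_lap_cst (- mu - A / D * T `^ b) y) HW)
    (has_lapZ d (has_lapB Hp (has_lap_cst (polar T) y)))).
  rewrite add0r subr0.
  have -> : 4 * sqn y * (A / D * (b * (b - 1) * sqn y `^ (b - 2))) +
    2 * n%:R * (A / D * (b * sqn y `^ (b - 1))) = A * sqn y `^ (b - 1).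
    rewrite -(powR_mulV b sy0) /D; field.
    by rewrite !lt0r_neq0 //; lra.
  by rewrite gtrDl pmulr_rlt0.
have cont_f y : y != 0 -> {for y, continuous f}.
  move=> y0; have sy0 : 0 < sqn y by rewrite sqn_gt0.
  rewrite fE; apply: contD; first exact: uc.
  have F := der2D (der2D (der2_cst (- mu - A / D * T `^ b) (sqn y))
    (der2Z (A / D) (der2_powR b sy0)))
    (der2Z d (der2D (der2_polar sy0) (der2_cst (- polar T) (sqn y)))).
  exact: radial_cont0 (der2_der F).
apply: (@annulus_ge0 a T) => //; last by rewrite ax xT.
- move=> y /andP[ay _]; apply: cont_f; rewrite -sqn_gt0; exact: lt_le_trans ay.
- move=> y [ya|yT]; last first.
    by rewrite /f /W yT subrr mulr0 addr0 subrK subr_ge0 uT.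
  have yT : sqn y <= T by rewrite ya (le_trans ax).
  have := uM y yT; rewrite ler_norml => /andP[uy _].
  have : M + `|mu| + A / D * T `^ b <= d * (polar a - polar T).
    by rewrite [leRHS]mulrC -ler_pdivrMr // lerBrDr.
  have := ler_norm mu.
  have : 0 <= W (sqn y) by rewrite /W mulr_ge0 // powR_ge0.
  rewrite /f ya; lra.
- move=> y /andP[ay yT] fy ym.
  have y0 : y != 0 by rewrite -sqn_gt0; exact: lt_trans ay.
  (* On the sphere through y, f and u differ by a constant, so y minimises u there as well. *)
  have uy : sphere_min u y.
    move=> z zy; have := ym z; rewrite zy (ltW ay) (ltW yT) => /(_ isT).
    rewrite /f zy; lra.
  have [l ul' lA] := ul y y0 yT uy.
  have [l' fl' l'A] := der_f y y0.
  exists (l + l'); last lra.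
  by rewrite fE; exact: has_lapD.
Qed.

Lemma nonzero_near (P : set 'rV[R]_n) : (0 < n)%N -> nbhs (0 : 'rV[R]_n) P ->
  exists2 x, x != 0 & P x.
Proof.
move=> n0 P0; pose i := Ordinal n0.
have H := line_near i P0.
have /nbhs_ballP[e /= e0 he] := H.
exists (0 + (e / 2) *: basis_vec R i).
  rewrite -sqn_gt0 sqn_line sqn0 mxE; nra.
by apply: he; rewrite -ball_normE /= sub0r normrN gtr0_norm; lra.
Qed.

(** The case A = 0 of [punctured_ball_bound]. Continuity transfers the bound to the origin, which is
    a limit of nonzero points. *)
Lemma sphere_min_ball u mu T : (2 <= n)%N -> continuous u -> 0 < T ->
  (forall y, y != 0 -> exists2 l, has_lap u y l & l <= 0) ->
  (forall y, sqn y = T -> mu <= u y) ->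
  forall x, sqn x <= T -> mu <= u x.
Proof.
move=> n2 uc T0 ul uT.
have H x : x != 0 -> sqn x <= T -> mu <= u x.
  move=> x0 xT.
  have := @punctured_ball_bound u 0 mu 1 T n2 uc ltr01 (lexx 0) T0 _ uT x x0 xT.
  rewrite !mul0r addr0; apply => y y0 yT _.
  by have [l ? l0] := ul y y0; exists l; rewrite // mul0r oppr_ge0.
move=> x xT; have [->|] := eqVneq x 0; last by move/H; apply.
rewrite leNgt; apply/negP => u0.
have : nbhs (0 : 'rV[R]_n) [set y | u y < mu /\ sqn y < T].
  have A : \forall y \near (0 : 'rV[R]_n), u y < mu by exact: (cvgr_lt _ (uc 0)).
  have B : \forall y \near (0 : 'rV[R]_n), sqn y < T by apply: sqn_lt_near; rewrite sqn0.
  by near=> y; split; near: y.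
move=> /nonzero_near[|y y0 [/= uy yT]]; first exact: leq_trans n2.
by move: uy; rewrite ltNge H // ltW.
Unshelve. all: by end_near. Qed.

End Comparison.

(** * Radial barriers, exterior bounds and strict positivity *)

Section Barriers.
Context {R : realType} {n : nat}.
Implicit Types (x y z : 'rV[R]_n) (f g u v : 'rV[R]_n -> R) (a b c s t : R).

Lemma radial_comparison v (F F1 F2 : R -> R) a b : 0 < a ->
  (forall x, a <= sqn x <= b -> {for x, continuous v}) ->
  (forall x, a < sqn x < b -> exists2 l, has_lap v x l & l <= 0) ->
  (forall s, a <= s <= b -> is_derive2 F s (F1 s) (F2 s)) ->
  (forall s, a < s < b -> 4 * s * F2 s + 2 * n%:R * F1 s < 0) ->
  (forall x, sqn x = a \/ sqn x = b -> 0 <= v x + F (sqn x)) ->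
  forall x, a <= sqn x <= b -> 0 <= v x + F (sqn x).
Proof.
move=> a0 vc vl Fd Fl vb; apply: (@annulus_ge0 _ _ a b (fun x => v x + F (sqn x))) => //.
- move=> x xab; apply: contD; first exact: vc.
  exact: radial_cont0 (der2_der (Fd _ xab)).
- move=> y yab _ _; have [l vyl l0] := vl y yab.
  have yab' : a <= sqn y <= b by case/andP: yab => *; rewrite !ltW.
  exists (l + (4 * sqn y * F2 (sqn y) + 2 * n%:R * F1 (sqn y))).
    by apply: has_lapD vyl _; apply: has_lap_radial0; exact: Fd.
  by have := Fl _ yab; lra.
Qed.

(** The function c (S/s)^b is harmonic and equals c on the inner sphere. Lowered by its value at T
    it is nonpositive on the outer sphere, so it lies below v there. The limits are eta to 0, then T
    to infinity. *)
Lemma exterior_decay v c S : (3 <= n)%N -> 0 < S -> 0 <= c ->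
  (forall x, S <= sqn x -> {for x, continuous v}) ->
  (forall x, S <= sqn x -> 0 <= v x) ->
  (forall x, S < sqn x -> exists2 l, has_lap v x l & l <= 0) ->
  (forall x, sqn x = S -> c <= v x) ->
  let b := (n%:R - 2) / 2 in
  forall x, S <= sqn x -> c * S `^ b * sqn x `^ (- b) <= v x.
Proof.
rewrite -(ler_nat R) => n3 S0 c0 vc v0 vl vS b.
have b0 : 0 < b by rewrite /b; lra.
have k0 : 0 <= c * S `^ b by rewrite mulr_ge0 // powR_ge0.
move=> x Sx.
have bound T eta : sqn x <= T -> 0 < eta ->
    c * S `^ b * sqn x `^ (- b) <= v x + c * S `^ b * T `^ (- b) + eta * (T - sqn x).
  move=> xT eta0.
  have ST : S <= T by exact: le_trans xT.
  (* The term eta (T - s) makes the comparison strict: its Laplacian is -2 n eta. *)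
  pose F s := - (c * S `^ b) * s `^ (- b) + (c * S `^ b * T `^ (- b) + eta * T) +
     (- eta) * s.
  have : 0 <= v x + F (sqn x); last by rewrite /F; lra.
  apply: (@radial_comparison v F _ _ S T).
  - exact: S0.
  - by move=> y /andP[Sy _]; exact: vc.
  - by move=> y /andP[Sy _]; exact: vl.
  - move=> s /andP[Ss _]; have s0 : 0 < s by exact: lt_le_trans Ss.
    exact: (der2D (der2D (der2Z (- (c * S `^ b)) (der2_powR (- b) s0)) (der2_cst _ s))
      (der2Z (- eta) (der2_id s))).
  - move=> s /andP[Ss _]; have s0 : 0 < s by exact: lt_trans Ss.
    have -> : 4 * s * (- (c * S `^ b) * (- b * (- b - 1) * s `^ (- b - 2)) + 0 + - eta * 0) +
      2 * n%:R * (- (c * S `^ b) * (- b * s `^ (- b - 1)) + 0 + - eta * 1) =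
      - (2 * n%:R * eta).
      by rewrite -(powR_mulV (- b) s0) /b; field.
    by rewrite oppr_lt0 !mulr_gt0 //; lra.
  - move=> y [yS|yT].
      rewrite /F yS.
      have -> : - (c * S `^ b) * S `^ (- b) = - c.
        by rewrite powRN mulNr -mulrA mulfV ?mulr1 // gt_eqF // powR_gt0.
      have : 0 <= c * S `^ b * T `^ (- b) by rewrite mulr_ge0 // powR_ge0.
      have : 0 <= eta * (T - S) by rewrite mulr_ge0 ?subr_ge0 // ltW.
      have := vS y yS; lra.
    have : 0 <= v y by apply: v0; rewrite yT.
    rewrite /F yT; lra.
  - by rewrite Sx xT.
have bound2 T : sqn x <= T ->
    c * S `^ b * sqn x `^ (- b) <= v x + c * S `^ b * T `^ (- b).
  by move=> xT; apply: (@le_limit _ _ _ (T - sqn x)) => eta eta0; exact: bound.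
apply: (@le_limit _ _ _ (c * S `^ b)) => e e0.
have [t0 t00 Ht] := powR_small b0 e0.
have := bound2 (Order.max t0 (sqn x)); rewrite le_max lexx orbT => /(_ isT).
move=> /le_trans; apply; rewrite lerD2l [leRHS]mulrC ler_wpM2l //.
by apply: Ht; rewrite le_max lexx.
Qed.

(** In the plane ln s is harmonic and unbounded: for every d > 0, c - d (ln s - ln S) becomes
    nonpositive far out, where v >= 0 suffices. Letting d tend to 0 then leaves the constant c
    itself, without any decay. *)
Lemma planar_exterior_ge v c S : n = 2 -> 0 < S -> 0 <= c ->
  (forall x, S <= sqn x -> {for x, continuous v}) ->
  (forall x, S <= sqn x -> 0 <= v x) ->
  (forall x, S < sqn x -> exists2 l, has_lap v x l & l <= 0) ->
  (forall x, sqn x = S -> c <= v x) ->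
  forall x, S <= sqn x -> c <= v x.
Proof.
move=> n2 S0 c0 vc v0 vl vS x Sx.
have x0 : 0 < sqn x by exact: lt_le_trans Sx.
apply: (@le_limit _ _ _ (ln (sqn x) - ln S)) => d d0.
(* Large enough that d (ln T - ln S) >= c. *)
pose T := Order.max (sqn x) (expR (c / d + ln S)).
have xT : sqn x <= T by rewrite le_max lexx.
have T0 : 0 < T by exact: lt_le_trans xT.
have cT : c <= d * (ln T - ln S).
  rewrite [leRHS]mulrC -ler_pdivrMr // lerBrDr -[leLHS]expRK.
  by rewrite ler_ln ?posrE ?expR_gt0 // le_max lexx orbT.
apply: (@le_limit _ _ _ (T - sqn x)) => eta eta0.
pose F s := d * ln s + (- c - d * ln S + eta * T) + (- eta) * s.
have : 0 <= v x + F (sqn x); last by rewrite /F; lra.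
apply: (@radial_comparison v F _ _ S T).
- exact: S0.
- by move=> y /andP[Sy _]; exact: vc.
- by move=> y /andP[Sy _]; exact: vl.
- move=> s /andP[Ss _]; have s0 : 0 < s by exact: lt_le_trans Ss.
  exact: (der2D (der2D (der2Z d (der2_ln s0)) (der2_cst _ s))
    (der2Z (- eta) (der2_id s))).
- move=> s /andP[Ss _]; have s0 : 0 < s by exact: lt_trans Ss.
  have -> : 4 * s * (d * - s ^- 2 + 0 + - eta * 0) +
      2 * n%:R * (d * s^-1 + 0 + - eta * 1) = - (4 * eta).
    by rewrite n2; field; rewrite lt0r_neq0.
  lra.
- move=> y [yS|yT].
    have : 0 <= eta * (T - S).
      by rewrite mulr_ge0 ?subr_ge0 ?(le_trans Sx) // ltW.
    have := vS y yS; rewrite /F yS; lra.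
  have : 0 <= v y by apply: v0; rewrite yT (le_trans Sx).
  rewrite /F yT; lra.
- by rewrite Sx xT.
Qed.

Lemma sphere_inf u T : (0 < n)%N -> 0 <= T ->
  (forall x, sqn x = T -> {for x, continuous u}) ->
  exists2 y, sqn y = T & forall x, sqn x = T -> u y <= u x.
Proof.
move=> n0 T0 uc.
have KE x : (T <= sqn x <= T) <-> sqn x = T.
  by split => [/andP[? ?]|->]; [apply: le_anti; apply/andP | rewrite lexx].
have K0 : [set x : 'rV[R]_n | T <= sqn x <= T] !=set0.
  by have [x /KE xT] := sphere_nonempty n0 T0; exists x.
have cf : {within [set x : 'rV[R]_n | T <= sqn x <= T], continuous u}.
  by apply: continuous_in_subspaceT => x; rewrite inE /= => /KE; exact: uc.
have [y] := EVT_min_rV K0 (@compact_sqn _ _ T T) cf.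
rewrite inE /= => /KE yT ym; exists y => // x xT; apply: ym.
by rewrite inE; apply/KE.
Qed.

Lemma sqn_ball (P : set 'rV[R]_n) z : nbhs z P ->
  exists2 r, 0 < r & forall y, sqn (y - z) <= r -> P y.
Proof.
move=> /nbhs_ballP[e /= e0 he]; exists ((e / 2) ^+ 2).
  by rewrite exprn_gt0 // divr_gt0.
move=> y yz; apply: he; rewrite -ball_normE /= distrC.
apply: le_lt_trans (norm_sqn _) _.
apply: (@le_lt_trans _ _ (e / 2)); last lra.
rewrite -[leRHS]gtr0_norm ?divr_gt0 // -sqrtr_sqr ler_wsqrtr //.
Qed.

Lemma sqn_le_dist y z : sqn y <= 2 * sqn (y - z) + 2 * sqn z.
Proof.
rewrite /sqn !mulr_sumr -big_split /=; apply: ler_sum => i _.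
rewrite !mxE; move: (y _ _) (z _ _) => p q.
rewrite -subr_ge0.
have -> : 2 * (p - q) ^+ 2 + 2 * q ^+ 2 - p ^+ 2 = (p - 2 * q) ^+ 2 by ring.
exact: sqr_ge0.
Qed.

(* The barrier |x - z|^(-2n) - Q^(-n) around a point z with u z > 0 is used on
   arbitrarily large balls; the origin is neutralised by a multiple of polar. *)
Lemma superharmonic_gt0 u : (2 <= n)%N -> continuous u -> (forall x, 0 <= u x) ->
  (forall x, x != 0 -> exists2 l, has_lap u x l & l <= 0) ->
  (exists z, u z != 0) -> forall x, 0 < u x.
Proof.
move=> n2 uc u0 ul [z uz0].
have n2' : 2 <= n%:R :> R by rewrite ler_nat.
have uz : 0 < u z by rewrite lt_def uz0 u0.
have H x : x != 0 -> 0 < u x.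
  move=> x0.
  have : \forall y \near z, u z / 2 < u y by apply: (cvgr_gt _ (uc z)); lra.
  move=> /sqn_ball[r r0 ur].
  have [xr|rx] := leP (sqn (x - z)) r; first by apply: lt_trans (ur _ xr); lra.
  pose Q := sqn (x - z) + 1.
  (* The power s^(-n) is strictly subharmonic: its Laplacian is 2n(n+2) s^(-n-1). *)
  pose N : R := - n%:R.
  have s_gt0 s : r <= s -> 0 < s by exact: lt_le_trans.
  (* Normalised so that the barrier is at most u z / 2 on the sphere |y - z|^2 = r, where u exceeds
     this value. *)
  pose k := u z / 2 / r `^ N.
  have k0 : 0 < k by rewrite divr_gt0 ?powR_gt0 //; lra.
  have Bdecr s s' : r <= s -> s < s' -> s' `^ N < s `^ N.
    move=> rs ss'; have s0 := s_gt0 _ rs; have s'0 := lt_trans s0 ss'.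
    have N0 : 0 < n%:R :> R by lra.
    rewrite /N !powRN ltf_pV2 ?posrE ?powR_gt0 //.
    by apply: (gt0_ltr_powR N0) ss'; rewrite nnegrE ltW.
  have Qx : Q `^ N < sqn (x - z) `^ N by apply: Bdecr; [exact: ltW | by rewrite /Q ltrDl ltr01].
  suff : k * (sqn (x - z) `^ N - Q `^ N) <= u x.
    by apply: lt_le_trans; rewrite mulr_gt0 // subr_gt0.
  pose T := 2 * Q + 2 * sqn z.
  apply: (@le_limit _ _ _ (polar (sqn x) - polar T)) => d d0.
  have sx0 : 0 < sqn x by rewrite sqn_gt0.
  have [a [a0 ax aC]] := polar_large (k * r `^ N / d + polar T) sx0.
  pose f y := u y + (- k * sqn (y - z) `^ N + k * Q `^ N + d * (polar (sqn y) - polar T)).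
  suff : 0 <= f x by rewrite /f; lra.
  pose K := [set y : 'rV[R]_n | [/\ r <= sqn (y - z), sqn (y - z) <= Q & a <= sqn y]].
  have KT y : K y -> sqn y <= T.
    by move=> [_ yQ _]; apply: le_trans (sqn_le_dist y z) _; rewrite /T; lra.
  have cK : compact K.
    apply: bounded_closed_compact; first exact: (@bounded_sqn _ _ T).
    rewrite (_ : K = ((fun y => sqn (y - z)) @^-1` [set t | r <= t]) `&`
       ((fun y => sqn (y - z)) @^-1` [set t | t <= Q]) `&` (sqn @^-1` [set t | a <= t])).
      apply: closedI; first apply: closedI; apply: closed_comp.
      - by move=> ? _; exact: sqn_sub_cont.
      - exact: closed_ge.
      - by move=> ? _; exact: sqn_sub_cont.
      - exact: closed_le.
      - by move=> ? _; exact: sqn_cont.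
      - exact: closed_ge.
    by apply/seteqP; split => y /= => [[? ? ?]|[[? ?] ?]].
  apply: (@compact_ge0 _ _ K f) => //; last first.
  - by split; [exact: ltW | rewrite /Q lerDl ler01 | ].
  - move=> y Ky fy ym; have [ry yQ ay] := Ky.
    have yz0 := s_gt0 _ ry.
    have sy0 : 0 < sqn y by exact: lt_le_trans ay.
    have y0 : y != 0 by rewrite -sqn_gt0.
    have pT : polar T <= polar (sqn y) by apply: polar_decr => //; exact: KT.
    have dpT : 0 <= d * (polar (sqn y) - polar T) by rewrite mulr_ge0 ?subr_ge0 // ltW.
    have uy := u0 y.
    have krE : k * r `^ N = u z / 2 by rewrite /k divfK // gt_eqF // powR_gt0.
    have kQ : 0 <= k * Q `^ N by rewrite mulr_ge0 ?powR_ge0 // ltW.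
    have ry' : r < sqn (y - z).
      rewrite lt_def ry andbT; apply/eqP => yr.
      have := ur y; rewrite yr lexx => /(_ isT) uzy.
      move: fy; rewrite /f yr; lra.
    have yQ' : sqn (y - z) < Q.
      rewrite lt_def yQ andbT eq_sym; apply/eqP => yr.
      move: fy; rewrite /f yr; lra.
    have ay' : a < sqn y.
      rewrite lt_def ay andbT; apply/eqP => ya.
      have : k * r `^ N <= d * (polar a - polar T).
        by rewrite [leRHS]mulrC -ler_pdivrMr // lerBrDr.
      have : k * sqn (y - z) `^ N <= k * r `^ N.
        by rewrite ler_pM2l // ltW // Bdecr.
      move: fy; rewrite /f ya; lra.
    have [l uyl l0] := ul y y0.
    have [lp Hp /(_ n2) lp0] := has_lap_polar y0.
    have HB := has_lap_radial (der2Z (- k) (der2_powR N yz0)).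
    have Hf := has_lapD uyl (has_lapD (has_lapD HB (has_lap_cst (k * Q `^ N) y))
      (has_lapZ d (has_lapB Hp (has_lap_cst (polar T) y)))).
    have : 0 <= l + (4 * sqn (y - z) * (- k * (N * (N - 1) * sqn (y - z) `^ (N - 2))) +
      2 * n%:R * (- k * (N * sqn (y - z) `^ (N - 1))) + 0 + d * (lp - 0)).
      apply: has_lap_min Hf _.
      near=> w; apply: ym; split; apply: ltW; near: w.
      + exact: (cvgr_gt _ (@sqn_sub_cont _ _ z y)).
      + exact: (cvgr_lt _ (@sqn_sub_cont _ _ z y)).
      + exact: sqn_gt_near.
    have -> : 4 * sqn (y - z) * (- k * (N * (N - 1) * sqn (y - z) `^ (N - 2))) +
      2 * n%:R * (- k * (N * sqn (y - z) `^ (N - 1))) =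
      - (k * sqn (y - z) `^ (N - 1)) * (2 * n%:R * (n%:R + 2)).
      by rewrite -(powR_mulV N yz0) /N; ring.
    have : 0 < k * sqn (y - z) `^ (N - 1) * (2 * n%:R * (n%:R + 2)).
      apply: mulr_gt0; first by rewrite mulr_gt0 // powR_gt0.
      by apply: mulr_gt0; lra.
    have : d * (lp - 0) < 0 by rewrite subr0 pmulr_rlt0.
    lra.
  - move=> y [ry yQ ay].
    have yz0 := s_gt0 _ ry.
    have sy0 : 0 < sqn y by exact: lt_le_trans ay.
    apply: contD; first exact: uc.
    apply: contD.
      have F := der2_der (der2D (der2Z (- k) (der2_powR N yz0))
        (der2_cst (k * Q `^ N) (sqn (y - z)))).
      exact: radial_cont F.
    have F := der2_der (der2Z d (der2D (der2_polar sy0) (der2_cst (- polar T) (sqn y)))).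
    exact: radial_cont0 F.
(* The value at the origin is at least the minimum over the unit sphere, already known to be
   positive. *)
move=> x; have [->|] := eqVneq x 0; last exact: H.
have n0 : (0 < n)%N by exact: leq_trans n2.
have [y y1 ym] := @sphere_inf u 1 n0 ler01 (fun x _ => uc x).
apply: (@lt_le_trans _ _ (u y)); first by apply: H; rewrite -sqn_gt0 y1.
by apply: (@sphere_min_ball _ _ u (u y) 1) => //; rewrite sqn0.
Unshelve. all: by end_near. Qed.

End Barriers.

(** * Chain rule and Kelvin transform *)

Section ChainRule.
Context {R : realType} {n : nat}.

Lemma der_sum m (h : 'I_m -> R -> R) (t : R) (a : 'I_m -> R) :
  (forall i, is_derive t 1 (h i) (a i)) ->
  is_derive t 1 (fun s => \sum_i h i s) (\sum_i a i).
Proof.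
move=> H; rewrite (_ : (fun s => _) = \sum_i h i); last first.
  by apply/funext => s; rewrite fct_sumE.
exact: is_derive_sum.
Qed.

Implicit Types (x y z : 'rV[R]_n) (u : 'rV[R]_n -> R) (i j k : 'I_n) (a b c s t : R).
Notation ei i := (basis_vec R i).

Definition C1_on (U : set 'rV[R]_n) u := forall y, U y -> forall i,
  derivable u y (ei i) /\ {for y, continuous (partial i u)}.

(** Continuous partial derivatives give total differentiability. The increment telescopes over the
    coordinates, and the mean value theorem on each segment produces a partial derivative at a point
    x + xi with |xi| <= |v|, which tends to x with v. *)
Lemma C1_caratheodory (U : set 'rV[R]_n) u x : open U -> C1_on U u -> U x ->
  exists c : 'I_n -> 'rV[R]_n -> R,
    [/\ \forall v \near (0 : 'rV[R]_n), u (x + v) - u x = \sum_k v ord0 k * c k v,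
        forall k, {for (0 : 'rV[R]_n), continuous (c k)} & forall k, c k 0 = partial k u x].
Proof.
move=> Uo uC Ux.
have /nbhs_ballP[d /= d0 dU] : nbhs x U by exact: open_nbhs_nbhs.
(* The truncation of v to its first m coordinates. *)
pose w (v : 'rV[R]_n) (m : nat) : 'rV[R]_n := \row_j if (j < m)%N then v ord0 j else 0.
have wS v k : w v k.+1 = w v k + v ord0 k *: ei k.
  apply/rowP => j; rewrite !mxE ltnS leq_eqVlt.
  have [jk|jk] := eqVneq k j.
    by rewrite jk eqxx ltnn /= mulr1 add0r.
  by rewrite /= mulr0 addr0 -(inj_eq val_inj) eq_sym in jk *; rewrite (negbTE jk).
have wn v k s : 0 <= s <= 1 -> `|w v k + (s * v ord0 k) *: ei k| <= `|v|.
  move=> /andP[s0 s1].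
  rewrite [leLHS]/Num.Def.normr/= mx_normrE; apply: bigmax_le => // -[l j] _ /=.
  rewrite ord1 !mxE; have [jk|jk] := eqVneq k j.
    rewrite jk ltnn add0r mulr1 normrM (ger0_norm s0).
    apply: le_trans (coord_norm v j); rewrite -[leRHS]mul1r.
    by apply: ler_wpM2r.
  by rewrite mulr0 addr0; case: ifP; rewrite ?normr0 // coord_norm.
have xq (q : 'rV[R]_n) : x + q - x = q by rewrite addrC addKr.
(* Stated for all v so that choice applies. For |v| >= d the point xi = 0 is only a filler. *)
have H (p : 'I_n * 'rV[R]_n) : exists xi : 'rV[R]_n, `|xi| <= `|p.2| /\
   (`|p.2| < d -> u (x + w p.2 p.1.+1) - u (x + w p.2 p.1) =
      p.2 ord0 p.1 * partial p.1 u (x + xi)).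
  case: p => k v /=; have [vd|vd] := ltP `|v| d; last first.
    by exists 0; rewrite normr0; split.
  pose h s := u (x + w v k + (s * v ord0 k) *: ei k).
  have hd s : s \in `]0, 1[%R -> is_derive s 1 h
      (partial k u (x + w v k + (s * v ord0 k) *: ei k) * v ord0 k).
    rewrite in_itv /= => /andP[s0 s1].
    apply: (@der_comp _ (fun t => u (x + w v k + t *: ei k)) (fun t => t * v ord0 k)).
      apply: line_derive; apply: derivableP.
      have [|//] := uC (x + w v k + (s * v ord0 k) *: ei k) _ k; apply: dU.
      rewrite -ball_normE /= distrC -(addrA x) xq.
      by apply: le_lt_trans vd; apply: wn; rewrite !ltW.
    apply: (is_derive_eq (derM (der_id s) (der_cst (v ord0 k) s))).
    by rewrite mul1r mulr0 addr0.
  have hc : {within `[0, 1], continuous h}.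
    apply: continuous_in_subspaceT => s; rewrite inE /= in_itv /= => s01.
    apply: (@der_cont _ h s (partial k u (x + w v k + (s * v ord0 k) *: ei k) * v ord0 k)).
    apply: (@der_comp _ (fun t => u (x + w v k + t *: ei k)) (fun t => t * v ord0 k)).
      apply: line_derive; apply: derivableP.
      have [|//] := uC (x + w v k + (s * v ord0 k) *: ei k) _ k; apply: dU.
      rewrite -ball_normE /= distrC -(addrA x) xq.
      by apply: le_lt_trans vd; apply: wn.
    apply: (is_derive_eq (derM (der_id s) (der_cst (v ord0 k) s))).
    by rewrite mul1r mulr0 addr0.
  have [s] := MVT (@ltr01 R) hd hc.
  rewrite in_itv /= => /andP[s0 s1]; rewrite /h mul1r mul0r scale0r addr0 subr0 mulr1 => hE.
  exists (w v k + (s * v ord0 k) *: ei k); split.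
    by apply: wn; rewrite !ltW.
  by move=> _; rewrite wS addrA hE addrA mulrC.
have [xi Hxi] := choice H.
exists (fun k v => partial k u (x + xi (k, v))); split.
- near=> v.
  have vd : `|v| < d.
    near: v; apply/nbhs_ballP; exists d => //= v.
    by rewrite -ball_normE /= sub0r normrN.
  transitivity (\sum_(k < n) (u (x + w v k.+1) - u (x + w v k))).
    rewrite -(big_mkord xpredT (fun m : nat => u (x + w v m.+1) - u (x + w v m))).
    rewrite telescope_sumr //; congr (u (x + _) - u _).
      by apply/rowP => j; rewrite mxE ltn_ord.
    by apply/rowP => j; rewrite !mxE addr0.
  by apply: eq_bigr => k _; have [_ /(_ vd)] := Hxi (k, v).
- move=> k; have xi0 : xi (k, 0) = 0.
    by have [+ _] := Hxi (k, 0); rewrite /= normr0 normr_le0 => /eqP.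
  have cx : {for (0 : 'rV[R]_n), continuous (fun v : 'rV[R]_n => x + xi (k, v))}.
    apply/(@cvgrPdist_le R 'rV[R]_n _ (nbhs (0 : 'rV[R]_n)) _ _ _) => e e0; near=> v.
    rewrite xi0 addr0 opprD addNKr normrN.
    have [+ _] := Hxi (k, v); move/le_trans; apply.
    near: v; apply/nbhs_ballP; exists e => //= v.
    by rewrite -ball_normE /= sub0r normrN => /ltW.
  apply: (continuous_comp cx).
  by rewrite xi0 addr0; have [] := uC x Ux k.
- move=> k; have xi0 : xi (k, 0) = 0.
    by have [+ _] := Hxi (k, 0); rewrite /= normr0 normr_le0 => /eqP.
  by rewrite xi0 addr0.
Unshelve. all: by end_near. Qed.

Lemma rV_cont (T : topologicalType) (g : T -> 'rV[R]_n) (t : T) :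
  (forall k, {for t, continuous (fun w => g w ord0 k)}) -> {for t, continuous g}.
Proof.
move=> gc; apply/cvgrPdist_le => e e0; near=> s.
rewrite [leLHS]/Num.Def.normr/= mx_normrE; apply: bigmax_le => [|[l j] _ /=].
  exact: ltW.
rewrite ord1 !mxE; move: j; near: s; apply: filter_forall => j.
by move: (gc j) => /cvgrPdist_le; apply.
Unshelve. all: by end_near. Qed.

(** Inversion bends coordinate lines, so derivatives along curves are required. The slope of the
    composite is assembled from the Carathéodory slopes of u and of the coordinates of g. *)
Lemma chain_rule (U : set 'rV[R]_n) u (g : R -> 'rV[R]_n) t (a : 'I_n -> R) :
  open U -> C1_on U u -> U (g t) ->
  (forall k, is_derive t 1 (fun s => g s ord0 k) (a k)) ->
  is_derive t 1 (fun s => u (g s)) (\sum_k a k * partial k u (g t)).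
Proof.
move=> Uo uC Ut gd.
have [c [cE cc c0]] := C1_caratheodory Uo uC Ut.
have gc : {for t, continuous g} by apply: rV_cont => k; exact: der_cont (gd k).
have gc0 : {for t, continuous (fun s => g s - g t)}.
  by apply: cvgB; [exact: gc | exact: cvg_cst].
have gc0' : (g s - g t) @[s --> t] --> (0 : 'rV[R]_n).
  by rewrite -(subrr (g t)); exact: gc0.
have /choice[q Hq] : forall k, exists q : R -> R,
    [/\ forall z : R, g z ord0 k - g t ord0 k = q z * (z - t), {for t, continuous q} & q t = a k].
  by move=> k; have [/(_ (gd k))] := is_derive1_caratheodory (fun s => g s ord0 k) t (a k).
apply: (@der_near _ (fun s => u (g t) + \sum_k (q k s * c k (g s - g t)) * (s - t))).
  near=> s.
  have : u (g t + (g s - g t)) - u (g t) = \sum_k (g s - g t) ord0 k * c k (g s - g t).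
    by near: s; have := gc0' _ cE.
  rewrite [g t + _]addrC subrK => /eqP; rewrite subr_eq addrC => /eqP ->.
  congr (_ + _); apply: eq_bigr => k _; have [+ _ _] := Hq k.
  by move=> /(_ s); rewrite !mxE => ->; ring.
apply/is_derive1_caratheodory; exists (fun s => \sum_k q k s * c k (g s - g t)); split.
- move=> z; rewrite [X in _ - (_ + X)]big1 => [|k _]; last by rewrite (subrr t) mulr0.
  by rewrite addr0 addrC addKr mulr_suml.
- apply: cont_sum => k; have [_ qc _] := Hq k; apply: contM => //.
  apply: (@continuous_comp _ _ _ (fun s => g s - g t) (c k)); first exact: gc0.
  by rewrite subrr; exact: cc.
- by apply: eq_bigr => k _; have [_ _ ->] := Hq k; rewrite subrr c0.
Unshelve. all: by end_near. Qed.

Lemma der2_chain (U : set 'rV[R]_n) u (g : R -> 'rV[R]_n) t (a b : 'I_n -> R) :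
  open U -> C2_on U u -> U (g t) ->
  (forall k, is_derive2 (fun s => g s ord0 k) t (a k) (b k)) ->
  is_derive2 (fun s => u (g s)) t (\sum_k a k * partial k u (g t))
   (\sum_k (b k * partial k u (g t) +
      a k * \sum_j a j * partial j (partial k u) (g t))).
Proof.
move=> Uo uC Ut gd.
have uC1 : C1_on U u by move=> y /uC[_ H] i; have [? [? _]] := H i.
have uC1' k : C1_on U (partial k u).
  by move=> y /uC[_ H] i; have [_ [_ /(_ i)[? ?]]] := H k.
have gdt k := der2_der (gd k).
have gc : {for t, continuous g} by apply: rV_cont => k; exact: der_cont (gdt k).
have gU : \forall s \near t, U (g s) := gc _ (open_nbhs_nbhs (conj Uo Ut)).
have /choice[g1 Hg] := gd.
exists (fun s => \sum_k g1 k s * partial k u (g s)); split.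
- near=> s; apply: chain_rule Uo uC1 _ _.
    by near: s; exact: gU.
  near: s; apply: filter_forall => k; by have [] := Hg k.
- by apply: eq_bigr => k _; have [_ -> _] := Hg k.
- apply: der_sum => k; have [_ ga gb] := Hg k; rewrite -ga.
  apply: derM => //; apply: chain_rule Uo (uC1' k) Ut gdt.
Unshelve. all: by end_near. Qed.

End ChainRule.

(** * The Laplacian of the Kelvin transform *)

Section Kelvin.
Context {R : realType} {n : nat}.
Implicit Types (x y z : 'rV[R]_n) (u : 'rV[R]_n -> R) (i j k : 'I_n) (a b c s t L : R).
Notation ei i := (basis_vec R i).
Local Notation b := ((n%:R - 2) / 2 : R).

Lemma open_neq0 : open [set x : 'rV[R]_n | x != 0].
Proof.
rewrite (_ : [set x | _] = sqn @^-1` [set t | 0 < t]).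
  by apply: open_comp; [move=> ? _; exact: sqn_cont | exact: open_gt].
by apply/seteqP; split => x /=; rewrite sqn_gt0.
Qed.

(* L is the square of the radius of the inversion. *)
Definition kelvin L u x : R := L `^ b * sqn x `^ (- b) * u ((L / sqn x) *: x).

Lemma sum_deltal i (F : 'I_n -> R) : \sum_j F j * (i == j)%:R = F i.
Proof. by under eq_bigr do rewrite mulrC; exact: sum_delta. Qed.

Lemma sum_deltar i (F : 'I_n -> R) : \sum_j F j * (j == i)%:R = F i.
Proof. by under eq_bigr do rewrite eq_sym; exact: sum_deltal. Qed.

Lemma line_sqn_der2 x i :
  is_derive2 (fun t => sqn (x + t *: ei i)) 0 (2 * x ord0 i) 2.
Proof.
have := sqn_line_der2 x 0 i; rewrite subr0.
by under eq_fun do rewrite subr0.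
Qed.

(* The second order terms are controlled by the conformality of the inversion,
   and the first order terms cancel because 2 b = n - 2. *)
Lemma has_lap_kelvin L u x : C2_on [set x : 'rV[R]_n | x != 0] u -> x != 0 -> 0 < L ->
  has_lap (kelvin L u) x
    (L `^ b * sqn x `^ (- b) * (L / sqn x) ^+ 2 * laplacian u ((L / sqn x) *: x)).
Proof.
move=> uC x0 L0; have q0 : 0 < sqn x by rewrite sqn_gt0.
set q := sqn x in q0 *; have qN : q != 0 by rewrite gt_eqF.
pose y := (L / q) *: x.
have y0 : y != 0 by rewrite scaler_eq0 (negbTE x0) orbF gt_eqF // divr_gt0.
pose d i k : R := (i == k)%:R.
pose p1 i : R := - q ^- 2 * (2 * x ord0 i).
pose p2 i : R := 2 * q ^- 3 * (2 * x ord0 i) ^+ 2 + - q ^- 2 * 2.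
have hp i : is_derive2 (fun t => (sqn (x + t *: ei i))^-1) 0 (p1 i) (p2 i).
  have H : is_derive2 (fun s : R => s^-1) (sqn (x + 0 *: ei i)) (- q ^- 2) (2 * q ^- 3).
    rewrite line0 -/q; have := der2_powR (- 1 : R) q0.
    have E s : 0 < s -> s `^ (- 1) = s^-1 by move=> s0; rewrite powR_inv1 // ltW.
    move=> H; apply: (@der2_near _ (fun s => s `^ (- 1))).
      by near=> s; apply: E; near: s; exact: near_pos.
    apply: (der2_eq H).
      rewrite mulN1r (_ : - 1 - 1 = - 2%:R) ?powR_invn ?ltW //; ring.
    rewrite (_ : - 1 - 2 = - 3%:R) ?powR_invn ?ltW //; ring.
  exact: (der2_comp H (line_sqn_der2 x i)).
pose r0 : R := q `^ (- b).
pose r1 i : R := - b * q `^ (- b - 1) * (2 * x ord0 i).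
pose r2 i : R := - b * (- b - 1) * q `^ (- b - 2) * (2 * x ord0 i) ^+ 2 +
  - b * q `^ (- b - 1) * 2.
have hr i : is_derive2 (fun t => sqn (x + t *: ei i) `^ (- b)) 0 (r1 i) (r2 i).
  have H : is_derive2 (fun s : R => s `^ (- b)) (sqn (x + 0 *: ei i))
      (- b * q `^ (- b - 1)) (- b * (- b - 1) * q `^ (- b - 2)).
    by rewrite line0; exact: der2_powR.
  exact: (der2_comp H (line_sqn_der2 x i)).
pose A i k : R := L * (d i k * q^-1 + x ord0 k * p1 i).
pose B i k : R := L * (2 * d i k * p1 i + x ord0 k * p2 i).
pose g i t := (L / sqn (x + t *: ei i)) *: (x + t *: ei i).
have g0 i : g i 0 = y by rewrite /g !scale0r !addr0.
have hg i k : is_derive2 (fun t => g i t ord0 k) 0 (A i k) (B i k).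
  have hl : is_derive2 (fun t : R => x ord0 k + d i k * t) 0 (d i k) 0.
    have := der2D (der2_cst (x ord0 k) 0) (der2Z (d i k) (der2_id (0 : R))).
    by rewrite !add0r mulr1 mulr0.
  have H := der2Z L (der2M hl (hp i)).
  rewrite (_ : (fun t => g i t ord0 k) =
    (fun t => L * ((x ord0 k + d i k * t) * (sqn (x + t *: ei i))^-1))); last first.
    by apply/funext => t; rewrite /g /d !mxE; ring.
  apply: (der2_eq H); rewrite /A /B line0 -/q !mulr0 !addr0; ring.
have y0' i : [set x : 'rV[R]_n | x != 0] (g i 0) by rewrite g0.
have hU i := der2_chain open_neq0 uC (y0' i) (hg i).
pose U1 i := \sum_k A i k * partial k u y.
pose U2 i := \sum_k (B i k * partial k u y +
  A i k * \sum_j A i j * partial j (partial k u) y).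
have {}hU i : is_derive2 (fun t => u (g i t)) 0 (U1 i) (U2 i).
  by rewrite /U1 /U2 -(g0 i); exact: hU.
exists (fun i => L `^ b * (r1 i * u y + r0 * U1 i)),
  (fun i => L `^ b * (r2 i * u y + 2 * (r1 i * U1 i) + r0 * U2 i)); split.
  move=> i; have H := der2Z (L `^ b) (der2M (hr i) (hU i)).
  rewrite (_ : (fun t => kelvin L u _) =
    (fun t => L `^ b * (sqn (x + t *: ei i) `^ (- b) * u (g i t)))); last first.
    by apply/funext => t; rewrite /kelvin mulrA.
  by apply: (der2_eq H); rewrite g0 line0 -/q.
rewrite -mulr_sumr -!(mulrA (L `^ b)) -/r0 -/y; congr (_ * _).
have qr1 : q `^ (- b - 1) = r0 / q.
  by rewrite /r0 -(powR_mulVV (- b) q0) mulrAC mulfV // mul1r.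
have qr2 : q `^ (- b - 2) = r0 / q / q.
  by rewrite -qr1 -(powR_mulV (- b) q0) mulrAC mulfV // mul1r.
have sx : \sum_i x ord0 i * x ord0 i = q.
  by rewrite /q /sqn; apply: eq_bigr => i _; rewrite expr2.
(* Harmonicity of |x|^(-(n-2)). *)
have sr2 : \sum_i r2 i = 0.
  rewrite (eq_bigr (fun i => (4 * b * (b + 1) * r0 / q / q) * (x ord0 i * x ord0 i) -
    2 * b * r0 / q)); last by move=> i _; rewrite /r2 qr1 qr2; ring.
  rewrite big_split /= -mulr_sumr sx sumr_const card_ord -mulr_natr; field.
  exact: qN.
(* Conformality: the differential of the inversion is L / q times a reflection. *)
have sA k j : \sum_i A i k * A i j = L ^+ 2 / q ^+ 2 * d k j.
  rewrite (eq_bigr (fun i => L ^+ 2 / q ^+ 2 * (d i j * d i k) -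
    2 * L ^+ 2 / q ^+ 3 * x ord0 j * (x ord0 i * d i k) -
    2 * L ^+ 2 / q ^+ 3 * x ord0 k * (x ord0 i * d i j) +
    4 * L ^+ 2 / q ^+ 4 * x ord0 k * x ord0 j * (x ord0 i * x ord0 i))); last first.
    by move=> i _; rewrite /A /p1; field.
  rewrite !big_split /= !sumrN -!mulr_sumr /d !sum_deltar sx /=.
  by field.
(* The cross terms between the factor |x|^(-2b) and the inversion cancel the Laplacian of the
   inversion's coordinates. *)
have s1 k : \sum_i (2 * (r1 i * A i k) + r0 * B i k) = 0.
  rewrite (eq_bigr (fun i => (- 4 * b * r0 * L / q ^+ 2 - 4 * r0 * L / q ^+ 2) *
      (x ord0 i * d i k) +
    (8 * b * r0 * L / q ^+ 3 * x ord0 k + 8 * r0 * L / q ^+ 3 * x ord0 k) *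
      (x ord0 i * x ord0 i) - 2 * r0 * L / q ^+ 2 * x ord0 k)); last first.
    by move=> i _; rewrite /r1 qr1 /A /B /p1 /p2; field.
  rewrite !big_split /= -!mulr_sumr /d sum_deltar sx sumr_const card_ord -mulr_natr.
  by field.
rewrite !big_split /= -mulr_suml sr2 mul0r add0r.
have <- : \sum_k partial k u y * \sum_i (2 * (r1 i * A i k) + r0 * B i k) +
  r0 * \sum_k \sum_j partial j (partial k u) y * \sum_i A i k * A i j =
  r0 * (L / q) ^+ 2 * laplacian u y.
  rewrite [X in X + _ = _]big1 => [|k _]; last by rewrite s1 mulr0.
  rewrite add0r -mulrA; congr (_ * _).
  rewrite /laplacian [RHS]mulr_sumr; apply: eq_bigr => k _.
  rewrite (eq_bigr (fun j => L ^+ 2 / q ^+ 2 * (d k j * partial j (partial k u) y))).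
    by rewrite -mulr_sumr sum_delta; field.
  by move=> j _; rewrite sA; ring.
have -> : \sum_k partial k u y * \sum_i (2 * (r1 i * A i k) + r0 * B i k) =
  \sum_i \sum_k partial k u y * (2 * (r1 i * A i k) + r0 * B i k).
  by rewrite [RHS]exchange_big /=; apply: eq_bigr => k _; rewrite mulr_sumr.
have -> : \sum_k \sum_j partial j (partial k u) y * (\sum_i A i k * A i j) =
  \sum_i \sum_k A i k * \sum_j A i j * partial j (partial k u) y.
  rewrite [RHS]exchange_big /=; apply: eq_bigr => k _.
  rewrite (eq_bigr (fun j => \sum_i partial j (partial k u) y * (A i k * A i j))).
    rewrite exchange_big /=; apply: eq_bigr => i _.
    by rewrite mulr_sumr; apply: eq_bigr => j _; ring.
  by move=> j _; rewrite mulr_sumr.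
rewrite mulr_sumr -!big_split /=; apply: eq_bigr => i _.
rewrite /U1 /U2 big_split /= mulrDr addrA; congr (_ + _).
rewrite !mulr_sumr -big_split /=; apply: eq_bigr => k _; ring.
Unshelve. all: by end_near. Qed.

End Kelvin.

(** * Nonexistence outside the superlinear range *)

Section Nonexistence.
Context {R : realType} {n : nat}.
Implicit Types (x y z : 'rV[R]_n) (u : 'rV[R]_n -> R) (sigma p s c L T A : R).
Local Notation b := ((n%:R - 2) / 2 : R).

(** The common content of both cases of the definition of a solution: the equation is kept only off
    the origin, so necessity treats both signs of sigma at once. *)
Definition positive_solution sigma p u := [/\ continuous u, forall x, 0 < u x,
  C2_on [set x : 'rV[R]_n | x != 0] u &
  forall x, x != 0 -> laplacian u x = - (sqn x `^ (sigma / 2) * u x `^ p)].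

Lemma classical_solution_positive sigma p u : (2 <= n)%N ->
  classical_solution sigma p u -> (forall x, 0 <= u x) -> (exists x, u x != 0) ->
  positive_solution sigma p u.
Proof.
move=> n2 [uC uE] u0 un0.
have [uc uC2 uE'] : [/\ continuous u, C2_on [set x : 'rV[R]_n | x != 0] u &
  forall x, x != 0 -> - laplacian u x = eucl_norm x `^ sigma * u x `^ p].
  move: uC uE => /=; case: ifP => _ => [uC uE|[uc uC] uE].
    split; first by move=> x; have [] := uC x I.
      by move=> x _; exact: uC.
    by move=> x _; have [_] := uE x I.
  by split => // x /uE[].
have uE2 x : x != 0 -> laplacian u x = - (sqn x `^ (sigma / 2) * u x `^ p).
  by move=> x0; rewrite -eucl_norm_powR -uE' // opprK.
split => //; apply: superharmonic_gt0 => // x x0.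
exists (laplacian u x); first exact: C2_has_lap open_neq0 uC2 x0.
by rewrite uE2 // oppr_le0 mulr_ge0 ?powR_ge0.
Qed.

Lemma solution_has_lap sigma p u x : positive_solution sigma p u -> x != 0 ->
  has_lap u x (- (sqn x `^ (sigma / 2) * u x `^ p)).
Proof.
by move=> [_ _ uC uE] x0; rewrite -uE //; exact: C2_has_lap open_neq0 uC x0.
Qed.

Lemma solution_lap_lt0 sigma p u x : positive_solution sigma p u -> x != 0 ->
  - (sqn x `^ (sigma / 2) * u x `^ p) < 0.
Proof. by move=> [_ u0 _ _] x0; rewrite oppr_lt0 mulr_gt0 ?powR_gt0 ?sqn_gt0. Qed.

Lemma solution_superharmonic sigma p u x : positive_solution sigma p u -> x != 0 ->
  exists2 l, has_lap u x l & l <= 0.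
Proof.
move=> uS x0; exists (- (sqn x `^ (sigma / 2) * u x `^ p)).
  exact: solution_has_lap.
by rewrite ltW // (solution_lap_lt0 uS).
Qed.

Lemma powR_unbounded (a C : R) : 0 < a -> exists2 t : R, 1 <= t & C < t `^ a.
Proof.
move=> a0; exists ((Num.max C 0 + 1) `^ a^-1); last first.
  rewrite -powRrM mulVf ?gt_eqF // powRr1; last by rewrite addr_ge0 // le_max lexx orbT.
  by apply: (@le_lt_trans _ _ (Num.max C 0)); rewrite ?le_max ?lexx // ltrDl.
rewrite -[leLHS](powRr0 (Num.max C 0 + 1)); apply: ler_powR.
  by rewrite lerDr le_max lexx orbT.
by rewrite invr_ge0 ltW.
Qed.

(** Near 0, u^p >= A by continuity, and for |x| <= 1 and sigma <= -2 the weight is at least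
    |x|^(2(be-1)) for every be > 0. The resulting lower bound carries a factor 1/be, which is
    unbounded as be tends to 0, whereas u < 2w near 0. *)
Lemma no_solution_sigma sigma p u : (2 <= n)%N -> positive_solution sigma p u ->
  -2 < sigma.
Proof.
move=> n2 uS; rewrite ltNge; apply/negP => sg.
have [uc u0 _ _] := uS.
have n2' : 2 <= n%:R :> R by rewrite ler_nat.
have n0 : (0 < n)%N by exact: leq_trans n2.
have := u0 0; set w := u 0 => w0.
have /sqn_ball[r r0 ur] : \forall y \near (0 : 'rV[R]_n), w / 2 < u y < 2 * w.
  have A : \forall y \near (0 : 'rV[R]_n), w / 2 < u y.
    by apply: (cvgr_gt _ (uc 0)); rewrite -/w; lra.
  have B : \forall y \near (0 : 'rV[R]_n), u y < 2 * w.
    by apply: (cvgr_lt _ (uc 0)); rewrite -/w; lra.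
  by near=> y; apply/andP; split; near: y.
pose A : R := Num.min ((w / 2) `^ p) ((2 * w) `^ p).
have A0 : 0 < A by rewrite lt_min !powR_gt0 //; lra.
pose T : R := Num.min r 1.
have T0 : 0 < T by rewrite lt_min r0 ltr01.
have T1 : T <= 1 by rewrite ge_min lexx orbT.
have Tr : T <= r by rewrite ge_min lexx.
have urT y : sqn y <= T -> w / 2 < u y < 2 * w.
  by move=> yT; apply: ur; rewrite subr0; exact: le_trans Tr.
have uA y : sqn y <= T -> A <= u y `^ p.
  move=> /urT /andP[y1 y2]; rewrite ge_min.
  have uy := u0 y; have w2 : 0 < w / 2 by lra.
  have w2' : 0 < 2 * w by lra.
  have [p0|p0] := leP 0 p.
    by apply/orP; left; apply: (ge0_ler_powR p0); rewrite ?nnegrE ?ltW.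
  apply/orP; right; rewrite -[p]opprK !(powRN _ (- p)).
  rewrite lef_pV2 ?posrE ?powR_gt0 //.
  by apply: ge0_ler_powR; rewrite ?nnegrE ?ltW ?oppr_gt0.
(* So small that the lower bound A T / (4 be n) is at least 4w. *)
pose be : R := Num.min 1 (A * T / (16 * n%:R * w)).
have be0 : 0 < be.
  rewrite lt_min ltr01 divr_gt0 ?mulr_gt0 //; lra.
have be1 : be <= 1 by rewrite ge_min lexx.
have beA : be * (16 * n%:R * w) <= A * T.
  rewrite -ler_pdivlMr; first by rewrite ge_min lexx orbT.
  by rewrite !mulr_gt0 //; lra.
(* The radius is chosen so that |x|^(2 be) is half of T^be. *)
have [x xE] := @sphere_nonempty R n (T * 2 `^ (- be^-1)) n0 (mulr_ge0 (ltW T0) (powR_ge0 _ _)).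
have xT : sqn x <= T.
  rewrite xE ger_pMr // powRN invf_le1 ?powR_gt0 //.
  by rewrite -[leLHS](powRr0 2) ler_powR ?invr_ge0 ?(ltW be0) //; lra.
have x0 : x != 0 by rewrite -sqn_gt0 xE mulr_gt0 // powR_gt0.
have := @punctured_ball_bound R n u A 0 be T n2 uc be0 (ltW A0) T0 _ _ x x0 xT.
have -> : sqn x `^ be = T `^ be / 2.
  rewrite xE powRM ?powR_ge0 ?ltW //; congr (_ * _).
  by rewrite -powRrM mulNr mulVf ?gt_eqF // powR_inv1.
rewrite add0r => H.
have {H} : A / (2 * be * (2 * be + n%:R - 2)) * (T `^ be - T `^ be / 2) <= u x.
  apply: H => [y y0 yT _|y _]; last exact: ltW.
  have sy : 0 < sqn y by rewrite sqn_gt0.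
  exists (- (sqn y `^ (sigma / 2) * u y `^ p)); first exact: solution_has_lap.
  rewrite opprK mulrC; apply: ler_pM; rewrite ?powR_ge0 ?(ltW A0) ?uA ?(ltW yT) //.
  by apply: ger_powR; [rewrite sy (le_trans (ltW yT)) | lra].
have /andP[_ ux] := urT x xT.
have T01 : 0 < T <= 1 by rewrite T0.
have TT : T <= T `^ be by have := ger_powR T01 be1; rewrite powRr1 // ltW.
have : A * T / (4 * be * n%:R) <= A / (2 * be * (2 * be + n%:R - 2)) * (T `^ be - T `^ be / 2).
  have -> : A * T / (4 * be * n%:R) = A / (2 * be * n%:R) * (T / 2).
    by field; rewrite !gt_eqF //; lra.
  apply: ler_pM.
  - by rewrite divr_ge0 ?mulr_ge0 // ltW.
  - by rewrite divr_ge0 // ltW.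
  - rewrite ler_pM2l // lef_pV2 ?posrE ?mulr_gt0 //; try lra.
    by rewrite ler_pM2l ?mulr_gt0 //; lra.
  - lra.
have : 4 * w <= A * T / (4 * be * n%:R).
  rewrite ler_pdivlMr ?mulr_gt0 //; last lra.
  by have -> : 4 * w * (4 * be * n%:R) = be * (16 * n%:R * w) by ring.
lra.
Unshelve. all: by end_near. Qed.

(** The minimum over the unit circle is global: inside by the ball principle, outside by the planar
    one. It is attained away from 0, where the equation makes the Laplacian negative. *)
Lemma no_solution_planar sigma p u : n = 2 -> ~ positive_solution sigma p u.
Proof.
move=> n2 uS; have [uc u0 _ _] := uS.
have n0 : (0 < n)%N by rewrite n2.
have n2' : (2 <= n)%N by rewrite n2.
have [y y1 ym] := @sphere_inf R n u 1 n0 ler01 (fun x _ => uc x).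
have y0 : y != 0 by rewrite -sqn_gt0 y1.
have Hmin x : u y <= u x.
  have [x1|/ltW x1] := leP (sqn x) 1.
    apply: (@sphere_min_ball _ _ u (u y) 1) => //.
    by move=> z z0; exact: solution_superharmonic uS z0.
  apply: (@planar_exterior_ge _ _ u (u y) 1) => //.
  - exact: ltW.
  - by move=> z _; exact: uc.
  - by move=> z _; exact: ltW.
  - move=> z z1; apply: (solution_superharmonic uS).
    by rewrite -sqn_gt0; exact: lt_trans z1.
have : 0 <= - (sqn y `^ (sigma / 2) * u y `^ p).
  apply: has_lap_min (solution_has_lap uS y0) _.
  by near=> z; exact: Hmin.
by rewrite leNgt (solution_lap_lt0 uS).
Unshelve. all: by end_near. Qed.

(* Comparison of the minimum over the sphere |x|^2 = T with the one over
   |x|^2 = T / 4: superharmonicity loses at most a factor 4^b, while the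
   equation gains the term A T^(1 + sigma / 2). *)
Lemma sphere_min_lower sigma p u : (3 <= n)%N -> -2 < sigma ->
  positive_solution sigma p u ->
  exists2 C, 0 < C & forall T A y, 0 < T -> 0 <= A -> sqn y = T -> sphere_min u y ->
    (forall z, z != 0 -> sqn z < T -> sphere_min u z -> A <= u z `^ p) ->
    C * A * T `^ (1 + sigma / 2) <= u y.
Proof.
move=> n3 sg uS; have [uc u0 _ _] := uS.
have n2 : (2 <= n)%N by exact: ltnW.
have n0 : (0 < n)%N by exact: leq_trans n3.
have n3' : 3 <= n%:R :> R by rewrite ler_nat.
pose be : R := 1 + sigma / 2.
have be0 : 0 < be by rewrite /be; lra.
have b0 : 0 < b by lra.
pose D : R := 2 * be * (2 * be + n%:R - 2).
have D0 : 0 < D by rewrite /D !mulr_gt0 //; lra.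
have q1 : (4^-1 : R) `^ be < 1.
  by have := @gt0_ltr_powR R be be0 4^-1 1; rewrite powR1 !nnegrE; apply; lra.
(* The factor with D is the gain between |x|^2 = T / 4 and |x|^2 = T, where the ball bound itself
   degenerates; 4^(-b) is the loss in carrying the value back out to T. *)
exists (4 `^ (- b) * ((1 - 4^-1 `^ be) / D)).
  by rewrite mulr_gt0 ?powR_gt0 // divr_gt0 // subr_gt0.
move=> T A y T0 A0 yT ym HA.
have T40 : 0 < T / 4 by rewrite divr_gt0.
have [y' y'E y'm] := @sphere_inf R n u (T / 4) n0 (ltW T40) (fun x _ => uc x).
have y'0 : y' != 0 by rewrite -sqn_gt0 y'E.
have H1 : A / D * (T `^ be - (T / 4) `^ be) <= u y'.
  have := @punctured_ball_bound R n u A 0 be T n2 uc be0 A0 T0 _ _ y' y'0.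
  rewrite y'E add0r -/D; apply.
  - move=> z z0 zT zm; exists (- (sqn z `^ (sigma / 2) * u z `^ p)).
      exact: solution_has_lap.
    rewrite opprK mulrC (_ : be - 1 = sigma / 2); last by rewrite /be; ring.
    by apply: ler_wpM2l; [exact: powR_ge0 | exact: HA].
  - by move=> z _; exact: ltW.
  - lra.
have H2 : u y' * (T / 4) `^ b * sqn y `^ (- b) <= u y.
  apply: (@exterior_decay R n u (u y') (T / 4)) => //.
  - exact: ltW.
  - by move=> z _; exact: uc.
  - by move=> z _; exact: ltW.
  - move=> z z1; apply: (solution_superharmonic uS).
    by rewrite -sqn_gt0; exact: lt_trans z1.
  - by rewrite yT; lra.
have E1 : (T / 4) `^ b * sqn y `^ (- b) = 4 `^ (- b).
  rewrite yT powRM ?(ltW T0) // mulrAC -powRD ?(gt_eqF T0) ?implybT //.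
  by rewrite subrr powRr0 mul1r -powR_inv1 // -powRrM mulN1r.
have E2 : (T / 4) `^ be = T `^ be * 4^-1 `^ be by rewrite powRM // ltW.
rewrite -mulrA E1 in H2; apply: le_trans H2; rewrite -/be [leRHS]mulrC.
rewrite -!mulrA ler_pM2l ?powR_gt0 //.
apply: le_trans H1; rewrite E2 -subr_ge0 le_eqVlt; apply/orP; left; apply/eqP.
by ring.
Qed.

Lemma sphere_min_le sigma p u y z : (2 <= n)%N -> positive_solution sigma p u ->
  sphere_min u y -> y != 0 -> sqn z <= sqn y -> u y <= u z.
Proof.
move=> n2 uS ym y0 zy; have [uc _ _ _] := uS.
apply: (@sphere_min_ball _ _ u (u y) (sqn y)) => //.
- by rewrite sqn_gt0.
- by move=> w w0; exact: solution_superharmonic uS w0.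
Qed.

(** Sphere minima decrease with the radius, so a sphere minimum u z inside lies between u y and u 0.
    As p - 1 <= 0, u z ^ p >= u y * B with B = u(0)^(p-1). The factor u y then cancels, and C B T^(1
    + sigma/2) <= 1 would hold for all large T. *)
Lemma no_solution_sublinear sigma p u : (3 <= n)%N -> -2 < sigma -> p <= 1 ->
  ~ positive_solution sigma p u.
Proof.
move=> n3 sg p1 uS; have [uc u0 _ _] := uS.
have [C C0 HC] := sphere_min_lower n3 sg uS.
have n2 : (2 <= n)%N by exact: ltnW.
have n0 : (0 < n)%N by exact: leq_trans n3.
pose B := u 0 `^ (p - 1).
have B0 : 0 < B by exact: powR_gt0.
have be0 : 0 < 1 + sigma / 2 by lra.
have [T T1 TC] := powR_unbounded (C * B)^-1 be0.
have T0 : 0 < T by exact: lt_le_trans T1.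
have [y yT ym] := @sphere_inf R n u T n0 (ltW T0) (fun x _ => uc x).
have y0 : y != 0 by rewrite -sqn_gt0 yT.
have ym' : sphere_min u y by move=> z; rewrite yT; exact: ym.
have : C * (u y * B) * T `^ (1 + sigma / 2) <= u y.
  apply: HC => //; first by rewrite mulr_ge0 // ltW.
  move=> z z0 zT zm.
  have yz : u y <= u z by apply: (sphere_min_le n2 uS) => //; rewrite yT ltW.
  have z0u : u z <= u 0 by apply: (sphere_min_le n2 uS) => //; rewrite sqn0 sqn_ge0.
  rewrite -(powR_mulVV p (u0 z)); apply: ler_pM => //; try exact: ltW.
  rewrite /B -[p - 1]opprK !(powRN _ (- (p - 1))) lef_pV2 ?posrE ?powR_gt0 //.
  have p1' : 0 <= - (p - 1) by lra.
  by apply: (ge0_ler_powR p1'); rewrite ?nnegrE ?(ltW (u0 _)).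
have -> : C * (u y * B) * T `^ (1 + sigma / 2) = u y * (C * B * T `^ (1 + sigma / 2)).
  by ring.
rewrite ger_pMr // -ler_pdivlMl ?mulr_gt0 // mulr1.
by rewrite leNgt TC.
Qed.

(** With A = u(y)^p, [sphere_min_lower] gives C u(y)^(p-1) T^(1 + sigma/2) <= 1. Inserting the
    assumed lower bound at |y|^2 = T leaves a power of T whose exponent cannot be positive. *)
Lemma no_solution_slow_decay sigma p u c : (3 <= n)%N -> -2 < sigma -> 1 < p ->
  positive_solution sigma p u -> 0 < c ->
  (forall x, 1 <= sqn x -> c * sqn x `^ (- (b / 2)) <= u x) ->
  2 + sigma <= b * (p - 1).
Proof.
move=> n3 sg p1 uS c0 Hc; have [uc u0 _ _] := uS.
rewrite leNgt; apply/negP => pb.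
have [C C0 HC] := sphere_min_lower n3 sg uS.
have n2 : (2 <= n)%N by exact: ltnW.
have n0 : (0 < n)%N by exact: leq_trans n3.
have p0 : 0 <= p - 1 by lra.
pose e := 1 + sigma / 2 - b / 2 * (p - 1).
have e0 : 0 < e by rewrite /e; lra.
have Cc : 0 < C * c `^ (p - 1) by rewrite mulr_gt0 // powR_gt0.
have [T T1 TC] := powR_unbounded (C * c `^ (p - 1))^-1 e0.
have T0 : 0 < T by exact: lt_le_trans T1.
have [y yT ym] := @sphere_inf R n u T n0 (ltW T0) (fun x _ => uc x).
have y0 : y != 0 by rewrite -sqn_gt0 yT.
have ym' : sphere_min u y by move=> z; rewrite yT; exact: ym.
have : C * (u y * u y `^ (p - 1)) * T `^ (1 + sigma / 2) <= u y.
  apply: HC => //; first by rewrite mulr_ge0 ?powR_ge0 // ltW.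
  move=> z z0 zT zm.
  have yz : u y <= u z by apply: (sphere_min_le n2 uS) => //; rewrite yT ltW.
  rewrite (powR_mulVV p (u0 y)); by apply: ge0_ler_powR; rewrite ?nnegrE ?(ltW (u0 _)) //; lra.
have -> : C * (u y * u y `^ (p - 1)) * T `^ (1 + sigma / 2) =
  u y * (C * u y `^ (p - 1) * T `^ (1 + sigma / 2)) by ring.
rewrite ger_pMr // => H.
have H1 : C * c `^ (p - 1) * T `^ e <= C * u y `^ (p - 1) * T `^ (1 + sigma / 2).
  rewrite -!mulrA ler_pM2l //.
  have -> : T `^ (1 + sigma / 2) = (T `^ (b / 2)) `^ (p - 1) * T `^ e.
    rewrite -powRrM -powRD ?(gt_eqF T0) ?implybT //.
    by congr (_ `^ _); rewrite /e; ring.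
  rewrite mulrA ler_pM2r ?powR_gt0 //.
  rewrite -powRM ?powR_ge0 ?(ltW (u0 _)) //.
  apply: ge0_ler_powR => //; rewrite ?nnegrE ?mulr_ge0 ?powR_ge0 ?(ltW (u0 _)) ?(ltW c0) //.
  have := Hc y; rewrite yT T1 => /(_ isT).
  by rewrite powRN ler_pdivrMr // powR_gt0.
have : C * c `^ (p - 1) * T `^ e <= 1 by exact: le_trans H.
by rewrite -ler_pdivlMl // mulr1 leNgt TC.
Qed.

End Nonexistence.

(** * Moving spheres centred at the origin *)

Section MovingSpheres.
Context {R : realType} {n : nat}.
Implicit Types (x y z : 'rV[R]_n) (u : 'rV[R]_n -> R) (sigma p s c L T A : R).
Local Notation b := ((n%:R - 2) / 2 : R).

Lemma powR_diff_le p (a c : R) : 1 < p -> 0 < a -> a < c ->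
  c `^ p - a `^ p <= p * c `^ (p - 1) * (c - a).
Proof.
move=> p1 a0 ac.
have hd t : t \in `]a, c[%R -> is_derive t 1 (fun t => t `^ p) (p * t `^ (p - 1)).
  by rewrite in_itv /= => /andP[at0 _]; apply: is_derive1_powR; exact: lt_trans at0.
have hc : {within `[a, c], continuous (fun t => t `^ p)}.
  apply: continuous_in_subspaceT => t; rewrite inE /= in_itv /= => /andP[at0 _].
  by apply: der_cont (is_derive1_powR p _); exact: lt_le_trans at0.
have [t] := MVT ac hd hc; rewrite in_itv /= => /andP[at0 tc] ->.
rewrite ler_pM2r ?subr_gt0 // ler_pM2l; last by lra.
have p0 : 0 <= p - 1 by lra.
by apply: (ge0_ler_powR p0); rewrite ?nnegrE ?ltW // (lt_trans a0) // (lt_trans at0).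
Qed.

Lemma kelvin0 u x : (3 <= n)%N -> kelvin 0 u x = 0.
Proof.
rewrite -(ler_nat R) => n3; rewrite /kelvin powR0 ?mul0r //.
by rewrite gt_eqF //; lra.
Qed.

Lemma kelvin_sphere u x : x != 0 -> kelvin (sqn x) u x = u x.
Proof.
rewrite -sqn_gt0 => x0.
rewrite /kelvin divff ?gt_eqF // scale1r -powRD ?(gt_eqF x0) ?implybT //.
by rewrite subrr powRr0 mul1r.
Qed.

Lemma kelvinE L u x : 0 <= L ->
  kelvin L u x = (L / sqn x) `^ b * u ((L / sqn x) *: x).
Proof.
move=> L0; rewrite /kelvin powRM ?invr_ge0 ?sqn_ge0 //.
by rewrite -(powR_inv1 (sqn_ge0 x)) -(powRrM _ (-1)) mulN1r.
Qed.

Lemma kelvin_continuous L u x : continuous u -> x != 0 ->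
  {for x, continuous (kelvin L u)}.
Proof.
move=> uc; rewrite -sqn_gt0 => x0; apply: contM.
  exact: radial_cont0 (derZ (L `^ b) (is_derive1_powR (- b) x0)).
have sc : {for x, continuous (fun y => L / sqn y)}.
  apply: (@radial_cont0 _ _ (fun s => L / s)).
  exact: (derZ L (is_deriveV (f := id) (lt0r_neq0 x0) (der_id _))).
have zc : {for x, continuous (fun y : 'rV[R]_n => (L / sqn y) *: y)}.
  apply: rV_cont => k.
  rewrite (_ : (fun y => _) = (fun y => L / sqn y * y ord0 k)); last first.
    by apply/funext => y; rewrite !mxE.
  by apply: contM; [exact: sc | exact: coord_cont].
exact: (continuous_comp zc (uc _)).
Qed.

(** With k = L / |x|^2, the two sides carry the factors k^(b + 2 + sigma) and k^(b p). Since k < 1,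
    the first is strictly smaller precisely when b (p - 1) < 2 + sigma. *)
Lemma kelvin_subsolution sigma p u L x : positive_solution sigma p u ->
  b * (p - 1) < 2 + sigma -> 0 < L -> L < sqn x ->
  exists2 l, has_lap (kelvin L u) x l &
    - l < sqn x `^ (sigma / 2) * kelvin L u x `^ p.
Proof.
move=> [uc u0 uC uE] pb L0 Lx; have q0 := lt_trans L0 Lx.
have x0 : x != 0 by rewrite -sqn_gt0.
have k0 : 0 < L / sqn x by rewrite divr_gt0.
have k1 : L / sqn x < 1 by rewrite ltr_pdivrMr ?mul1r.
eexists; first exact: has_lap_kelvin.
set k := L / sqn x in k0 k1 *; set y := k *: x.
have y0 : y != 0 by rewrite scaler_eq0 negb_or gt_eqF.
rewrite uE // mulrN opprK sqnZ kelvinE ?(ltW L0) // -/k -/y.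
have -> : L `^ b * sqn x `^ (- b) = k `^ b.
  have := @kelvinE L (fun=> 1) x (ltW L0); rewrite /kelvin !mulr1; exact.
have uy := u0 y.
have -> : (k ^+ 2 * sqn x) `^ (sigma / 2) = k `^ sigma * sqn x `^ (sigma / 2).
  rewrite powRM ?sqn_ge0 ?exprn_ge0 ?(ltW k0) //; congr (_ * _).
  rewrite -(powR_mulrn 2 (ltW k0)) -powRrM; congr (_ `^ _).
  by rewrite mulrCA mulfV ?mulr1.
rewrite powRM ?powR_ge0 ?(ltW uy) // -powRrM.
have -> : k `^ b * k ^+ 2 * (k `^ sigma * sqn x `^ (sigma / 2) * u y `^ p) =
  sqn x `^ (sigma / 2) * (k `^ (b + 2 + sigma) * u y `^ p).
  have kN : k != 0 by rewrite gt_eqF.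
  rewrite powRD ?kN ?implybT // [k `^ (b + 2)]powRD ?kN ?implybT //.
  by rewrite (powR_mulrn 2 (ltW k0)); ring.
rewrite ltr_pM2l ?powR_gt0 // ltr_pM2r ?powR_gt0 //.
rewrite /powR (gt_eqF k0) ltr_expR ltr_nM2r ?ln_lt0 ?k0 //; lra.
Qed.

(** The value L = 0 is included as the starting point of the continuation; the transform vanishes
    there for n >= 3, and [x != 0] then has to be stated separately. *)
Definition dominates L u := forall x, x != 0 -> L <= sqn x -> kelvin L u x <= u x.

(* Maximum principle on a thin annulus, uniformly in L: phi = 1 + K (rho^be - s^be)
   is a positive strict supersolution of the linearised equation there. For L0 = 0
   this starts the moving spheres, for L0 > 0 it continues them. *)
Lemma narrow_annulus sigma p u L0 : (3 <= n)%N -> -2 < sigma -> 1 < p ->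
  b * (p - 1) < 2 + sigma -> positive_solution sigma p u -> 0 <= L0 ->
  exists2 rho, L0 < rho & forall L, L0 <= L -> L < rho ->
    (forall x, sqn x = rho -> kelvin L u x <= u x) ->
    forall x, x != 0 -> L <= sqn x <= rho -> kelvin L u x <= u x.
Proof.
move=> n3 sg p1 pb uS L00; have [uc u0 _ _] := uS.
have n3' : 3 <= n%:R :> R by rewrite ler_nat.
have b0 : 0 < b by lra.
have [M HM] := ball_bounded (L0 + 1) uc.
have M0 : 0 < M.
  have := HM 0; rewrite sqn0 (_ : 0 <= L0 + 1); last lra.
  by move=> /(_ isT); apply: lt_le_trans; rewrite normr_gt0 gt_eqF.
pose be : R := 1 + sigma / 2.
have be0 : 0 < be by rewrite /be; lra.
pose D : R := 2 * be * (2 * be + n%:R - 2).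
have D0 : 0 < D by rewrite /D !mulr_gt0 //; lra.
pose Mp := p * M `^ (p - 1).
have Mp0 : 0 < Mp by rewrite mulr_gt0 ?powR_gt0 //; lra.
(* [Mp] is a Lipschitz constant of the power on [0, M]. With phi <= 2, the Laplacian - K D |x|^sigma
   of phi must outweigh 2 [Mp]. *)
pose K := (2 * Mp + 1) / D.
have K0 : 0 < K by rewrite divr_gt0 //; lra.
(* Thin enough that K (rho^be - s^be) <= 1 for s >= L0, so that phi lies between 1 and 2 on the
   annulus. *)
pose rho0 := (L0 `^ be + K^-1) `^ be^-1.
have rho0E : rho0 `^ be = L0 `^ be + K^-1.
  by rewrite -powRrM mulVf ?gt_eqF // powRr1 // addr_ge0 ?powR_ge0 // invr_ge0 ltW.
have rho0_ge0 : 0 <= rho0 by exact: powR_ge0.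
have L0rho0 : L0 < rho0.
  rewrite ltNge; apply/negP => h.
  have : rho0 `^ be <= L0 `^ be.
    by apply: ge0_ler_powR h; rewrite ?nnegrE ?rho0_ge0 ?(ltW be0).
  by rewrite rho0E gerDl leNgt invr_gt0 K0.
pose rho := Num.min rho0 (L0 + 1).
have rho_le : rho <= L0 + 1 by rewrite ge_min lexx orbT.
have Lrho : L0 < rho by rewrite lt_min L0rho0 ltrDl ltr01.
have r0 : 0 < rho by exact: le_lt_trans Lrho.
have Krho t : L0 <= t -> K * (rho `^ be - t `^ be) <= 1.
  move=> Lt; rewrite -ler_pdivlMl // mulr1.
  have : rho `^ be <= L0 `^ be + K^-1.
    rewrite -rho0E; apply: ge0_ler_powR; rewrite ?nnegrE ?rho0_ge0 ?(ltW be0) ?(ltW r0) //.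
    by rewrite ge_min lexx.
  have : L0 `^ be <= t `^ be.
    have t0 : 0 <= t by exact: le_trans Lt.
    by apply: ge0_ler_powR Lt; rewrite ?nnegrE ?(ltW be0).
  lra.
exists rho => // L L0L Lr HL.
have L_ge0 : 0 <= L by exact: le_trans L0L.
have [L_eq0|Ln0] := eqVneq L 0.
  by move=> x _ _; rewrite L_eq0 kelvin0 // ltW.
have L_gt0 : 0 < L by rewrite lt_def Ln0.
pose phi s := 1 + K * rho `^ be + (- K) * s `^ be.
have phi_ge1 s : 0 < s -> s <= rho -> 1 <= phi s.
  move=> s0 sr; rewrite /phi mulNr -addrA -mulrBr lerDl mulr_ge0 ?(ltW K0) //.
  by rewrite subr_ge0; apply: ge0_ler_powR sr; rewrite ?nnegrE ?(ltW be0) ?(ltW s0) ?(ltW r0).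
have phi_le2 s : L0 <= s -> phi s <= 2.
  move=> /Krho; rewrite /phi; lra.
have phi_der2 s : 0 < s -> is_derive2 phi s (0 + - K * (be * s `^ (be - 1)))
    (0 + - K * (be * (be - 1) * s `^ (be - 2))).
  by move=> s0; exact: (der2D (der2_cst _ s) (der2Z (- K) (der2_powR be s0))).
(* Dividing by phi absorbs the zeroth order term of the linearised equation, whose sign is wrong for
   a direct maximum principle. *)
pose f x := (u x - kelvin L u x) * (phi (sqn x))^-1.
suff H : forall x, L <= sqn x <= rho -> 0 <= f x.
  move=> x x0 xL; have := H x xL; case/andP: xL => _ xr.
  rewrite /f pmulr_lge0 ?subr_ge0 // invr_gt0.
  by apply: lt_le_trans (phi_ge1 _ _ xr) => //; rewrite sqn_gt0.
have posx x : L <= sqn x -> 0 < sqn x by exact: lt_le_trans.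
apply: annulus_ge0.
- move=> x /andP[Lx xr]; have sx0 := posx x Lx.
  have x0 : x != 0 by rewrite -sqn_gt0.
  apply: contM; first by apply: contB; [exact: uc | exact: kelvin_continuous].
  have ph0 : phi (sqn x) != 0 by rewrite gt_eqF // (lt_le_trans ltr01) // phi_ge1.
  have Hd := is_deriveV ph0 (der2_der (phi_der2 _ sx0)).
  exact: (radial_cont0 Hd).
- move=> x xb.
  have x0 : x != 0 by rewrite -sqn_gt0; case: xb => ->.
  have xr : sqn x <= rho by case: xb => -> //; exact: ltW.
  rewrite /f mulr_ge0 //; last first.
    by rewrite invr_ge0 (le_trans ler01) // phi_ge1 // sqn_gt0.
  case: xb => [xL|xr']; last by rewrite subr_ge0 HL.
  by rewrite -xL kelvin_sphere ?subrr.
- move=> y /andP[Ly yr] fy ym.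
  have sy0 : 0 < sqn y by exact: lt_trans Ly.
  have y0 : y != 0 by rewrite -sqn_gt0.
  have [l kl lk] := kelvin_subsolution uS pb L_gt0 Ly.
  pose k := - f y.
  have k0 : 0 < k by rewrite oppr_gt0.
  have ph1 := phi_ge1 _ sy0 (ltW yr).
  have ph2 := phi_le2 _ (le_trans L0L (ltW Ly)).
  have kphi : kelvin L u y - u y = k * phi (sqn y).
    rewrite /k /f; field.
    by rewrite gt_eqF // (lt_le_trans ltr01).
  exfalso.
  have Hl := has_lapD (has_lapB (solution_has_lap uS y0) kl)
    (has_lapZ k (has_lap_radial0 (phi_der2 _ sy0))).
  have := has_lap_min Hl.
  have -> : 4 * sqn y * (0 + - K * (be * (be - 1) * sqn y `^ (be - 2))) +
    2 * n%:R * (0 + - K * (be * sqn y `^ (be - 1))) = - (K * D) * sqn y `^ (sigma / 2).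
    have E1 : sqn y `^ (be - 1) = sqn y `^ (sigma / 2).
      by congr (_ `^ _); rewrite /be; ring.
    by rewrite -E1 -(powR_mulV be sy0) /D; ring.
  (* With - k the minimum of the quotient, u - kelvin + k phi is nonnegative near y and vanishes at
     y, so its Laplacian there is nonnegative. *)
  have nn : \forall z \near y, u y - kelvin L u y + k * phi (sqn y) <=
      u z - kelvin L u z + k * phi (sqn z).
    near=> z.
    have Lz : L < sqn z by near: z; exact: sqn_gt_near.
    have zr : sqn z < rho by near: z; exact: sqn_lt_near.
    have z0 := lt_trans L_gt0 Lz.
    have phz : 0 < phi (sqn z) by rewrite (lt_le_trans ltr01) // phi_ge1 // ltW.
    rewrite (_ : u y - _ + _ = 0); last by move: kphi; lra.
    have := ym z; rewrite (ltW Lz) (ltW zr) => /(_ isT); rewrite {2}/f ler_pdivlMr //.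
    by rewrite /k mulNr; lra.
  move=> /(_ nn); apply/negP; rewrite -ltNge.
  have kM : kelvin L u y <= M.
    have yk : L / sqn y <= 1 by rewrite ler_pdivrMr ?mul1r // ltW.
    rewrite kelvinE //.
    apply: (@le_trans _ _ (u ((L / sqn y) *: y))).
      rewrite ger_pMl //.
      have : (L / sqn y) `^ b <= 1 `^ b.
        apply: (ge0_ler_powR (ltW b0)) yk; rewrite nnegrE ?ler01 //.
        by rewrite divr_ge0 // ltW.
      by rewrite powR1.
    apply: le_trans (ler_norm _) (HM _ _); rewrite sqnZ.
    apply: (@le_trans _ _ L); last by apply: ltW (lt_le_trans Lr rho_le).
    have -> : (L / sqn y) ^+ 2 * sqn y = L * (L / sqn y) by field; rewrite gt_eqF.
    by rewrite ger_pMr.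
  have kp : 0 < kelvin L u y - u y by rewrite kphi mulr_gt0 // (lt_le_trans ltr01).
  have pd := powR_diff_le p1 (u0 y) (_ : u y < kelvin L u y).
  have {}pd : kelvin L u y `^ p - u y `^ p <= 2 * Mp * k.
    apply: le_trans (pd _) _; first by rewrite -subr_gt0.
    rewrite kphi; apply: (@le_trans _ _ (Mp * (k * 2))); last lra.
    apply: ler_pM.
    - by rewrite mulr_ge0 ?powR_ge0 //; lra.
    - by rewrite mulr_ge0 ?(ltW k0) // (le_trans ler01).
    - rewrite ler_pM2l; last lra.
      apply: ge0_ler_powR kM; rewrite ?nnegrE ?ltW //; last by move: (u0 y) kp; lra.
      by rewrite subr_gt0.
    - by rewrite ler_pM2l.
  have KD : K * D = 2 * Mp + 1 by rewrite /K divfK // gt_eqF.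
  have Q0 : 0 < sqn y `^ (sigma / 2) by exact: powR_gt0.
  rewrite KD; apply: (@lt_trans _ _ (sqn y `^ (sigma / 2) *
    (kelvin L u y `^ p - u y `^ p - k * (2 * Mp + 1)))).
    move: lk; lra.
  rewrite pmulr_rlt0 //; move: pd; lra.
Unshelve. all: by end_near. Qed.

End MovingSpheres.

(** * Continuation of the moving spheres and the necessary conditions *)

Section MovingSpheresContinuation.
Context {R : realType} {n : nat}.
Implicit Types (x y z : 'rV[R]_n) (u : 'rV[R]_n -> R) (sigma p s c L T A : R).
Local Notation b := ((n%:R - 2) / 2 : R).

(** Joint continuity in (z, L) with compactness of the ball. After z = x / |x|^2, this ball stands
    for the whole exterior domain. *)
Lemma scaled_uniform u L0 T (e : R) : continuous u -> 0 < e ->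
  \forall L \near L0, forall z, sqn z <= T -> `|u (L *: z) - u (L0 *: z)| <= e.
Proof.
move=> uc e0.
have cK := (@compact_near_coveringP _ _).1 (@compact_sqn R n 0 T).
have := cK R (nbhs L0) (fun L z => `|u (L *: z) - u (L0 *: z)| <= e) _.
have H : forall x, [set x : 'rV[R]_n | 0 <= sqn x <= T] x ->
    \forall x' \near x & L \near L0, `|u (L *: x') - u (L0 *: x')| <= e.
  move=> x _.
  have jc : {for (x, L0), continuous (fun w : 'rV[R]_n * R => u (w.2 *: w.1))}.
    apply: (@continuous_comp _ _ _ (fun w : 'rV[R]_n * R => w.2 *: w.1) u); last exact: uc.
    apply: rV_cont => k.
    rewrite (_ : (fun v => _) = (fun v : 'rV[R]_n * R => v.2 * v.1 ord0 k)); last first.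
      by apply/funext => v; rewrite mxE.
    apply: contM; first exact: cvg_snd.
    apply: (@continuous_comp _ _ _ fst (fun y : 'rV[R]_n => y ord0 k)).
      exact: cvg_fst.
    exact: coord_cont.
  have e2 : 0 < e / 2 by rewrite divr_gt0.
  have C1 : \forall w \near (x, L0), `|u (L0 *: x) - u (w.2 *: w.1)| <= e / 2.
    exact: ((cvgrPdist_le _ _).1 jc _ e2).
  have C2 : \forall w \near (x, L0), `|u (L0 *: x) - u (L0 *: w.1)| <= e / 2.
    have jc2 : {for (x, L0), continuous (fun w : 'rV[R]_n * R => u (L0 *: w.1))}.
      apply: (@continuous_comp _ _ _ fst (fun z => u (L0 *: z))); first exact: cvg_fst.
      apply: continuous_comp; last exact: uc.
      exact: scaler_continuous.
    exact: ((cvgrPdist_le _ _).1 jc2 _ e2).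
  near=> w.
  rewrite (_ : u _ - _ = (u (L0 *: x) - u (L0 *: w.1)) - (u (L0 *: x) - u (w.2 *: w.1))).
    apply: le_trans (ler_normB _ _) _; rewrite [leRHS]splitr lerD //.
      by near: w.
    by near: w.
  by ring.
move=> /(_ _ H); apply: filterS => L HL z zT; apply: HL.
by rewrite /= sqn_ge0.
Unshelve. all: by end_near. Qed.

(** Outside |x|^2 = rho the difference w is bounded below by eta |x|^(-2b). A small increase of L
    changes the transform by at most that much, uniformly up to infinity. The remaining thin annulus
    is covered by [narrow_annulus]. *)
Lemma dominates_open sigma p u L0 : (3 <= n)%N -> -2 < sigma -> 1 < p ->
  b * (p - 1) < 2 + sigma -> positive_solution sigma p u -> 0 <= L0 ->
  dominates L0 u -> exists2 L1, L0 < L1 & forall L, L0 <= L -> L < L1 -> dominates L u.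
Proof.
move=> n3 sg p1 pb uS L00 dom; have [uc u0 _ _] := uS.
have n0 : (0 < n)%N by exact: leq_trans n3.
have n3' : 3 <= n%:R :> R by rewrite ler_nat.
have b0 : 0 < b by lra.
have [rho Lrho Hrho] := narrow_annulus n3 sg p1 pb uS L00.
have r0 : 0 < rho by exact: le_lt_trans Lrho.
pose w x := u x - kelvin L0 u x.
have w_ge0 x : rho <= sqn x -> 0 <= w x.
  move=> rx; rewrite subr_ge0; apply: dom; first by rewrite -sqn_gt0 (lt_le_trans r0).
  by apply: ltW; exact: lt_le_trans rx.
have w_cont x : rho <= sqn x -> {for x, continuous w}.
  move=> rx; apply: contB; first exact: uc.
  by apply: kelvin_continuous uc _; rewrite -sqn_gt0 (lt_le_trans r0).
have w_lap x : L0 < sqn x -> exists2 l, has_lap w x l & l <= 0 /\ (w x = 0 -> l < 0).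
  move=> Lx; have sx0 := le_lt_trans L00 Lx.
  have x0 : x != 0 by rewrite -sqn_gt0.
  have wE : kelvin L0 u x <= u x by apply: dom => //; exact: ltW.
  have p0 : 0 <= p by lra.
  have Q0 : 0 < sqn x `^ (sigma / 2) by exact: powR_gt0.
  have [L0E|L0N] := eqVneq L0 0.
    exists (- (sqn x `^ (sigma / 2) * u x `^ p)).
      rewrite (_ : w = u); first exact: solution_has_lap.
      by apply/funext => z; rewrite /w L0E kelvin0 // subr0.
    by have := solution_lap_lt0 uS x0; split; [exact: ltW|].
  have L0_gt0 : 0 < L0 by rewrite lt_def L0N.
  have [l kl lk] := kelvin_subsolution uS pb L0_gt0 Lx.
  exists (- (sqn x `^ (sigma / 2) * u x `^ p) - l).
    exact: has_lapB (solution_has_lap uS x0) kl.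
  have K0 : 0 <= kelvin L0 u x by rewrite !mulr_ge0 ?powR_ge0 // ltW.
  have le : sqn x `^ (sigma / 2) * kelvin L0 u x `^ p <= sqn x `^ (sigma / 2) * u x `^ p.
    rewrite ler_pM2l //; apply: ge0_ler_powR wE => //.
    by rewrite nnegrE ltW.
  by split; [|move=> _]; move: lk le; lra.
have wc : forall x, sqn x = rho -> {for x, continuous w}.
  by move=> x xr; apply: w_cont; rewrite xr.
have [y yr ym] := sphere_inf n0 (ltW r0) wc.
(* A zero of w would be an interior minimum, but the strict subsolution property makes the Laplacian
   of w negative there. *)
have wy0 : 0 < w y.
  rewrite lt_def w_ge0 ?yr // andbT; apply/eqP => wy.
  have Ly : L0 < sqn y by rewrite yr.
  have [l wl [_ /(_ wy) l0]] := w_lap y Ly.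
  have : 0 <= l.
    apply: has_lap_min wl _; near=> z; rewrite wy subr_ge0.
    have Lz : L0 < sqn z by near: z; exact: sqn_gt_near.
    by apply: dom; rewrite ?(ltW Lz) // -sqn_gt0 (le_lt_trans L00).
  by rewrite leNgt l0.
have decay : forall x, rho <= sqn x -> w y * rho `^ b * sqn x `^ (- b) <= w x.
  apply: exterior_decay => //; first exact: ltW.
  move=> x rx; have [l wl [l0 _]] := w_lap x (lt_trans Lrho rx).
  by exists l.
pose eta := w y * rho `^ b.
have eta0 : 0 < eta by rewrite mulr_gt0 // powR_gt0.
have [M HM] := ball_bounded rho uc.
have M0 : 0 < M.
  by have := HM 0; rewrite sqn0 (ltW r0) => /(_ isT); apply: lt_le_trans; rewrite normr_gt0 gt_eqF.
(* Half of eta pays for the change of L^b, the other half (d2 below) for the change of the argument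
   of u. *)
pose d1 := eta / 2 / M.
have d10 : 0 < d1 by rewrite !divr_gt0.
pose La := (L0 `^ b + d1) `^ b^-1.
have LaE : La `^ b = L0 `^ b + d1.
  by rewrite -powRrM mulVf ?gt_eqF // powRr1 // addr_ge0 ?powR_ge0 // ltW.
have La_ge0 : 0 <= La by exact: powR_ge0.
have L0La : L0 < La.
  rewrite ltNge; apply/negP => h.
  have : La `^ b <= L0 `^ b.
    by apply: ge0_ler_powR h; rewrite ?nnegrE ?(ltW b0).
  by rewrite LaE gerDl leNgt d10.
pose d2 := eta / 2 / (L0 `^ b + 1).
have Lb1 : 0 < L0 `^ b + 1 by rewrite ltr_wpDl ?powR_ge0.
have d20 : 0 < d2 by rewrite !divr_gt0.
have /nbhs_ballP[r /= rr0 Hr] := @scaled_uniform u L0 rho^-1 d2 uc d20.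
exists (Num.min (Num.min rho La) (L0 + r)).
  by rewrite !lt_min Lrho L0La ltrDl.
move=> L L0L; rewrite !lt_min => /andP[/andP[Lr LLa] LL0r].
have L_ge0 : 0 <= L by exact: le_trans L0L.
have far x : rho <= sqn x -> kelvin L u x <= u x.
  move=> rx; have sx0 : 0 < sqn x by exact: lt_le_trans rx.
  have := decay x rx; rewrite /w -/w -/eta.
  (* In these terms the transform is L^b u(L z) |x|^(-2b), and |z|^2 <= 1 / rho. *)
  pose z := (sqn x)^-1 *: x.
  have zT : sqn z <= rho^-1.
    rewrite sqnZ (_ : _ ^+ 2 * _ = (sqn x)^-1); last by field; rewrite gt_eqF.
    by rewrite lef_pV2.
  have kE L' : kelvin L' u x = L' `^ b * u (L' *: z) * sqn x `^ (- b).
    by rewrite /kelvin scalerA mulrAC.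
  have e1 : `|u (L *: z) - u (L0 *: z)| <= d2.
    by apply: (Hr L) => //; rewrite -ball_normE /= distrC ger0_norm ?subr_ge0 //; lra.
  have e2 : 0 < u (L *: z) <= M.
    rewrite u0 /=; apply: le_trans (ler_norm _) (HM _ _); rewrite sqnZ.
    apply: (@le_trans _ _ (L ^+ 2 / rho)).
      by apply: ler_wpM2l => //; exact: exprn_ge0.
    rewrite ler_pdivrMr // -expr2 lerXn2r ?nnegrE ?(ltW r0) ?(ltW Lr) //.
  have e3 : L `^ b - L0 `^ b <= d1.
    have : L `^ b <= La `^ b.
      by apply: ge0_ler_powR (ltW LLa); rewrite ?nnegrE ?(ltW b0).
    rewrite LaE; lra.
  have e4 : L `^ b * u (L *: z) - L0 `^ b * u (L0 *: z) <= eta.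
    rewrite (_ : _ - _ = (L `^ b - L0 `^ b) * u (L *: z) +
      L0 `^ b * (u (L *: z) - u (L0 *: z))); last by ring.
    rewrite [leRHS]splitr; apply: lerD.
      apply: (@le_trans _ _ (d1 * u (L *: z))).
        by rewrite ler_pM2r //; case/andP: e2.
      case/andP: e2 => _ uM; apply: (@le_trans _ _ (d1 * M)); first by rewrite ler_pM2l.
      by rewrite /d1 divfK // gt_eqF.
    apply: (@le_trans _ _ (L0 `^ b * d2)).
      by apply: ler_wpM2l; [exact: powR_ge0 | exact: le_trans (ler_norm _) e1].
    apply: (@le_trans _ _ ((L0 `^ b + 1) * d2)).
      by rewrite ler_pM2r // lerDl.
    by rewrite /d2 mulrC divfK // gt_eqF.
  have P0 : 0 < sqn x `^ (- b) by exact: powR_gt0.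
  move: e4; rewrite -(ler_pM2r P0) mulrBl -!kE /w; lra.
move=> x x0 Lx; have [xr|/ltW rx] := leP (sqn x) rho; last exact: far.
apply: (Hrho L L0L Lr) => //; last by rewrite Lx xr.
by move=> z zr; apply: far; rewrite zr.
Unshelve. all: by end_near. Qed.

(** At a fixed x the transform is continuous in L, and L <= |x|^2 is inherited by every smaller
    L'. *)
Lemma dominates_closed u L : (3 <= n)%N -> continuous u -> (forall x, 0 < u x) ->
  0 <= L -> (forall L', 0 <= L' -> L' < L -> dominates L' u) -> dominates L u.
Proof.
move=> n3 uc u0 L_ge0 H x x0 Lx.
have [LE|Ln] := eqVneq L 0; first by rewrite LE kelvin0 // ltW.
have L0 : 0 < L by rewrite lt_def Ln.
rewrite leNgt; apply/negP => ku.
have kc : {for L, continuous (fun L => kelvin L u x)}.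
  rewrite (_ : (fun L => _) = (fun L => (L `^ b * sqn x `^ (- b)) * u (L *: ((sqn x)^-1 *: x)))).
    apply: contM; first apply: contM.
    - exact: der_cont (is_derive1_powR b L0).
    - exact: cst_continuous.
    - by apply: continuous_comp; [exact: scalel_continuous | exact: uc].
  by apply/funext => L'; rewrite /kelvin scalerA.
have : \forall L' \near L, 0 < L' /\ u x < kelvin L' u x.
  have A : \forall L' \near L, 0 < L' by exact: near_pos.
  have B : \forall L' \near L, u x < kelvin L' u x by exact: (cvgr_gt _ kc).
  by near=> L'; split; near: L'.
move=> /nbhs_ballP[r /= r0 Hr].
have [L'0 ] : 0 < L - r / 2 /\ u x < kelvin (L - r / 2) u x.
  by apply: Hr; rewrite -ball_normE /= opprB addrC subrK gtr0_norm; lra.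
rewrite ltNge => /negP; apply; apply: H => //.
- exact: ltW.
- lra.
- by apply: le_trans Lx; lra.
Unshelve. all: by end_near. Qed.

Lemma dominates_all sigma p u : (3 <= n)%N -> -2 < sigma -> 1 < p ->
  b * (p - 1) < 2 + sigma -> positive_solution sigma p u ->
  forall L, 0 <= L -> dominates L u.
Proof.
move=> n3 sg p1 pb uS; have [uc u0 _ _] := uS.
move=> Lbad Lbad0; apply: contrapT => bad.
pose S := [set L | 0 <= L /\ forall L', 0 <= L' -> L' <= L -> dominates L' u].
have dom0 : dominates 0 u by move=> x _ _; rewrite kelvin0 // ltW.
have S0 : S 0.
  by split => // L' L'0 L'1; rewrite (_ : L' = 0) //; apply: le_anti; rewrite L'0 L'1.
have Sub L : S L -> L <= Lbad.
  move=> [_ HL]; rewrite leNgt; apply/negP => LL; apply: bad; apply: HL => //; exact: ltW.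
have hS : has_sup S by split; [exists 0 | exists Lbad].
have Ls0 : 0 <= sup S by apply: sup_upper_bound.
have below L : 0 <= L -> L < sup S -> dominates L u.
  move=> L0 Ls; have e0 : 0 < sup S - L by rewrite subr_gt0.
  have [L' [_ HL'] LL'] := sup_adherent e0 hS.
  by apply: HL' => //; rewrite subKr in LL'; exact: ltW.
have doms : dominates (sup S) u by exact: dominates_closed.
have [L1 L1s HL1] := dominates_open n3 sg p1 pb uS Ls0 doms.
have : S ((sup S + L1) / 2).
  split; first lra.
  move=> L' L'0 L'1; have [sL'|sL'] := ltP L' (sup S); first exact: below.
  apply: HL1 => //; lra.
move=> /(sup_upper_bound hS); lra.
Qed.

(** The choice L = |x| sends x to the unit sphere, where u has a positive minimum, and gives the
    transform the prefactor |x|^(-b). Domination then contradicts the decay estimate. *)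
Lemma no_solution_subcritical sigma p u : (3 <= n)%N -> -2 < sigma -> 1 < p ->
  positive_solution sigma p u -> 2 + sigma <= b * (p - 1).
Proof.
move=> n3 sg p1 uS; have [uc u0 _ _] := uS.
rewrite leNgt; apply/negP => pb.
have n0 : (0 < n)%N by exact: leq_trans n3.
have [y y1 ym] := @sphere_inf R n u 1 n0 ler01 (fun x _ => uc x).
suff : 2 + sigma <= b * (p - 1) by rewrite leNgt pb.
apply: (no_solution_slow_decay n3 sg p1 uS (u0 y)) => x x1.
have sx0 : 0 < sqn x by exact: lt_le_trans x1.
have x0 : x != 0 by rewrite -sqn_gt0.
pose L := Num.sqrt (sqn x).
have LL : L ^+ 2 = sqn x by rewrite sqr_sqrtr // ltW.
have L0 : 0 < L by rewrite sqrtr_gt0.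
have L1 : 1 <= L by rewrite -sqrtr1 ler_wsqrtr.
have Lx : L <= sqn x by rewrite -LL expr2 ler_peMl // ltW.
apply: le_trans (dominates_all n3 sg p1 pb uS (ltW L0) x0 Lx).
rewrite kelvinE ?(ltW L0) // mulrC.
have -> : (L / sqn x) `^ b = sqn x `^ (- (b / 2)).
  have -> : L / sqn x = sqn x `^ (- 2^-1).
    rewrite powRN powR12_sqrt ?(ltW sx0) // -/L -LL; field.
    by rewrite gt_eqF.
  by rewrite -powRrM; congr (_ `^ _); ring.
rewrite ler_pM2l ?powR_gt0 //; apply: ym.
by rewrite sqnZ -LL; field; rewrite gt_eqF.
Qed.

Lemma solution_necessary sigma p u : (2 <= n)%N -> positive_solution sigma p u ->
  [/\ (3 <= n)%N, (n%:R + 2 + 2 * sigma) / (n%:R - 2) <= p & -2 < sigma].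
Proof.
move=> n2 uS; have sg := no_solution_sigma n2 uS.
have n3 : (3 <= n)%N.
  rewrite ltn_neqAle n2 andbT eq_sym; apply/eqP => n2E.
  exact: no_solution_planar n2E uS.
have n3' : 3 <= n%:R :> R by rewrite ler_nat.
have p1 : 1 < p.
  by rewrite ltNge; apply/negP => p1; exact: no_solution_sublinear n3 sg p1 uS.
have := no_solution_subcritical n3 sg p1 uS.
split => //; rewrite ler_pdivrMr; last by lra.
have -> : p * (n%:R - 2) = 2 * (b * (p - 1)) + (n%:R - 2) by field.
lra.
Qed.

End MovingSpheresContinuation.

(** * The radial initial value problem *)

Section Antiderivative.
Context {R : realType}.
Implicit Types (f g : R -> R) (x s t a c e : R).

Lemma cont_eps f t : (forall e, 0 < e -> exists2 d, 0 < d &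
  forall s, `|s - t| < d -> `|f t - f s| <= e) -> {for t, continuous f}.
Proof.
move=> H; apply/(@cvgrPdist_le R R^o _ (nbhs t) _ _ _) => e e0.
have [d d0 Hd] := H e e0; apply/nbhs_ballP; exists d => //= s.
by rewrite -ball_normE /= distrC; exact: Hd.
Qed.

(** Integrating from -1 makes 0 an interior point, so the derivative at 0 is two-sided. *)
Lemma antiderivative f : continuous f -> exists F : R -> R, F 0 = 0 /\
  forall x : R, -1 < x -> is_derive x 1 F (f x).
Proof.
move=> fc; pose I y := (\int[@lebesgue_measure R]_(t in [set` `[-1, y]]) f t)%R.
exists (fun y => I y - I 0); split; first by rewrite subrr.
move=> x x1.
have xx : x < x + 1 by rewrite ltrDl.
have fi : (@lebesgue_measure R).-integrable `[-1, x + 1] (EFin \o f).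
  apply: continuous_compact_integrable; first exact: segment_compact.
  exact: continuous_subspaceT.
have [Id IE] := continuous_FTC1_closed xx fi x1 (fc x).
have H : is_derive x 1 I (f x).
  by split; [exact: Id | rewrite -derive1E].
by apply: (is_derive_eq (derD H (der_cst (- I 0) x))); rewrite addr0.
Qed.

Lemma der_le (F G F' G' : R -> R) T : 0 <= T ->
  (forall s, 0 < s < T -> is_derive s 1 F (F' s)) ->
  (forall s, 0 < s < T -> is_derive s 1 G (G' s)) ->
  (forall s, 0 <= s <= T -> {for s, continuous F}) ->
  (forall s, 0 <= s <= T -> {for s, continuous G}) ->
  (forall s, 0 < s < T -> F' s <= G' s) ->
  F T - F 0 <= G T - G 0.
Proof.
rewrite le_eqVlt => /orP[/eqP <- *|T0 Fd Gd Fc Gc FG]; first by rewrite !subrr.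
have hd s : s \in `]0, T[%R -> is_derive s 1 (fun s => G s - F s) (G' s - F' s).
  rewrite in_itv /= => s0T; have := derD (Gd s s0T) (derZ (-1) (Fd s s0T)).
  by rewrite mulN1r; under eq_fun do rewrite mulN1r.
have hc : {within `[0, T], continuous (fun s => G s - F s)}.
  apply: continuous_in_subspaceT => s; rewrite inE /= in_itv /= => s0T.
  by apply: contB; [exact: Gc | exact: Fc].
have [s] := MVT T0 hd hc; rewrite in_itv /= subr0 => s0T E.
have : 0 <= (G' s - F' s) * T by rewrite mulr_ge0 ?(ltW T0) // subr_ge0 FG.
rewrite -E; lra.
Qed.

Lemma norm_der_le (F G F' G' : R -> R) T : 0 <= T -> F 0 = 0 ->
  (forall s, 0 < s < T -> is_derive s 1 F (F' s)) ->
  (forall s, 0 < s < T -> is_derive s 1 G (G' s)) ->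
  (forall s, 0 <= s <= T -> {for s, continuous F}) ->
  (forall s, 0 <= s <= T -> {for s, continuous G}) ->
  (forall s, 0 < s < T -> `|F' s| <= G' s) ->
  `|F T| <= G T - G 0.
Proof.
move=> T0 F0 Fd Gd Fc Gc FG; rewrite ler_norml; apply/andP; split; last first.
  have := @der_le F G F' G' T T0 Fd Gd Fc Gc; rewrite F0 subr0; apply => s s0T.
  by apply: le_trans (FG s s0T); exact: ler_norm.
have := @der_le (fun s => - F s) G (fun s => - F' s) G' T T0 _ Gd _ Gc.
rewrite F0 oppr0 subr0 lerNl; apply.
- move=> s s0T; have := derZ (-1) (Fd s s0T).
  by rewrite mulN1r; under eq_fun do rewrite mulN1r.
- by move=> s s0T; apply: continuousN; exact: Fc.
- by move=> s s0T; apply: le_trans (FG s s0T); rewrite -normrN ler_norm.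
Qed.

Lemma abs_powR_cont a : 0 < a -> continuous (fun t : R => `|t| `^ a).
Proof.
move=> a0 t; have [->|tN] := eqVneq t 0; last first.
  apply: (@continuous_comp _ _ _ (fun t : R => `|t|) (fun s => s `^ a)).
    exact: norm_continuous.
  by apply: der_cont (is_derive1_powR a _); rewrite normr_gt0.
apply: cont_eps => e e0; exists (e `^ a^-1); first exact: powR_gt0.
move=> s; rewrite subr0 normr0 powR0 ?gt_eqF // sub0r normrN => /ltW se.
rewrite ger0_norm ?powR_ge0 //.
have -> : e = (e `^ a^-1) `^ a by rewrite -powRrM mulVf ?gt_eqF // powRr1 // ltW.
by apply: ge0_ler_powR; rewrite ?nnegrE ?powR_ge0 ?(ltW a0).
Qed.

(** Every lower end f j - 2c 2^(-j) lies below every upper end f k + 2c 2^(-k). The limit is the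
    supremum of the lower ends, which yields the rate at once. *)
Lemma geometric_limit (f : nat -> R) c :
  (forall j, `|f j.+1 - f j| <= c * 2^-1 ^+ j) ->
  exists l, forall j, `|l - f j| <= 2 * c * 2^-1 ^+ j.
Proof.
move=> H.
have c0 : 0 <= c by have := H 0%N; rewrite expr0 mulr1; apply: le_trans.
have h0 j : 0 <= c * 2^-1 ^+ j by rewrite mulr_ge0 // exprn_ge0 // invr_ge0.
have dist j k : `|f (j + k)%N - f j| <= 2 * c * 2^-1 ^+ j - 2 * c * 2^-1 ^+ (j + k).
  elim: k => [|k IHk]; first by rewrite addn0 !subrr normr0.
  rewrite addnS -(subrK (f (j + k)%N) (f (j + k).+1)) -addrA.
  apply: le_trans (ler_normD _ _) _; have := H (j + k)%N.
  rewrite [2^-1 ^+ (j + k).+1]exprS; move: IHk; set q := _ ^+ (j + k); lra.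
have bd j k : f j - 2 * c * 2^-1 ^+ j <= f k + 2 * c * 2^-1 ^+ k.
  have [jk|/ltnW kj] := leqP j k.
    have := dist j (k - j)%N; rewrite subnKC // ler_norml => /andP[+ _].
    have := h0 k; lra.
  have := dist k (j - k)%N; rewrite subnKC // ler_norml => /andP[_].
  have := h0 j; lra.
pose S := [set y | exists j, y = f j - 2 * c * 2^-1 ^+ j].
have hS : has_sup S.
  split; first by exists (f 0%N - 2 * c * 2^-1 ^+ 0), 0%N.
  by exists (f 0%N + 2 * c * 2^-1 ^+ 0) => _ [j ->]; exact: bd.
exists (sup S) => j; rewrite ler_norml; apply/andP; split.
  have : f j - 2 * c * 2^-1 ^+ j <= sup S by apply: sup_upper_bound => //; exists j.
  lra.
have : sup S <= f j + 2 * c * 2^-1 ^+ j.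
  by apply: ge_sup; [case: hS | move=> _ [k ->]; exact: bd].
lra.
Qed.

End Antiderivative.

Section Picard.
Context {R : realType}.
Context (m : R).
Implicit Types (f g v : R -> R) (x y s t a c e : R).

(* The initial value problem t v'' + m v' + f(t) = 0, v(0) = 1, whose first
   integral is (t^m v')' = - t^(m-1) f; here P = - t^m v' and Q = - v'. *)
Definition radial_ivp f (P Q V : R -> R) := [/\ P 0 = 0 /\ V 0 = 1,
  forall x, -1 < x -> is_derive x 1 P (`|x| `^ (m - 1) * f x),
  forall x, -1 < x -> is_derive x 1 V (- Q `|x|),
  continuous (fun x => Q `|x|) &
  (forall x, 0 < x -> P x = x `^ m * Q x) /\ Q 0 = f 0 / m].

Lemma powR_der s : 1 < m -> 0 < s -> is_derive s 1 (fun s => s `^ m / m) (s `^ (m - 1)).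
Proof.
move=> m1 s0; have := derZ m^-1 (is_derive1_powR m s0).
rewrite mulrA mulVf ?mul1r; last by rewrite gt_eqF // (lt_trans ltr01).
by under eq_fun do rewrite mulrC.
Qed.

Lemma powR_der_abs s c : 1 < m -> 0 < s ->
  is_derive s 1 (fun s => c * (`|s| `^ m / m)) (c * s `^ (m - 1)).
Proof.
move=> m1 s0; apply: (@der_near _ (fun s => c * (s `^ m / m))).
  near=> t; rewrite gtr0_norm //; near: t; exact: near_pos.
exact: derZ (powR_der m1 s0).
Unshelve. all: by end_near. Qed.

Lemma powR_abs_cont c : 1 < m -> continuous (fun s => c * (`|s| `^ m / m)).
Proof.
move=> m1 s; have A := abs_powR_cont (lt_trans ltr01 m1) (x := s).
have B := contM A (@cont_cst R R m^-1 s).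
by have := contM (@cont_cst R R c s) B.
Qed.

Lemma weighted_primitive_le (P f : R -> R) c T : 1 < m -> 0 < T -> P 0 = 0 ->
  (forall x, -1 < x -> is_derive x 1 P (`|x| `^ (m - 1) * f x)) ->
  (forall s, 0 < s < T -> `|f s| <= c) -> `|P T| <= c * T `^ m / m.
Proof.
move=> m1 T0 P0 Pd fc.
have gt1 s : 0 <= s -> -1 < s by move=> s0; lra.
have := @norm_der_le _ P (fun s => c * (`|s| `^ m / m)) (fun s => `|s| `^ (m - 1) * f s)
  (fun s => c * s `^ (m - 1)) T (ltW T0) P0.
rewrite (gtr0_norm T0) normr0 powR0 ?gt_eqF ?(lt_trans ltr01 m1) //.
rewrite mul0r mulr0 subr0 mulrA; apply.
- by move=> s /andP[s0 _]; apply: Pd; apply: gt1; exact: ltW.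
- by move=> s /andP[s0 _]; exact: powR_der_abs.
- by move=> s /andP[s0 _]; apply: der_cont (Pd s _); exact: gt1.
- by move=> s _; exact: powR_abs_cont.
- move=> s sT; have /andP[s0 _] := sT.
  rewrite normrM (gtr0_norm s0) ger0_norm ?powR_ge0 // mulrC ler_wpM2r ?powR_ge0 //.
  exact: fc.
Qed.

Lemma radial_ivp_exists f : 1 < m -> continuous f -> exists P Q V, radial_ivp f P Q V.
Proof.
move=> m1 fc; have m0 : 0 < m by exact: lt_trans m1.
have wc : continuous (fun x => `|x| `^ (m - 1) * f x).
  have m10 : 0 < m - 1 by rewrite subr_gt0.
  by move=> x; have := contM (abs_powR_cont m10 (x := x)) (fc x).
have [P [P0 Pd]] := antiderivative wc.
(* Near 0, P x is f(0) x^m / m up to o(x^m), so f(0) / m is the value that makes Q continuous. *)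
pose Q x := if x == 0 then f 0 / m else P x / x `^ m.
have PQ x : 0 < x -> P x = x `^ m * Q x.
  by move=> x0; rewrite /Q gt_eqF // mulrC divfK // gt_eqF // powR_gt0.
have Qc : continuous (fun x => Q `|x|).
  move=> x; have [->|xN] := eqVneq x 0; last first.
    apply: (@continuous_comp _ _ _ (fun x : R => `|x|) Q); first exact: norm_continuous.
    have x0 : 0 < `|x| by rewrite normr_gt0.
    have xm1 : -1 < `|x| by lra.
    have xm0 : `|x| `^ m != 0 by rewrite gt_eqF // powR_gt0.
    have D := derM (Pd _ xm1) (is_deriveV (f := fun y => y `^ m) xm0 (is_derive1_powR m x0)).
    apply: der_cont (der_near _ D); near=> y.
    have y0 : 0 < y by near: y; exact: near_pos.
    by rewrite /Q gt_eqF.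
  apply: cont_eps => e e0.
  have : \forall x \near (0 : R), `|f 0 - f x| <= e.
    by exact: ((cvgrPdist_le _ _).1 (fc 0) _ e0).
  move=> /nbhs_ballP[r /= r0 Hr]; exists r => // {x}x; rewrite subr0 => xr.
  rewrite normr0; have [->|xN] := eqVneq x 0; first by rewrite normr0 subrr normr0 ltW.
  have x0 : 0 < `|x| by rewrite normr_gt0.
  have xm : 0 < `|x| `^ m by exact: powR_gt0.
  pose P2 s := P s - f 0 * (`|s| `^ m / m).
  have : `|P `|x| - f 0 * (`|x| `^ m / m)| <= e * (`|x| `^ m / m).
    have := @norm_der_le _ P2 (fun s => e * (`|s| `^ m / m))
      (fun s => `|s| `^ (m - 1) * f s - f 0 * s `^ (m - 1))
      (fun s => e * s `^ (m - 1)) `|x| (ltW x0).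
    rewrite /P2 !normr_id normr0 P0 powR0 ?gt_eqF //.
    rewrite !(mul0r, mulr0) !subr0; apply => //.
    - move=> s /andP[s0 _]; have s1 : -1 < s by lra.
      have := derD (Pd s s1) (derZ (-1) (powR_der_abs (f 0) m1 s0)).
      by rewrite mulN1r; under eq_fun do rewrite mulN1r.
    - by move=> s /andP[s0 _]; exact: powR_der_abs.
    - move=> s /andP[s0 _]; have s1 : -1 < s by lra.
      by have := contB (der_cont (Pd s s1)) (@powR_abs_cont (f 0) m1 s).
    - by move=> s _; exact: powR_abs_cont.
    - move=> s /andP[s0 sx]; rewrite (gtr0_norm s0) [f 0 * _]mulrC -mulrBr normrM.
      rewrite ger0_norm ?powR_ge0 // mulrC ler_wpM2r ?powR_ge0 // distrC.
      apply: Hr; rewrite -ball_normE /= sub0r normrN gtr0_norm //.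
      exact: lt_trans xr.
  rewrite {1}/Q eqxx PQ // => H.
  have : `|x| `^ m * `|f 0 / m - Q `|x| | <= `|x| `^ m * e.
    have E : `|x| `^ m * (f 0 / m - Q `|x|) =
      - (`|x| `^ m * Q `|x| - f 0 * (`|x| `^ m / m)) by ring.
    rewrite -[X in X * _](ger0_norm (ltW xm)) -normrM E normrN.
    apply: le_trans H _; rewrite mulrC -mulrA ler_pM2l // mulrC.
    by rewrite ler_pdivrMr // ler_peMr // ltW.
  by rewrite ler_pM2l.
have [W [W0 Wd]] := antiderivative Qc.
exists P, Q, (fun x => 1 - W x); split => //.
- by rewrite W0 subr0.
- move=> x x1; have := derD (der_cst 1 x) (derZ (-1) (Wd x x1)).
  by rewrite mulN1r add0r; under eq_fun do rewrite mulN1r.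
- by split => //; rewrite /Q eqxx.
Unshelve. all: by end_near. Qed.

End Picard.

(** * Global solution by iteration in a weighted norm *)

Section PicardIteration.
Context {R : realType}.
Context (m : R).
Implicit Types (f g : R -> R) (x s t a c e : R).

(* In the weighted norm sup |v(t)| e^(- lam t) the solution operator is
   Lipschitz with constant 1 / lam. *)
Lemma ivp_contraction f1 f2 (P1 Q1 V1 P2 Q2 V2 : R -> R) C lam : 1 < m ->
  radial_ivp m f1 P1 Q1 V1 -> radial_ivp m f2 P2 Q2 V2 -> 0 <= C -> 0 < lam ->
  (forall t, 0 <= t -> `|f1 t - f2 t| <= C * expR (lam * t)) ->
  forall t, 0 <= t -> `|V1 t - V2 t| <= C / lam * expR (lam * t).
Proof.
move=> m1 [[P10 V10] P1d V1d _ [PQ1 _]] [[P20 V20] P2d V2d _ [PQ2 _]] C0 l0 H.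
have gt1 s : 0 <= s -> -1 < s by move=> s0; lra.
(* The exponential increases, so its value at s bounds the data on [0, s]; the weights t^(m-1) / s^m
   integrate to 1/m <= 1. *)
have Qdiff s : 0 < s -> `|Q1 s - Q2 s| <= C * expR (lam * s).
  move=> s0; have sm : 0 < s `^ m by exact: powR_gt0.
  have c0 : 0 <= C * expR (lam * s) by rewrite mulr_ge0 // expR_ge0.
  have := @weighted_primitive_le R m (fun s => P1 s - P2 s) (fun s => f1 s - f2 s)
    (C * expR (lam * s)) s m1 s0.
  rewrite P10 P20 subrr PQ1 // PQ2 // => /(_ erefl) Hw.
  rewrite -(ler_pM2l sm) -[X in X * `|_|](ger0_norm (ltW sm)) -normrM mulrBr.
  have {}Hw : `|s `^ m * Q1 s - s `^ m * Q2 s| <= C * expR (lam * s) * s `^ m / m.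
    apply: Hw => [x x1|t /andP[t0 ts]].
      have := derD (P1d x x1) (derZ (-1) (P2d x x1)).
      by rewrite mulN1r -mulrBr; under eq_fun do rewrite mulN1r.
    apply: le_trans (H t (ltW t0)) _.
    by rewrite ler_wpM2l // ler_expR ler_pM2l // ltW.
  apply: le_trans Hw _; rewrite [leRHS]mulrC ler_pdivrMr ?(lt_trans ltr01 m1) //.
  by rewrite ler_peMr ?(ltW m1) // mulr_ge0 // ltW.
move=> t t0.
have hexp s : is_derive s 1 (fun s => C / lam * expR (lam * s)) (C * expR (lam * s)).
  have E := der_comp (is_derive_expR (lam * s)) (derZ lam (der_id s)).
  apply: (is_derive_eq (derZ (C / lam) E)); field.
  by rewrite gt_eqF.
have : `|V1 t - V2 t| <= C / lam * expR (lam * t) - C / lam * expR (lam * 0).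
  apply: (@norm_der_le _ (fun s => V1 s - V2 s) (fun s => C / lam * expR (lam * s))
    (fun s => - (Q1 s - Q2 s)) (fun s => C * expR (lam * s)) t t0).
  - by rewrite V10 V20 subrr.
  - move=> s /andP[s0 _]; have s1 := gt1 _ (ltW s0).
    have := derD (V1d s s1) (derZ (-1) (V2d s s1)).
    under eq_fun do rewrite mulN1r; move=> D; apply: (is_derive_eq D).
    rewrite gtr0_norm //; ring.
  - move=> s /andP[s0 _]; have s1 := gt1 _ s0.
    by have := contB (der_cont (V1d s s1)) (der_cont (V2d s s1)).
  - by move=> s _; exact: der_cont (hexp s).
  - by move=> s /andP[s0 _]; rewrite normrN; exact: Qdiff.
move=> /le_trans; apply.
by rewrite gerBl mulr_ge0 ?expR_ge0 // divr_ge0 // ltW.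
Qed.

Lemma half_expn_small e : 0 < e -> exists j, 2^-1 ^+ j <= e.
Proof.
move=> e0.
have H j : (2^-1 : R) ^+ j <= j.+1%:R^-1.
  elim: j => [|j IHj]; first by rewrite expr0 invr1.
  rewrite exprS; apply: (@le_trans _ _ (2^-1 * j.+1%:R^-1)).
    by rewrite ler_pM2l // invr_gt0.
  rewrite -invfM lef_pV2 ?posrE ?mulr_gt0 ?ltr0n //.
  by rewrite -natrM ler_nat mul2n -addnn addSn ltnS leq_addl.
have := archi_boundP (ltW (_ : 0 < e^-1)); rewrite invr_gt0 => /(_ e0).
set j := Num.bound _ => ej; exists j; apply: le_trans (H j) _.
rewrite -[leRHS]invrK lef_pV2 ?posrE ?invr_gt0 ?ltr0n //.
by apply: le_trans (ltW ej) _; rewrite ler_nat.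
Qed.

(** The iterated unknown is the source term f = g(V), not V. The weight exp(lam t) makes the
    iteration converge on the whole half-line at once, and the bound on g starts the induction. *)
Lemma radial_ode_exists g L : 1 < m -> 0 < L ->
  (forall a c, `|g a - g c| <= L * `|a - c|) -> (forall a, `|g a| <= 1) ->
  exists P Q V, radial_ivp m (fun x => g (V `|x|)) P Q V.
Proof.
move=> m1 L0 gL g1.
have gc : continuous g.
  move=> x; apply: cont_eps => e e0; exists (e / L); first exact: divr_gt0.
  move=> s sx; apply: le_trans (gL _ _) _.
  by rewrite mulrC -ler_pdivlMr // distrC ltW.
(* A solution operator on all functions; discontinuous ones receive a filler triple. *)
have /choice[W HW] : forall f, exists W : (R -> R) * (R -> R) * (R -> R),
    continuous f -> radial_ivp m f W.1.1 W.1.2 W.2.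
  move=> f; have [fc|fn] := pselect (continuous f).
    by have [P [Q [V PQV]]] := radial_ivp_exists m1 fc; exists (P, Q, V).
  by exists (id, id, id) => /fn.
have Vc f : continuous f -> continuous (fun x => g ((W f).2 `|x|)).
  move=> fc x; have [_ _ Vd _ _] := HW f fc.
  apply: (@continuous_comp _ _ _ (fun x : R => (W f).2 `|x|) g); last exact: gc.
  apply: (@continuous_comp _ _ _ (fun x : R => `|x|) (W f).2); first exact: norm_continuous.
  have x1 : -1 < `|x| by have := normr_ge0 x; lra.
  exact: der_cont (Vd _ x1).
pose F := fix F (j : nat) : R -> R :=
  if j is j'.+1 then (fun x => g ((W (F j')).2 `|x|)) else (fun=> 0).
have Fc j : continuous (F j).
  by elim: j => [|j IHj] /=; [exact: cst_continuous | exact: Vc].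
have Feven j x : F j `|x| = F j x by case: j => //= j; rewrite normr_id.
(* Makes the contraction factor L / lam equal to 1/2. *)
pose lam := 2 * L.
have l0 : 0 < lam by rewrite /lam mulr_gt0.
have Fstep j t : 0 <= t -> `|F j.+1 t - F j t| <= expR (lam * t) * 2^-1 ^+ j.
  elim: j t => [|j IHj] t t0.
    rewrite expr0 mulr1 subr0; apply: le_trans (g1 _) _.
    by rewrite -expR0 ler_expR mulr_ge0 // ltW.
  apply: le_trans (gL _ _) _; rewrite -/F (ger0_norm t0).
  have h0 : 0 <= (2^-1 : R) ^+ j by rewrite exprn_ge0 // invr_ge0.
  have := ivp_contraction m1 (HW _ (Fc j.+1)) (HW _ (Fc j)) h0 l0 _ t0.
  move=> /(_ _)/wrap[|Hc]; first by move=> s s0; rewrite mulrC; exact: IHj.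
  apply: (@le_trans _ _ (L * (2^-1 ^+ j / lam * expR (lam * t)))).
    by rewrite ler_pM2l.
  rewrite le_eqVlt; apply/orP; left; apply/eqP; rewrite exprS /lam; field.
  by rewrite gt_eqF.
have /choice[l Hl] : forall t, exists l, forall j,
    `|l - F j t| <= 2 * expR (lam * `|t|) * 2^-1 ^+ j.
  move=> t; apply: geometric_limit => j.
  by rewrite -Feven -[F j t]Feven; exact: Fstep.
pose f t := l `|t|.
have Hf j t : `|f t - F j t| <= 2 * expR (lam * `|t|) * 2^-1 ^+ j.
  by have := Hl `|t| j; rewrite normr_id Feven.
have fc : continuous f.
  move=> t; apply: cont_eps => e e0.
  pose K := 2 * expR (lam * (`|t| + 1)).
  have K0 : 0 < K by rewrite mulr_gt0 // expR_gt0.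
  have [|j Hj] := @half_expn_small (e / 4 / K); first by rewrite !divr_gt0.
  have KHj : K * 2^-1 ^+ j <= e / 4 by rewrite mulrC -ler_pdivlMr.
  have near_t s : `|s - t| < 1 -> `|f s - F j s| <= e / 4.
    move=> st; apply: le_trans (Hf j s) (le_trans _ KHj).
    rewrite ler_wpM2r ?exprn_ge0 ?invr_ge0 // ler_pM2l // ler_expR ler_pM2l //.
    have := ler_normB t (t - s); rewrite subKr distrC; lra.
  have e2 : 0 < e / 2 by lra.
  have : \forall s \near t, `|F j t - F j s| <= e / 2.
    exact: ((cvgrPdist_le _ _).1 (Fc j t) _ e2).
  move=> /nbhs_ballP[r /= r0 Hr]; exists (Num.min r 1); first by rewrite lt_min r0 ltr01.
  move=> s; rewrite lt_min => /andP[sr s1].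
  have A := near_t s s1.
  have B := near_t t (_ : `|t - t| < 1); rewrite subrr normr0 ltr01 in B.
  have {}B := B isT.
  have C : `|F j t - F j s| <= e / 2 by apply: Hr; rewrite -ball_normE /= distrC.
  rewrite (_ : f t - f s = (f t - F j t) + (F j t - F j s) - (f s - F j s)); last by ring.
  apply: le_trans (ler_normB _ _) _; have := ler_normD (f t - F j t) (F j t - F j s); lra.
have HV := HW f fc.
exists (W f).1.1, (W f).1.2, (W f).2.
(* Fixed point property: both sides are limits of the same iterates F j.+1. *)
suff -> : (fun x => g ((W f).2 `|x|)) = f by [].
apply/funext => x; apply/eqP; rewrite -subr_eq0 -normr_le0.
apply: (@le_limit _ _ _ (2 * expR (lam * `|x|))) => e e0; rewrite add0r.
have [j Hj] := half_expn_small e0.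
have h0 : 0 <= 2 * (2^-1 : R) ^+ j by rewrite mulr_ge0 // exprn_ge0 // invr_ge0.
have Hc : `|(W f).2 `|x| - (W (F j)).2 `|x| | <= 2 * 2^-1 ^+ j / lam * expR (lam * `|x|).
  apply: (ivp_contraction m1 HV (HW _ (Fc j)) h0 l0) => // t t0.
  by have := Hf j t; rewrite (ger0_norm t0) mulrAC.
have A := gL ((W f).2 `|x|) ((W (F j)).2 `|x|).
have B := Hf j.+1 x; rewrite /= -/F in B.
have E := expR_gt0 (lam * `|x|).
rewrite (_ : _ - f x = (g ((W f).2 `|x|) - g ((W (F j)).2 `|x|)) -
  (f x - g ((W (F j)).2 `|x|))); last by ring.
apply: le_trans (ler_normB _ _) _.
apply: (@le_trans _ _ (2 * expR (lam * `|x|) * 2^-1 ^+ j)); last first.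
  by rewrite mulrC ler_wpM2r // mulr_ge0 // ltW.
rewrite exprS in B.
have : L * `|(W f).2 `|x| - (W (F j)).2 `|x| | <= 2^-1 ^+ j * expR (lam * `|x|).
  apply: (@le_trans _ _ (L * (2 * 2^-1 ^+ j / lam * expR (lam * `|x|)))).
    by rewrite ler_pM2l.
  rewrite le_eqVlt; apply/orP; left; apply/eqP; rewrite /lam; field.
  by rewrite gt_eqF.
lra.
Qed.

End PicardIteration.

(** * Positivity from the Pohozaev identity *)

Section Pohozaev.
Context {R : realType}.
Context (m p : R).
Implicit Types (x s t a c e : R).

Definition clamp a : R := Num.max 0 (Num.min a 1).

Lemma clamp_itv a : 0 <= clamp a <= 1.
Proof. by rewrite le_max lexx /= ge_max ler01 ge_min lexx orbT. Qed.

Lemma clamp_id a : 0 <= a <= 1 -> clamp a = a.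
Proof. by move=> /andP[a0 a1]; rewrite /clamp min_l // max_r. Qed.

Lemma clamp_lipschitz a c : `|clamp a - clamp c| <= `|a - c|.
Proof.
have H x y : x <= y -> 0 <= clamp y - clamp x <= y - x.
  rewrite /clamp => xy; have M01 : Num.max 0 1 = 1 :> R by rewrite max_r.
  have [x1|x1] := leP x 1; have [y1|y1] := leP y 1; rewrite ?M01;
    have [x0|x0] := leP 0 x; have [y0|y0] := leP 0 y; lra.
have [ac|/ltW ca] := leP a c.
  have /andP[h0 h1] := H _ _ ac.
  by rewrite distrC [leRHS]distrC !ger0_norm // subr_ge0.
by have /andP[h0 h1] := H _ _ ca; rewrite !ger0_norm // subr_ge0.
Qed.

Lemma powR_lipschitz a c : 1 < p -> 0 <= a <= 1 -> 0 <= c <= 1 ->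
  `|a `^ p - c `^ p| <= p * `|a - c|.
Proof.
move=> p1; have p0 : 0 < p by exact: lt_trans p1.
have H x y : 0 <= x -> x < y -> y <= 1 -> y `^ p - x `^ p <= p * (y - x).
  move=> x0 xy y1; have y0 : 0 < y by exact: le_lt_trans xy.
  have [->|xN] := eqVneq x 0.
    rewrite powR0 ?gt_eqF // !subr0; apply: (@le_trans _ _ y).
      by apply: ge1r_powR; rewrite ?y0 // ltW.
    by rewrite ler_peMl // ltW.
  have x_gt0 : 0 < x by rewrite lt_def xN.
  apply: le_trans (powR_diff_le p1 x_gt0 xy) _.
  rewrite ler_pM2r ?subr_gt0 // ger_pMr //.
  have p10 : 0 <= p - 1 by lra.
  have := @ge0_ler_powR _ (p - 1) p10 y 1; rewrite powR1 !nnegrE; apply => //.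
  exact: ltW.
have M x y : 0 <= x -> x <= y -> x `^ p <= y `^ p.
  move=> x0 xy; have y0 := le_trans x0 xy.
  by apply: (ge0_ler_powR (ltW p0)) xy; rewrite nnegrE.
move=> /andP[a0 a1] /andP[c0 c1].
have [ac|ca|->] := ltgtP a c; last by rewrite !subrr normr0 mulr0.
  have h0 : 0 <= c `^ p - a `^ p by rewrite subr_ge0 M // ltW.
  by rewrite distrC [`|a - c|]distrC (ger0_norm h0) ger0_norm ?H // subr_ge0 ltW.
have h0 : 0 <= a `^ p - c `^ p by rewrite subr_ge0 M // ltW.
by rewrite (ger0_norm h0) ger0_norm ?H // subr_ge0 ltW.
Qed.

(** The derivative of E has the sign of m / (p + 1) - (m - 1) / 2, which is nonpositive exactly when
    m + 1 <= p (m - 1). E tends to 0 at the origin, while at a zero of V only the positive term in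
    P^2 survives, so E would have to increase. *)
Lemma radial_ode_positive : 1 < m -> m + 1 <= p * (m - 1) ->
  exists P Q V, radial_ivp m (fun x => V `|x| `^ p) P Q V /\
    forall x, 0 <= x -> 0 < V x <= 1.
Proof.
move=> m1 pm.
have p1 : 1 < p by rewrite ltNge; apply/negP => p1; nra.
have p0 : 0 < p by exact: lt_trans p1.
have m0 : 0 < m by exact: lt_trans m1.
pose g a := clamp a `^ p.
have g01 a : 0 <= g a <= 1.
  have /andP[c0 c1] := clamp_itv a; rewrite powR_ge0 /=.
  have := @ge0_ler_powR _ p (ltW p0) (clamp a) 1; rewrite powR1 !nnegrE; exact.
have gL a c : `|g a - g c| <= p * `|a - c|.
  apply: le_trans (powR_lipschitz p1 (clamp_itv a) (clamp_itv c)) _.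
  by rewrite ler_pM2l // clamp_lipschitz.
have gn a : `|g a| <= 1 by have /andP[h0 h1] := g01 a; rewrite ger0_norm.
have gc : continuous g.
  move=> x; apply: cont_eps => e e0; exists (e / p); first exact: divr_gt0.
  move=> s sx; apply: le_trans (gL _ _) _.
  by rewrite mulrC -ler_pdivlMr // distrC ltW.
have [P [Q [V PQV]]] := radial_ode_exists m1 p0 gL gn.
have [[P0 V0] Pd Vd Qc [PQ Q0]] := PQV.
have gt1 s : 0 <= s -> -1 < s by move=> s0; lra.
have Pd0 s : 0 < s -> is_derive s 1 P (s `^ (m - 1) * g (V s)).
  by move=> s0; have := Pd s (gt1 _ (ltW s0)); rewrite gtr0_norm.
have Vd0 s : 0 < s -> is_derive s 1 V (- Q s).
  by move=> s0; have := Vd s (gt1 _ (ltW s0)); rewrite gtr0_norm.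
have Pc s : 0 <= s -> {for s, continuous P} by move=> s0; exact: der_cont (Pd s (gt1 _ s0)).
have Vc s : 0 <= s -> {for s, continuous V} by move=> s0; exact: der_cont (Vd s (gt1 _ s0)).
have Pmono s t : 0 <= s -> s <= t -> P s <= P t.
  move=> s0; rewrite le_eqVlt => /orP[/eqP -> //|st].
  have hd x : x \in `]s, t[%R -> is_derive x 1 P (x `^ (m - 1) * g (V x)).
    by rewrite in_itv /= => /andP[sx _]; apply: Pd0; exact: le_lt_trans sx.
  have hc : {within `[s, t], continuous P}.
    apply: continuous_in_subspaceT => x; rewrite inE /= in_itv /= => /andP[sx _].
    by apply: Pc; exact: le_trans sx.
  have [x _ E] := MVT st hd hc; rewrite -subr_ge0 E.
  have /andP[gx _] := g01 (V x).
  by rewrite mulr_ge0 ?subr_ge0 ?(ltW st) // mulr_ge0 // powR_ge0.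
have Ppos t : 0 < t -> 0 < P t.
  move=> t0.
  have : \forall s \near (0 : R), 1 / 2 < V s.
    by apply: (cvgr_gt _ (Vc 0 (lexx 0))); rewrite V0; lra.
  move=> /nbhs_ballP[r /= r0 Hr].
  pose d := Num.min t (r / 2).
  have d0 : 0 < d by rewrite lt_min t0 divr_gt0.
  have dt : d <= t by rewrite ge_min lexx.
  have dr : d <= r / 2 by rewrite ge_min lexx orbT.
  apply: lt_le_trans (Pmono d t (ltW d0) dt).
  have hd x : x \in `]0, d[%R -> is_derive x 1 P (x `^ (m - 1) * g (V x)).
    by rewrite in_itv /= => /andP[sx _]; exact: Pd0.
  have hc : {within `[0, d], continuous P}.
    by apply: continuous_in_subspaceT => x; rewrite inE /= in_itv /= => /andP[sx _]; exact: Pc.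
  have [x + E] := MVT d0 hd hc; rewrite in_itv /= => /andP[x0 xd].
  rewrite P0 !subr0 in E; rewrite E mulr_gt0 // mulr_gt0 ?powR_gt0 //.
  have Vx : 1 / 2 < V x.
    by apply: Hr; rewrite -ball_normE /= sub0r normrN gtr0_norm //; lra.
  by rewrite lt_max lt_min ltr01 andbT; apply/orP; right; lra.
have Qpos t : 0 < t -> 0 < Q t.
  by move=> t0; have := Ppos t t0; rewrite PQ // pmulr_rgt0 // powR_gt0.
have Vdecr s t : 0 <= s -> s < t -> V t < V s.
  move=> s0 st.
  have hd x : x \in `]s, t[%R -> is_derive x 1 V (- Q x).
    by rewrite in_itv /= => /andP[sx _]; apply: Vd0; exact: le_lt_trans sx.
  have hc : {within `[s, t], continuous V}.
    apply: continuous_in_subspaceT => x; rewrite inE /= in_itv /= => /andP[sx _].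
    by apply: Vc; exact: le_trans sx.
  have [x + E] := MVT st hd hc; rewrite in_itv /= => /andP[sx _].
  rewrite -subr_lt0 E mulNr oppr_lt0 mulr_gt0 ?subr_gt0 // Qpos //.
  exact: le_lt_trans sx.
have V1 x : 0 <= x -> V x <= 1.
  rewrite le_eqVlt => /orP[/eqP <-|x0]; first by rewrite V0.
  by rewrite -V0 ltW // Vdecr.
have Vpos x : 0 <= x -> 0 < V x.
  move=> x0; rewrite ltNge; apply/negP => Vx.
  have hc : {within `[0, x], continuous V}.
    by apply: continuous_in_subspaceT => y; rewrite inE /= in_itv /= => /andP[sx _]; exact: Vc.
  (* V is strictly decreasing, so T is its first zero and the truncation is inactive before T. *)
  have [|T + VT] := IVT x0 hc (v := 0).
    by rewrite V0 ge_min Vx orbT le_max ler01.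
  rewrite in_itv /= => /andP[T_ge0 _].
  have T0 : 0 < T.
    by rewrite lt_def T_ge0 andbT; apply/eqP => TE; move: VT; rewrite TE V0; lra.
  have VT1 s : 0 < s < T -> 0 < V s < 1.
    by move=> /andP[s0 sT]; rewrite -{1}VT -V0 !Vdecr // ltW.
  (* In terms of V', E is t^(m-1) times (t V')^2 / 2 + t V^(p+1) / (p+1)
     + (m-1)/2 V (t V'), the Pohozaev functional. *)
  pose E s := s `^ (1 - m) * (P s * P s) / 2 + s `^ m * (V s * g (V s)) / (p + 1) -
     (m - 1) / 2 * (V s * P s).
  have Ed s : 0 < s < T -> is_derive s 1 E
     (s `^ (m - 1) * V s `^ (p + 1) * (m / (p + 1) - (m - 1) / 2)).
    move=> sT; have /andP[s0 sT'] := sT; have /andP[Vs0 Vs1] := VT1 s sT.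
    have gE : \forall r \near s, V r `^ (p + 1) = V r * g (V r).
      near=> r; have r0 : 0 < r by near: r; exact: near_pos.
      have rT : r < T by near: r; exact: lt_nbhsl.
      have /andP[Vr0 Vr1] : 0 < V r < 1 by apply: VT1; rewrite r0.
      rewrite /g clamp_id ?(ltW Vr0) ?(ltW Vr1) //.
      by rewrite -(powR_mulVV (p + 1) Vr0) addrK.
    have gs := nbhs_singleton gE.
    have Vp : g (V s) = V s `^ p by rewrite /g clamp_id // !ltW.
    have D1 := derM (is_derive1_powR (1 - m) s0) (derM (Pd0 s s0) (Pd0 s s0)).
    have D2 := derM (is_derive1_powR m s0)
      (der_near gE (der_comp (is_derive1_powR (p + 1) Vs0) (Vd0 s s0))).
    have D3 := derM (Vd0 s s0) (Pd0 s s0).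
    have D := derD (derD (derZ 2^-1 D1) (derZ (p + 1)^-1 D2)) (derZ (- ((m - 1) / 2)) D3).
    rewrite (_ : E = (fun t => 2^-1 * (t `^ (1 - m) * (P t * P t)) +
        (p + 1)^-1 * (t `^ m * (V t * g (V t))) + - ((m - 1) / 2) * (V t * P t))); last first.
      by apply/funext => t; rewrite /E; ring.
    apply: (is_derive_eq D).
    rewrite -gs addrK Vp PQ // (_ : 1 - m - 1 = - m); last by ring.
    have S1 : s `^ (m - 1) = s `^ m / s.
      by rewrite -(powR_mulVV m s0) mulrAC mulfV ?mul1r // gt_eqF.
    have S2 : s `^ (1 - m) = s / s `^ m.
      rewrite powRD ?(gt_eqF s0) ?implybT // powRr1 ?(ltW s0) // powRN //.
    have VpE : V s `^ (p + 1) = V s * V s `^ p.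
      by rewrite -(powR_mulVV (p + 1) Vs0) addrK.
    rewrite S1 S2 powRN VpE; field.
    by rewrite !gt_eqF ?powR_gt0 //; lra.
  have Ec s : 0 < s -> {for s, continuous E}.
    move=> s0.
    have c1 := der_cont (is_derive1_powR (1 - m) s0).
    have c2 := der_cont (is_derive1_powR m s0).
    have cP := Pc s (ltW s0); have cV := Vc s (ltW s0).
    have cg : {for s, continuous (fun s => g (V s))}.
      exact: (continuous_comp cV (gc _)).
    have e1 := contM (contM c1 (contM cP cP)) (@cont_cst R R 2^-1 s).
    have e2 := contM (contM c2 (contM cV cg)) (@cont_cst R R (p + 1)^-1 s).
    have e3 := contM (@cont_cst R R ((m - 1) / 2) s) (contM cV cP).
    by have := contB (contD e1 e2) e3.
  have ET : 0 < E T.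
    rewrite /E VT !mul0r mulr0 mul0r mulr0 addr0 subr0 divr_gt0 // mulr_gt0 ?powR_gt0 //.
    by rewrite mulr_gt0 // Ppos.
  have Edecr e : 0 < e -> e < T -> E T <= E e.
    move=> e0 eT.
    have hd y : y \in `]e, T[%R -> is_derive y 1 E
       (y `^ (m - 1) * V y `^ (p + 1) * (m / (p + 1) - (m - 1) / 2)).
      by rewrite in_itv /= => /andP[ey yT]; apply: Ed; rewrite yT (lt_trans e0).
    have hcE : {within `[e, T], continuous E}.
      apply: continuous_in_subspaceT => y; rewrite inE /= in_itv /= => /andP[ey _].
      by apply: Ec; exact: lt_le_trans ey.
    have [y _ EE] := MVT eT hd hcE; rewrite -subr_le0 EE.
    apply: mulr_le0_ge0; last by rewrite subr_ge0 ltW.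
    apply: mulr_ge0_le0; first by rewrite mulr_ge0 ?powR_ge0.
    rewrite subr_le0 ler_pdivrMr; last by lra.
    nra.
  (* At e the two nonnegative terms of E are at most e / 2 and e, and the last one is subtracted, so
     E e < E T. *)
  pose e := Num.min (Num.min 1 (T / 2)) (E T / 4).
  have e0 : 0 < e by rewrite !lt_min ltr01 !divr_gt0.
  have e1 : e <= 1 by rewrite !ge_min lexx.
  have eT : e < T by apply: (@le_lt_trans _ _ (T / 2)); [rewrite !ge_min lexx orbT | lra].
  have eE : e <= E T / 4 by rewrite ge_min lexx orbT.
  have := Edecr e e0 eT; apply/negP; rewrite -ltNge.
  have em : e `^ m <= e by apply: ge1r_powR; [rewrite e0 | exact: ltW].
  have Pe : P e <= e `^ m.
    have := @weighted_primitive_le R m P (fun x => g (V `|x|)) 1 e m1 e0 P0 Pd.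
    move=> /(_ (fun s _ => gn _)) /(le_trans (ler_norm _)) /le_trans; apply.
    by rewrite mul1r ler_pdivrMr // ler_peMr ?powR_ge0 // ltW.
  have Pe0 := Ppos e e0.
  have PPe : e `^ (1 - m) * (P e * P e) <= e.
    apply: (@le_trans _ _ (e `^ (1 - m) * (e `^ m * e `^ m))).
      by rewrite ler_pM2l ?powR_gt0 // ler_pM // ltW.
    rewrite mulrA -powRD ?(gt_eqF e0) ?implybT // subrK powRr1 ?(ltW e0) //.
    by rewrite ger_pMr // (le_trans em).
  have Ve0 : 0 < V e by have /andP[] : 0 < V e < 1 by apply: VT1; rewrite e0.
  have VPe : 0 <= (m - 1) / 2 * (V e * P e).
    by rewrite mulr_ge0 ?divr_ge0 ?subr_ge0 ?(ltW m1) // mulr_ge0 // ltW.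
  have Vg : e `^ m * (V e * g (V e)) / (p + 1) <= e.
    have /andP[gv0 gv1] := g01 (V e).
    have Vg1 : V e * g (V e) <= 1.
      by rewrite -[leRHS]mulr1 ler_pM ?(ltW Ve0) // V1 // ltW.
    have Vg0 : 0 <= V e * g (V e) by rewrite mulr_ge0 // ltW.
    rewrite ler_pdivrMr; last by lra.
    apply: (@le_trans _ _ (e * 1)).
      by apply: ler_pM => //; exact: powR_ge0.
    by rewrite ler_pM2l //; lra.
  rewrite /E; move: ET eE; rewrite -/(E T); lra.
exists P, Q, V; split; last by move=> x x0; rewrite Vpos // V1.
rewrite (_ : (fun x => _) = (fun x => g (V `|x|))) //.
apply/funext => x; rewrite /g clamp_id //.
by rewrite (ltW (Vpos _ _)) // V1.
Unshelve. all: by end_near. Qed.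

End Pohozaev.

(** * Regularity of radial functions *)

Section RadialC2.
Context {R : realType} {n : nat}.
Implicit Types (x y : 'rV[R]_n) (f : 'rV[R]_n -> R) (i j : 'I_n) (s t a c : R).
Notation ei i := (basis_vec R i).

Lemma derive_line f x v a :
  is_derive (0 : R) (1 : R) (fun t : R => f (x + t *: v)) a -> is_derive x v f a.
Proof.
move=> [fd <-].
suff E : (fun h => h^-1 *: ((f \o shift x) (h *: v) - f x)) =
  (fun h => h^-1 *: (((fun t : R => f (x + t *: v)) \o shift 0) (h *: (1 : R)) -
    f (x + 0 *: v))).
  by split; rewrite /derivable /derive /= in fd E *; rewrite E.
apply/funext => h /=; congr (_ *: (f _ - f _)); last by rewrite scale0r addr0.
by rewrite addr0 [_%:A]mulr1 addrC.
Qed.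

(** The difference quotient is at most c |t|. This covers k |t|^(2b) with b >= 1, for which the
    power rule fails at 0. *)
Lemma quadratic_der0 (f : R -> R) c : 0 < c ->
  (forall t, `|t| <= 1 -> `|f t - f 0| <= c * t ^+ 2) -> is_derive (0 : R) (1 : R) f 0.
Proof.
move=> c0 H; apply/is_derive1_caratheodory.
exists (fun z => (f z - f 0) / z); split.
- by move=> z; rewrite subr0; have [->|z0] := eqVneq z 0; [rewrite subrr mulr0 | rewrite divfK].
- apply: cont_eps => e e0; exists (Num.min 1 (e / c)); first by rewrite lt_min ltr01 divr_gt0.
  move=> s; rewrite subr0 subrr mul0r sub0r normrN lt_min => /andP[s1 se].
  have [->|sN] := eqVneq s 0; first by rewrite subrr mul0r normr0 ltW.
  have s0 : 0 < `|s| by rewrite normr_gt0.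
  rewrite normrM normfV ler_pdivrMr //; apply: le_trans (H s (ltW s1)) _.
  rewrite -(real_normK (num_real s)) expr2 mulrA ler_pM2r //.
  by rewrite mulrC -ler_pdivlMr // ltW.
- by rewrite subrr mul0r.
Qed.

Definition radial_profile (F F1 F2 : R -> R) := forall s, 0 < s ->
  [/\ is_derive s 1 F (F1 s), is_derive s 1 F1 (F2 s) & {for s, continuous F2}].

Lemma line_sqn_der x i :
  is_derive (0 : R) (1 : R) (fun t : R => sqn (x + t *: ei i)) (2 * x ord0 i).
Proof. exact: der2_der (line_sqn_der2 x i). Qed.

Lemma neq0_near x : x != 0 -> \forall y \near x, y != 0.
Proof.
by rewrite -sqn_gt0 => /sqn_gt_near; apply: filterS => y; rewrite sqn_gt0.
Qed.

Lemma cont_near f g x : (\forall y \near x, f y = g y) -> {for x, continuous f} ->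
  {for x, continuous g}.
Proof.
move=> fg fc; have gx : g y @[y --> x] --> f x.
  exact: cvg_trans (near_eq_cvg fg) fc.
have fx : f x = g x := nbhs_singleton fg.
by rewrite fx in gx.
Qed.

Lemma coord2_cont x i : {for x, continuous (fun x => 2 * x ord0 i)}.
Proof. by have := contM (@cont_cst R _ 2 x) (@coord_cont R n i x). Qed.

Section Profile.
Context (F F1 F2 : R -> R) (FP : radial_profile F F1 F2).
Local Notation u := (fun x => F (sqn x)).

Lemma radial_derive x i : x != 0 -> is_derive x (ei i) u (2 * x ord0 i * F1 (sqn x)).
Proof.
rewrite -sqn_gt0 => x0; have [Fd _ _] := FP x0; apply: derive_line; rewrite mulrC.
by apply: (@der_comp _ F); [rewrite line0 | exact: line_sqn_der].
Qed.

Lemma radial_partial x i : x != 0 -> partial i u x = 2 * x ord0 i * F1 (sqn x).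
Proof. by move=> x0; rewrite /partial; have [_ ->] := radial_derive i x0. Qed.

Lemma radial_gradient_derive x i j : x != 0 ->
  is_derive x (ei j) (fun x => 2 * x ord0 i * F1 (sqn x))
    (2 * (i == j)%:R * F1 (sqn x) + 4 * x ord0 i * x ord0 j * F2 (sqn x)).
Proof.
rewrite -sqn_gt0 => x0; have [_ F1d _] := FP x0; apply: derive_line.
have D1 : is_derive (0 : R) (1 : R) (fun t : R => 2 * (x + t *: ei j) ord0 i) (2 * (i == j)%:R).
  rewrite (_ : (fun t => _) = (fun t : R => 2 * x ord0 i + 2 * (i == j)%:R * t)); last first.
    by apply/funext => t; rewrite !mxE (eq_sym j i); ring.
  apply: (is_derive_eq (derD (der_cst _ _) (derZ _ (der_id _)))).
  by rewrite add0r mulr1.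
have D2 : is_derive (0 : R) (1 : R) (fun t : R => F1 (sqn (x + t *: ei j)))
    (F2 (sqn x) * (2 * x ord0 j)).
  by apply: (@der_comp _ F1); [rewrite line0 | exact: line_sqn_der].
apply: (is_derive_eq (derM D1 D2)); rewrite scale0r addr0; ring.
Qed.

Lemma radial_partial2 x i j : x != 0 -> is_derive x (ei j) (partial i u)
  (2 * (i == j)%:R * F1 (sqn x) + 4 * x ord0 i * x ord0 j * F2 (sqn x)).
Proof.
move=> x0; apply: near_eq_is_derive (radial_gradient_derive i j x0).
by apply: filterS (neq0_near x0) => y y0; rewrite radial_partial.
Qed.

Lemma radial_C2 : C2_on [set x | x != 0] u.
Proof.
move=> x /= x0; have s0 : 0 < sqn x by rewrite sqn_gt0.
have [Fd F1d F2c] := FP s0.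
split; first exact: radial_cont0 Fd.
move=> i; split; first by have [] := radial_derive i x0.
split.
  apply: (@cont_near (fun x => 2 * x ord0 i * F1 (sqn x))).
    by apply: filterS (neq0_near x0) => y y0; rewrite radial_partial.
  by have := contM (@coord2_cont x i) (radial_cont0 F1d).
move=> j; split; first by have [] := radial_partial2 i j x0.
apply: (@cont_near (fun x => 2 * (i == j)%:R * F1 (sqn x) +
    2 * x ord0 i * (2 * x ord0 j) * F2 (sqn x))).
  apply: filterS (neq0_near x0) => y y0.
  rewrite /partial; have [_ ->] := radial_partial2 i j y0; ring.
have c1 := contM (@cont_cst R _ (2 * (i == j)%:R) x) (radial_cont0 F1d).
have c2 : {for x, continuous (fun x => F2 (sqn x))}.
  exact: (continuous_comp (@sqn_cont R n x) F2c).
by have := contD c1 (contM (contM (@coord2_cont x i) (@coord2_cont x j)) c2).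
Qed.

Lemma radial_laplacian x : x != 0 ->
  laplacian u x = 2 * n%:R * F1 (sqn x) + 4 * sqn x * F2 (sqn x).
Proof.
move=> x0; rewrite /laplacian (eq_bigr (fun i => 2 * F1 (sqn x) +
    4 * F2 (sqn x) * x ord0 i ^+ 2)); last first.
  move=> i _; rewrite /partial; have [_ ->] := radial_partial2 i i x0.
  by rewrite eqxx mulr1; ring.
rewrite big_split /= sumr_const card_ord -mulr_sumr -/(sqn x) -[X in X + _]mulr_natr; ring.
Qed.

(* At the origin only continuity of F1 and of s F2(s), the latter with
   value 0, is needed: this covers F(s) = V(k s^b) with b >= 1. *)
Definition regular_origin (W : 'rV[R]_n -> R) :=
  [/\ {for (0 : 'rV[R]_n), continuous u}, forall i, is_derive (0 : 'rV[R]_n) (ei i) u 0,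
    {for (0 : 'rV[R]_n), continuous (fun x => F1 (sqn x))},
    {for (0 : 'rV[R]_n), continuous W} /\ W 0 = 0 &
    forall x, x != 0 -> W x = sqn x * F2 (sqn x)].

Lemma radial_partialT W i : regular_origin W -> partial i u = fun x => 2 * x ord0 i * F1 (sqn x).
Proof.
move=> [_ u0d _ _ _]; apply/funext => x.
have [->|x0] := eqVneq x 0; last exact: radial_partial.
by rewrite /partial mxE mulr0 mul0r; have [_ ->] := u0d i.
Qed.

Lemma radial_partial2_0 W i j : regular_origin W ->
  is_derive (0 : 'rV[R]_n) (ei j) (partial i u) (2 * (i == j)%:R * F1 0).
Proof.
move=> H; have [_ _ F1c _ _] := H; rewrite (radial_partialT _ H); apply: derive_line.
apply/is_derive1_caratheodory.
exists (fun t => 2 * (i == j)%:R * F1 (sqn (0 + t *: ei j))); split.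
- by move=> t; rewrite !mxE (eq_sym j i); ring.
- have lc : {for (0 : R), continuous (fun t : R => F1 (sqn (0 + t *: ei j)))}.
    apply: (@continuous_comp _ _ _ (fun t : R => 0 + t *: ei j) (fun x => F1 (sqn x))).
      exact: line_cont.
    by rewrite scale0r addr0.
  by have := contM (@cont_cst R _ (2 * (i == j)%:R) (0 : R)) lc.
- by rewrite line0 sqn0.
Qed.

Lemma coord_mul_sqn x i j : `|x ord0 i * x ord0 j| <= sqn x.
Proof.
rewrite -(@ler_sqr _ `|_|) ?nnegrE ?sqn_ge0 // real_normK ?num_real // exprMn.
by rewrite [leRHS]expr2 ler_pM ?sqr_ge0 // coord_sqn.
Qed.

(** The only delicate term of the Hessian at 0 is 4 x_i x_j F''(|x|^2). It is bounded by 4 |W|,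
    which tends to 0 even where F'' is singular. *)
Lemma radial_C2T W : regular_origin W -> C2_on setT u.
Proof.
move=> H; have [uc u0d F1c [Wc W0] WF2] := H.
move=> x _; have [->|x0] := eqVneq x 0; last exact: radial_C2.
split => // i; split; first by have [] := u0d i.
split.
  by rewrite (radial_partialT _ H); have := contM (@coord2_cont 0 i) F1c.
move=> j; split; first by have [] := radial_partial2_0 i j H.
have E : partial j (partial i u) = fun x => 2 * (i == j)%:R * F1 (sqn x) +
    4 * (x ord0 i * x ord0 j * F2 (sqn x)).
  apply/funext => y; have [->|y0] := eqVneq y 0.
    rewrite /partial; have [_ ->] := radial_partial2_0 i j H.
    by rewrite sqn0 !mxE; ring.
  by rewrite /partial; have [_ ->] := radial_partial2 i j y0; ring.
rewrite E.
have c2 : {for (0 : 'rV[R]_n), continuous (fun x => x ord0 i * x ord0 j * F2 (sqn x))}.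
  apply/(@cvgrPdist_le R R^o _ (nbhs (0 : 'rV[R]_n)) _ _ _) => e e0.
  have : \forall y \near (0 : 'rV[R]_n), `|W 0 - W y| <= e.
    exact: ((cvgrPdist_le _ _).1 Wc _ e0).
  apply: filterS => y; rewrite W0 sub0r normrN => We.
  rewrite [X in X * _ * _]mxE !mul0r sub0r normrN; apply: le_trans We.
  have [->|y0] := eqVneq y 0; first by rewrite [X in X * _ * _]mxE !mul0r normr0.
  rewrite WF2 // !normrM (ger0_norm (sqn_ge0 y)) ler_wpM2r // -normrM.
  exact: coord_mul_sqn.
have c1 := contM (@cont_cst R _ (2 * (i == j)%:R) (0 : 'rV[R]_n)) F1c.
by have := contD c1 (contM (@cont_cst R _ 4 (0 : 'rV[R]_n)) c2).
Qed.

Lemma radial_laplacian0 W : regular_origin W -> laplacian u 0 = 2 * n%:R * F1 0.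
Proof.
move=> H; rewrite /laplacian (eq_bigr (fun=> 2 * F1 0)); last first.
  move=> i _; rewrite /partial; have [_ ->] := radial_partial2_0 i i H.
  by rewrite eqxx mulr1.
by rewrite sumr_const card_ord -[LHS]mulr_natr; ring.
Qed.

End Profile.
End RadialC2.

(** * Existence of positive radial solutions *)

Section RadialSolution.
Context {R : realType} {n : nat}.
Implicit Types (x y : 'rV[R]_n) (s t a c sigma p : R).

Lemma sqn_powR_cont a : 0 <= a -> continuous (fun x : 'rV[R]_n => sqn x `^ a).
Proof.
rewrite le_eqVlt => /orP[/eqP <-|a0] x.
  rewrite (_ : (fun x => _) = (fun=> 1)); last by apply/funext => y; rewrite powRr0.
  exact: cont_cst.
rewrite (_ : (fun x => _) = (fun x => `|sqn x| `^ a)); last first.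
  by apply/funext => y; rewrite ger0_norm ?sqn_ge0.
exact: (continuous_comp (@sqn_cont R n x) (abs_powR_cont a0 (x := sqn x))).
Qed.

(** For u = V(t), t = k |x|^(2b), the Laplacian is 4 k b^2 |x|^sigma (t V'' + m V'). The choice of k
    makes the prefactor 4 k b^2 equal to 1, so the weight cancels from the equation. *)
Lemma exists_radial_solution sigma p : (3 <= n)%N -> -2 < sigma ->
  (n%:R + 2 + 2 * sigma) / (n%:R - 2) <= p ->
  exists u : 'rV[R]_n -> R, classical_solution sigma p u /\ forall x, 0 < u x.
Proof.
move=> n3 sg pn; have n3' : 3 <= n%:R :> R by rewrite ler_nat.
pose b := 1 + sigma / 2; have b0 : 0 < b by rewrite /b; lra.
pose k := (4 * b ^+ 2)^-1; have k0 : 0 < k by rewrite invr_gt0 mulr_gt0 // exprn_gt0.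
pose m := 1 + (n%:R - 2) / (2 * b).
have m1E : m - 1 = (n%:R - 2) / (2 * b) by rewrite /m; ring.
have m1 : 1 < m by rewrite -subr_gt0 m1E divr_gt0 //; lra.
have m0 : 0 < m by exact: lt_trans m1.
have pm : m + 1 <= p * (m - 1).
  move: pn; rewrite ler_pdivrMr; last by lra.
  rewrite m1E mulrA ler_pdivlMr ?mulr_gt0 //.
  apply: le_trans; rewrite /m le_eqVlt; apply/orP; left; apply/eqP.
  by rewrite /b; field; move: b0; rewrite /b => b0; rewrite gt_eqF //; lra.
have [P [Q [V [[[P0 V0] Pd Vd Qc [PQ Q0]] V01]]]] := radial_ode_positive m1 pm.
have Q0E : Q 0 = m^-1 by rewrite Q0 normr0 V0 powR1 mul1r.
have Vd0 s : 0 < s -> is_derive s 1 V (- Q s).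
  move=> s0; have s1 : -1 < s by lra.
  by have := Vd s s1; rewrite gtr0_norm.
have Vd00 : is_derive (0 : R) 1 V (- Q 0) by have := Vd 0; rewrite normr0; apply; lra.
have Vc s : 0 <= s -> {for s, continuous V}.
  by move=> s0; apply: der_cont (Vd s _); lra.
have Vpos s : 0 <= s -> 0 < V s by move=> s0; have /andP[] := V01 s s0.
have Qd s : 0 < s -> is_derive s 1 Q ((V s `^ p - m * Q s) / s).
  move=> s0; have s1 : -1 < s by lra.
  have D := derM (is_derive1_powR (- m) s0) (Pd s s1).
  apply: (@der_near _ (fun t => t `^ (- m) * P t)).
    near=> t; have t0 : 0 < t by near: t; exact: near_pos.
    by rewrite PQ // mulrA -powRD ?(gt_eqF t0) ?implybT // addNr powRr0 mul1r.
  apply: (is_derive_eq D); rewrite PQ // gtr0_norm //.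
  have S1 : s `^ (m - 1) = s `^ m / s.
    by rewrite -(powR_mulVV m s0) mulrAC mulfV ?mul1r // gt_eqF.
  have S2 : s `^ (- m - 1) = s `^ (- m) / s.
    by rewrite -(powR_mulVV (- m) s0) mulrAC mulfV ?mul1r // gt_eqF.
  by rewrite S1 S2 powRN; field; rewrite !gt_eqF ?powR_gt0.
pose T s := k * s `^ b.
have T0 s : 0 < s -> 0 < T s by move=> s0; rewrite mulr_gt0 // powR_gt0.
have T_ge0 s : 0 <= T s by rewrite mulr_ge0 ?powR_ge0 // ltW.
pose F s := V (T s).
pose F1 s := - (k * b) * (Q (T s) * s `^ (b - 1)).
(* F'' after t V'' has been eliminated by the differential equation. At t = 0, V = 1 and Q = 1/m, so
   the first summand vanishes; hence s F''(s) tends to 0 also when b = 1. *)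
pose B t := b * (V t `^ p - m * Q t) + (b - 1) * Q t.
pose F2 s := - (k * b) * (B (T s) * s `^ (b - 2)).
have Td s : 0 < s -> is_derive s 1 T (k * (b * s `^ (b - 1))).
  by move=> s0; exact: derZ (is_derive1_powR b s0).
have FP : radial_profile F F1 F2.
  move=> s s0; have Ts := T0 s s0; split.
  - by apply: (is_derive_eq (der_comp (Vd0 _ Ts) (Td s s0))); rewrite /F1; ring.
  - have D := derZ (- (k * b)) (derM (der_comp (Qd _ Ts) (Td s s0)) (is_derive1_powR (b - 1) s0)).
    apply: (is_derive_eq D); rewrite /F2 /B.
    have E1 : s `^ (b - 1) = s * s `^ (b - 2) by rewrite powR_mulV.
    have E2 : b - 1 - 1 = b - 2 by ring.
    have E3 : T s = k * (s * (s * s `^ (b - 2))).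
      by rewrite /T -(powR_mulVV b s0) -(powR_mulV b s0).
    rewrite E2; move: (V (T s) `^ p) (Q (T s)) => v q; rewrite E3 E1.
    by field; rewrite !gt_eqF ?powR_gt0.
  - have cV : {for s, continuous (fun s => V (T s) `^ p)}.
      have D := is_derive1_powR p (Vpos _ (T_ge0 s)).
      exact: der_cont (der_comp D (der_comp (Vd0 _ Ts) (Td s s0))).
    have cQ : {for s, continuous (fun s => Q (T s))}.
      exact: der_cont (der_comp (Qd _ Ts) (Td s s0)).
    have cb := der_cont (is_derive1_powR (b - 2) s0).
    have c1 := contM (@cont_cst R R b s) (contB cV (contM (@cont_cst R R m s) cQ)).
    have c2 := contM (@cont_cst R R (b - 1) s) cQ.
    by have := contM (@cont_cst R R (- (k * b)) s) (contM (contD c1 c2) cb).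
pose u x := F (sqn x).
have cTx x : {for x, continuous (fun x => T (sqn x))}.
  by have := contM (@cont_cst R _ k x) (sqn_powR_cont (ltW b0) (x := x)).
have uc : continuous u by move=> x; exact: (continuous_comp (cTx x) (Vc _ (T_ge0 _))).
have eqn x : x != 0 -> - laplacian u x = eucl_norm x `^ sigma * u x `^ p.
  move=> x0; have s0 : 0 < sqn x by rewrite sqn_gt0.
  rewrite (radial_laplacian FP x0) eucl_norm_powR /u /F1 /F2 /B /F.
  have E1 : sqn x `^ (sigma / 2) = sqn x * sqn x `^ (b - 2).
    by rewrite powR_mulV // /b; congr (_ `^ _); ring.
  rewrite E1 -(powR_mulV b s0) /k /m.
  move: (V (T (sqn x)) `^ p) (Q (T (sqn x))) (sqn x `^ (b - 2)) => v q w.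
  by field; rewrite gt_eqF.
exists u; split; last by move=> x; exact: Vpos.
rewrite /classical_solution; case: ifP => [sg0|_]; last first.
  split; first by split; [exact: uc | exact: radial_C2 FP].
  by move=> x x0; split; [move=> _; exact: Vpos | exact: eqn].
(* From here sigma >= 0, so regularity and the equation are due at the origin as well. *)
have b1 : 0 <= b - 1 by rewrite /b; lra.
have cQx x : {for x, continuous (fun x => Q (T (sqn x)))}.
  rewrite (_ : (fun x => _) = (fun x => Q `|T (sqn x)|)); last first.
    by apply/funext => y; rewrite ger0_norm.
  exact: (continuous_comp (cTx x) (Qc _)).
have cb x := sqn_powR_cont b1 (x := x).
pose W x := - (k * b) * (B (T (sqn x)) * sqn x `^ (b - 1)).
have T00 : T (sqn (0 : 'rV[R]_n)) = 0 by rewrite sqn0 /T powR0 ?mulr0 // gt_eqF.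
have reg : regular_origin F F1 F2 W.
  split.
  - exact: uc.
  - move=> i; apply: derive_line.
    have Td00 : is_derive (0 : R) 1 (fun t : R => T (sqn (0 + t *: basis_vec R i))) 0.
      apply: (quadratic_der0 k0) => t t1.
      rewrite !sqn_line sqn0 mxE !mulr0 !add0r expr0n /= /T powR0 ?gt_eqF // mulr0 subr0.
      rewrite normrM (gtr0_norm k0) ger0_norm ?powR_ge0 // ler_pM2l //.
      have [->|tN] := eqVneq t 0; first by rewrite expr0n /= powR0 ?gt_eqF.
      apply: ge1r_powR; last by rewrite /b; lra.
      rewrite exprn_even_gt0 //= tN /= -(real_normK (num_real t)).
      by rewrite expr_le1.
    have D : is_derive (T (sqn ((0 : 'rV[R]_n) + (0 : R) *: basis_vec R i))) 1 V (- Q 0).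
      by rewrite scale0r addr0 T00.
    by have E := @der_comp _ V _ (0 : R) _ _ D Td00; rewrite mulr0 in E; exact: E.
  - by have := contM (@cont_cst R _ (- (k * b)) (0 : 'rV[R]_n)) (contM (cQx 0) (cb 0)).
  - split.
      have cV : {for (0 : 'rV[R]_n), continuous (fun x => V (T (sqn x)) `^ p)}.
        have V00 : 0 < V (T (sqn (0 : 'rV[R]_n))) by exact: Vpos.
        exact: (continuous_comp (uc 0) (der_cont (is_derive1_powR p V00))).
      have c1 := contM (@cont_cst R _ b (0 : 'rV[R]_n))
        (contB cV (contM (@cont_cst R _ m (0 : 'rV[R]_n)) (cQx 0))).
      have c2 := contM (@cont_cst R _ (b - 1) (0 : 'rV[R]_n)) (cQx 0).
      by have := contM (@cont_cst R _ (- (k * b)) (0 : 'rV[R]_n)) (contM (contD c1 c2) (cb 0)).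
    rewrite /W /B T00 Q0E V0 powR1 mulfV ?gt_eqF // subrr mulr0 add0r sqn0.
    have [->|bN] := eqVneq (b - 1) 0; first by rewrite mul0r mul0r mulr0.
    by rewrite powR0 // !mulr0.
  - move=> x x0; have s0 : 0 < sqn x by rewrite sqn_gt0.
    by rewrite /W /F2 -(powR_mulV b s0); ring.
split; first exact: (radial_C2T FP reg).
move=> x _; split; first by move=> _; exact: Vpos.
have [->|x0] := eqVneq x 0; last exact: eqn.
rewrite (radial_laplacian0 FP reg) eucl_norm_powR sqn0 /F1 /u /F T00 V0 powR1 mulr1.
have T0' : T 0 = 0 by move: T00; rewrite sqn0.
rewrite T0' Q0E (_ : sigma / 2 = b - 1); last by rewrite /b; ring.
(* For sigma > 0 both sides vanish at the origin. For sigma = 0 the weight is 0^0 = 1, and k = 1/4,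
   m = n/2 make the left side 1. *)
have [bE|bN] := eqVneq (b - 1) 0; last by rewrite powR0 // !mulr0 oppr0.
have b1' : b = 1 by lra.
rewrite bE powRr0 /k /m b1'; field; rewrite gt_eqF //; lra.
Unshelve. all: by end_near. Qed.

End RadialSolution.

Local Close Scope classical_set_scope.

Theorem theorem1p1 (R : realType) (n : nat) (p sigma : R) :
  (2 <= n)%N ->
  ((exists u : 'rV[R]_n -> R,
      classical_solution sigma p u /\
      (forall x, 0 <= u x) /\ (exists x, u x != 0))
   <->
   [/\ (3 <= n)%N, (n%:R + 2 + 2 * sigma) / (n%:R - 2) <= p & -2 < sigma]).
Proof.
move=> n2; split.
  move=> [u [uS [u0 un0]]].
  exact: solution_necessary (classical_solution_positive n2 uS u0 un0).
move=> [n3 pn sg]; have [u [uS u0]] := exists_radial_solution n3 sg pn.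
exists u; split => //; split; first by move=> x; exact: ltW.
by exists 0; rewrite gt_eqF.
Qed.
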